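(* Let $X$ be a complex vector space with $\dim_{\mathbb{C}}X\ge2$, $Y\ne\{0\}$ a sequentially complete Hausdorff complex locally convex space, and $K\subset\Omega\subset X$ such that $\Omega$ and $\Omega\setminus K$ are $2$-open and $\Omega\setminus K$ is polygonally connected. Assume there exists $u\in X\setminus\{0\}$ such that: (i) for all $a\in\Omega$ and $v\in X$ there is $\varepsilon>0$ such that $K\cap L_a(u,v[\varepsilon])$ is compact in $L_a(u,v)$; (ii) $K\cap L_c(u)=\emptyset$ for some $c\in\Omega$. Then every $f\in\mathcal{H}_G(\Omega\setminus K,Y)$ has a unique extension $\tilde f\in\mathcal{H}_G(\Omega,Y)$, and $\tilde f(\Omega)\subset\overline{\mathrm{co}}(f(\Omega\setminus K))$. If $Y=\mathbb{C}$, then $\tilde f(\Omega)=f(\Omega\setminus K)$.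
   Context: $L_a(u):=a+\mathbb{C}u$, $L_a(u,v):=a+\mathbb{C}u+\mathbb{C}v$ (with Euclidean topology), and $L_a(u,v[\varepsilon]):=L_a(u)+\{\lambda\in\mathbb{C}:|\lambda|\le\varepsilon\}\cdot v$. $A\subset X$ is $2$-open if $A\cap L$ is open in $L$ for every complex affine subspace $L$ of dimension $1$ or $2$. Polygonally connected: any two points joined by a polygonal chain in the set. $\mathcal{H}_G(U,Y)$: maps with $\lambda\mapsto\varphi(f(a+\lambda v))$ holomorphic near $0$ for all $a\in U,v\in X,\varphi\in Y^*$. $\overline{\mathrm{co}}$: closed convex hull. *)

(* Defs.v *)
From mathcomp Require Import all_boot all_order all_algebra.
From mathcomp Require Import all_classical all_reals all_analysis.
From mathcomp Require Export complex.
Import numFieldNormedType.Exports.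

Set Implicit Arguments.
Unset Strict Implicit.
Unset Printing Implicit Defensive.

Import Order.TTheory GRing.Theory Num.Theory.
Local Open Scope ring_scope.
Local Open Scope classical_set_scope.

(* The complex numbers are R[i] for R : realType; the Euclidean topology of
   C is the norm topology, carried by the alias R[i]^o. *)
Notation Cx R := (R[i])^o.

Section Defs.
Variable R : realType.
Local Notation C := (Cx R).

Definition indep2 (X : lmodType C) (u v : X) : Prop :=
  forall alpha beta : C, alpha *: u + beta *: v = 0 -> alpha = 0 /\ beta = 0.

Definition dim_ge2 (X : lmodType C) : Prop := exists u v : X, indep2 u v.

Definition Laff1 (X : lmodType C) (a u : X) : set X :=
  [set x | exists lam : C, x = a + lam *: u].

Definition Laff2 (X : lmodType C) (a u v : X) : set X :=
  [set x | exists lam mu : C, x = a + lam *: u + mu *: v].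

Definition Laff2_eps (X : lmodType C) (a u v : X) (eps : R) : set X :=
  [set x | exists lam mu : C, `|mu| <= eps%:C%C /\ x = a + lam *: u + mu *: v].

(* A is 2-open: A /\ L is open in L (Euclidean topology of L) for every
   complex affine subspace L of dimension 1 or 2.  The Euclidean topology of
   L = a + C u (u <> 0), resp. L = a + C u + C v (u, v independent), is
   transported from C, resp. C x C, by the affine parametrisation. *)
Definition two_open (X : lmodType C) (A : set X) : Prop :=
  (forall a u : X, u != 0 -> open [set lam : C | A (a + lam *: u)]) /\
  (forall a u v : X, indep2 u v ->
     open [set p : C * C | A (a + p.1 *: u + p.2 *: v)]).

(* S (a subset of L_a(u,v), with u <> 0) is compact in L_a(u,v) equipped
   with its Euclidean topology: L_a(u,v) is a plane when u, v are
   independent, and the line L_a(u) otherwise. *)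
Definition compact_in_Laff2 (X : lmodType C) (a u v : X) (S : set X) : Prop :=
  (indep2 u v /\ compact [set p : C * C | S (a + p.1 *: u + p.2 *: v)]) \/
  (~ indep2 u v /\ compact [set lam : C | S (a + lam *: u)]).

Definition segment (X : lmodType C) (x y : X) : set X :=
  [set z | exists t : R, 0 <= t <= 1 /\ z = (1 - t)%:C%C *: x + t%:C%C *: y].

Definition polygonally_connected (X : lmodType C) (A : set X) : Prop :=
  forall p q, A p -> A q ->
    exists (n : nat) (xs : nat -> X), xs 0%N = p /\ xs n = q /\
      forall i, (i < n)%N -> segment (xs i) (xs i.+1) `<=` A.

Definition dual_elt (Y : tvsType C) (phi : Y -> C) : Prop :=
  (forall (c : C) (x y : Y), phi (c *: x + y) = c * phi x + phi y) /\
  continuous phi.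

Definition holo_near0_on (D : set C) (g : C -> C) : Prop :=
  exists r : R, 0 < r /\
    forall z : C, `|z| < r%:C%C -> D z /\ derivable g z 1.

(* f in H_G(U, Y) (only the values of f on U matter) *)
Definition HG (X : lmodType C) (Y : tvsType C) (U : set X) (f : X -> Y) : Prop :=
  forall (a : X) (v : X) (phi : Y -> C), U a -> dual_elt phi ->
    holo_near0_on [set lam | U (a + lam *: v)] (fun lam => phi (f (a + lam *: v))).

Definition seq_complete (Y : tvsType C) : Prop :=
  forall u : nat -> Y,
    (forall N : set Y, nbhs 0 N ->
       exists n0, forall m n, (n0 <= m)%N -> (n0 <= n)%N -> N (u m - u n)) ->
    exists y : Y, u @ \oo --> y.

Definition closed_conv_hull (Y : tvsType C) (A : set Y) : set Y :=
  [set y | forall B : set Y, A `<=` B -> convex_set (B : set (convex_lmodType Y)) ->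
     closed B -> B y].

End Defs.

(* Main.v *)
(* On the slice [a + C u] the extension is given by Cauchy's formula: it is the integral of [f (a +
z u) / (2 i pi z)] over a cycle of the slice of [Omega] that surrounds [0] and the slice of [K]. By
(i) the same cycle serves for all [a + l v] with [l] small. Since [f] is only Gateaux holomorphic,
Hartogs' theorem on separate holomorphy is needed to bound it near the cycle and to differentiate
under the integral sign. The extension agrees with [f] near the slice of (ii), and the identity
theorem along polygons carries this to all of [Omega \ K].

For vector values the midpoint sums of the integral have increments that are weakly O(2^-n), hence
O(2^-n) since weakly bounded sequences are bounded (Hahn-Banach and a gliding hump); so they
converge by sequential completeness. Continuous functionals then reduce everything to the scalar
case. For the convex hull, a half-plane that contains the values of [phi o f] is exhausted by large
discs, on which the maximum principle applies. If a value [w] of the extension were not a value of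
[f], the extension of [1 / (f - w)] would be an inverse of the extension of [f - w]. *)
Require Import Defs.
From mathcomp Require Import all_boot all_order all_algebra.
From mathcomp Require Import all_classical all_reals all_analysis.
From mathcomp Require Import complex.
From mathcomp Require Import ring lra zify.
Import numFieldNormedType.Exports.
Import Order.TTheory GRing.Theory Num.Theory.
Local Open Scope ring_scope.
Local Open Scope classical_set_scope.
Set Implicit Arguments.
Unset Strict Implicit.
Unset Printing Implicit Defensive.
Local Notation Re := (@complex.Re _).
Local Notation Im := (@complex.Im _).

(** Almost every passage from local to global is one bisection argument: a property of segments or
    triangles that passes from the pieces of a midpoint subdivision to the whole, and holds for all
    small pieces near each point, holds everywhere ([cousin_seg], [cousin_tri]). Integrals are
    limits of dyadic averages for this reason: they split exactly at midpoints, make sense in any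
    vector space and commute with linear maps. Contours consist of sides that lie in half-planes or
    grid cells, so convexity replaces homotopy, and no angle or winding number is computed. Cauchy's
    formula then carries a constant known only to be nonzero; sharp inequalities are recovered by
    applying crude ones to powers of a function. The same device shapes Hartogs' lemma: in place of
    subharmonic functions it uses an explicit rational function, raised to a power proportional to
    the index of the Taylor coefficient. The main obstacle throughout is that [f] has no continuity
    across slices, so every uniformity in the parameter [l] has to come either from compactness of a
    segment or a cell, or from Hartogs' theorem. *)

Section Modulus.
Variable R : realType.
Local Notation C := R[i].
Implicit Types z w : C.

(* The norm of [R[i]] takes its values in [R[i]]; [nm] is the real number behind it. *)
Definition nm z : R := ComplexField.Normc.normc z.

Lemma nmE z : `|z| = (nm z)%:C%C.
Proof. by []. Qed.

Lemma nm0 : nm 0 = 0. Proof. exact: ComplexField.Normc.normc0. Qed.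
Lemma nm1 : nm 1 = 1. Proof. exact: ComplexField.Normc.normc1. Qed.
Lemma nmM z w : nm (z * w) = nm z * nm w.
Proof. exact: ComplexField.Normc.normcM. Qed.
Lemma nmV z : nm z^-1 = (nm z)^-1.
Proof. exact: ComplexField.Normc.normcV. Qed.
Lemma nmD z w : nm (z + w) <= nm z + nm w.
Proof. by have := ler_normD z w; rewrite !nmE -rmorphD lecR. Qed.
Lemma nmN z : nm (- z) = nm z.
Proof. by have := normrN z; rewrite !nmE => /complexI. Qed.
Lemma nm_ge0 z : 0 <= nm z.
Proof. by have := normr_ge0 z; rewrite nmE lecR. Qed.
Lemma nm_eq0 z : (nm z == 0) = (z == 0).
Proof. by have := normr_eq0 z; rewrite nmE -(rmorph0 (real_complex R)) (inj_eq (@complexI R)). Qed.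
Lemma nm_gt0 z : (0 < nm z) = (z != 0).
Proof. by rewrite lt0r nm_ge0 nm_eq0 andbT. Qed.
Lemma nmX z n : nm (z ^+ n) = nm z ^+ n.
Proof. by elim: n => [|n IH]; rewrite ?expr0 ?nm1// !exprS nmM IH. Qed.
Lemma nmBC z w : nm (z - w) = nm (w - z).
Proof. by rewrite -nmN opprB. Qed.
Lemma nmB z w : nm (z - w) <= nm z + nm w.
Proof. by rewrite (le_trans (nmD _ _))// nmN. Qed.
Lemma nm_tri w z z' : nm (z - z') <= nm (z - w) + nm (w - z').
Proof. by apply: le_trans (nmD _ _); rewrite addrA subrK. Qed.
Lemma nm_ge z w : nm z - nm w <= nm (z + w).
Proof. by have := nmD (z + w) (- w); rewrite addrK nmN lerBlDr. Qed.
Lemma nmR (r : R) : nm r%:C%C = `|r|.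
Proof. by rewrite /nm/= expr0n addr0 sqrtr_sqr. Qed.
Lemma nm_nat n : nm n%:R = n%:R.
Proof. by rewrite -(rmorph_nat (real_complex R)) nmR normr_nat. Qed.
Lemma nm_i : nm 'i%C = 1.
Proof. by rewrite /nm/= expr0n expr1n add0r sqrtr1. Qed.
Lemma nm_Re z : `|Re z| <= nm z.
Proof.
by case: z => a b; rewrite /nm/= -sqrtr_sqr ler_sqrt ?addr_ge0 ?sqr_ge0// lerDl sqr_ge0.
Qed.
Lemma nm_Im z : `|Im z| <= nm z.
Proof.
by case: z => a b; rewrite /nm/= -sqrtr_sqr ler_sqrt ?addr_ge0 ?sqr_ge0// lerDr sqr_ge0.
Qed.
Lemma nm_ReIm z : nm z <= `|Re z| + `|Im z|.
Proof.
case: z => a b; have -> : (a +i* b)%C = a%:C%C + 'i%C * b%:C%C by simpc.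
by apply: (le_trans (nmD _ _)); rewrite nmM nm_i mul1r !nmR/=; simpc.
Qed.
Lemma nm_eq0P z : (forall e, 0 < e -> nm z <= e) -> z = 0.
Proof.
move=> h; apply/eqP; rewrite -nm_eq0; apply/eqP/le_anti; rewrite nm_ge0 andbT.
by apply/ler_addgt0Pl => e /h; rewrite addr0.
Qed.

Lemma nm_sum (I : Type) (r : seq I) (P : pred I) (F : I -> C) :
  nm (\sum_(i <- r | P i) F i) <= \sum_(i <- r | P i) nm (F i).
Proof.
elim/big_ind2: _ => [|z a w b za wb|//]; first by rewrite nm0.
by apply: (le_trans (nmD _ _)); exact: lerD.
Qed.

Definition clim (u : nat -> C) (l : C) : Prop :=
  forall e : R, 0 < e -> exists N : nat, forall n, (N <= n)%N -> nm (u n - l) <= e.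

Lemma clim_uniq u l l' : clim u l -> clim u l' -> l = l'.
Proof.
move=> ul ul'; apply/eqP; rewrite -subr_eq0; apply/eqP/nm_eq0P => e e0.
have e2 : 0 < e / 2 by rewrite divr_gt0.
have [N hN] := ul _ e2; have [N' hN'] := ul' _ e2.
apply: (le_trans (nm_tri (u (maxn N N')) _ _)).
rewrite [e]splitr lerD//; last by apply: hN'; exact: leq_maxr.
by rewrite nmBC; apply: hN; exact: leq_maxl.
Qed.

Lemma clim_cst l : clim (fun=> l) l.
Proof. by move=> e e0; exists 0%N => n _; rewrite subrr nm0 ltW. Qed.

Lemma clim_ext u v l : u =1 v -> clim u l -> clim v l.
Proof. by move=> uv ul e /ul[N hN]; exists N => n /hN; rewrite uv. Qed.

Lemma climD u v l l' : clim u l -> clim v l' -> clim (fun n => u n + v n) (l + l').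
Proof.
move=> ul vl e e0; have e2 : 0 < e / 2 by rewrite divr_gt0.
have [N hN] := ul _ e2; have [N' hN'] := vl _ e2.
exists (maxn N N') => n; rewrite geq_max => /andP[/hN h1 /hN' h2].
by rewrite opprD addrACA [e]splitr (le_trans (nmD _ _))// lerD.
Qed.

Lemma climZ c u l : clim u l -> clim (fun n => c * u n) (c * l).
Proof.
move=> ul e e0; have c0 : 0 < nm c + 1 by rewrite ltr_pwDr// nm_ge0.
have [N hN] := ul _ (divr_gt0 e0 c0); exists N => n /hN h.
rewrite -mulrBr nmM (le_trans (ler_wpM2l (nm_ge0 _) h))//.
by rewrite mulrCA -{2}[e]mulr1 ler_pM2l// ler_pdivrMr// mul1r lerDl.
Qed.

Lemma climS u l : clim (fun n => u n.+1) l -> clim u l.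
Proof. by move=> h e /h[N hN]; exists N.+1 => -[//|n]; exact: hN. Qed.

Lemma R_cauchy_cvg (u : nat -> R) :
  (forall e, 0 < e -> exists N : nat, forall m n, (N <= m)%N -> (N <= n)%N ->
     `|u m - u n| <= e) ->
  exists l, forall e, 0 < e -> exists N : nat, forall n, (N <= n)%N -> `|u n - l| <= e.
Proof.
move=> h.
have /cvg_ex[l ul] : cvgn u.
  apply: cauchy_cvg; apply: cauchy_exP => e e0.
  have [N hN] := h _ (divr_gt0 e0 (ltr0n R 2)).
  exists (u N); exists N => // n /= Nn; rewrite /ball/= (le_lt_trans (hN _ _ _ Nn))//.
  by rewrite ltr_pdivrMr// ltr_pMr// ltr1n.
exists l => e e0; move/cvgrPdist_le: ul => /(_ _ e0)[N _ hN].
by exists N => n /hN /=; rewrite distrC.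
Qed.

Lemma C_cauchy_cvg (u : nat -> C) :
  (forall e, 0 < e -> exists N : nat, forall m n, (N <= m)%N -> (N <= n)%N ->
     nm (u m - u n) <= e) -> exists l, clim u l.
Proof.
move=> h.
have [|a ha] := @R_cauchy_cvg (fun n => Re (u n)).
  move=> e /h[N hN]; exists N => m n Nm Nn; apply: le_trans (hN _ _ Nm Nn).
  by rewrite -[Re _ - _](raddfB (@complex.Re R : Rcomplex R -> R)) nm_Re.
have [|b hb] := @R_cauchy_cvg (fun n => Im (u n)).
  move=> e /h[N hN]; exists N => m n Nm Nn; apply: le_trans (hN _ _ Nm Nn).
  by rewrite -[Im _ - _](raddfB (@complex.Im R : Rcomplex R -> R)) nm_Im.
exists (a +i* b)%C => e e0; have e2 : 0 < e / 2 by rewrite divr_gt0.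
have [N hN] := ha _ e2; have [N' hN'] := hb _ e2.
exists (maxn N N') => n; rewrite geq_max => /andP[/hN h1 /hN' h2].
rewrite (le_trans (nm_ReIm _))// [e]splitr lerD//; first by case: (u n) h1.
by case: (u n) h2.
Qed.

Lemma geometric_cauchy (u : nat -> C) (d : R) :
  (forall n, nm (u n.+1 - u n) <= d * 2^-1 ^+ n) ->
  exists2 l, clim u l & forall n, nm (u n - l) <= 2 * (d * 2^-1 ^+ n).
Proof.
move=> h.
have d0 : 0 <= d by have := le_trans (nm_ge0 _) (h 0%N); rewrite expr0 mulr1.
(* Keeping the negative tail term makes the induction on [m] close; [key2] drops it. *)
have key n m : nm (u (n + m)%N - u n) <= 2 * (d * 2^-1 ^+ n) - 2 * (d * 2^-1 ^+ (n + m)).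
  elim: m => [|m IH]; first by rewrite addn0 !subrr nm0.
  rewrite addnS; apply: (le_trans (nm_tri (u (n + m)%N) _ _)).
  have -> : 2 * (d * 2^-1 ^+ n) - 2 * (d * 2^-1 ^+ (n + m).+1) = 
     d * 2^-1 ^+ (n + m) + (2 * (d * 2^-1 ^+ n) - 2 * (d * 2^-1 ^+ (n + m))).
    rewrite exprS; lra.
  exact: lerD.
have key2 n m : nm (u (n + m)%N - u n) <= 2 * (d * 2^-1 ^+ n).
  by apply: (le_trans (key n m)); rewrite lerBlDr lerDl !mulr_ge0// exprn_ge0// invr_ge0.
have small e : 0 < e -> exists N, forall n, (N <= n)%N -> 2 * (d * 2^-1 ^+ n) <= e.
  move=> e0.
  have := @cvg_geometric R (2 * d) 2^-1.
  rewrite ger0_norm ?invr_ge0// invf_lt1// ltr1n => /(_ isT)/cvgrPdist_le/(_ _ e0)[N _ hN].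
  exists N => n /hN /=; rewrite sub0r normrN mulrA ger0_norm//.
  by rewrite !mulr_ge0// exprn_ge0// invr_ge0.
have [|l ul] := @C_cauchy_cvg u.
  move=> e e0; have [N hN] := small _ (divr_gt0 e0 (ltr0n R 2)).
  exists N => m n Nm Nn; apply: (le_trans (nm_tri (u N) _ _)).
  rewrite [e]splitr lerD//; last rewrite nmBC.
    by rewrite -(subnKC Nm) (le_trans (key2 _ _))// hN.
  by rewrite -(subnKC Nn) (le_trans (key2 _ _))// hN.
exists l => // n; apply/ler_addgt0Pl => e /ul[N hN].
apply: (le_trans (nm_tri (u (n + N)%N) _ _)); rewrite addrC lerD//.
  by apply: hN; exact: leq_addl.
by rewrite nmBC key2.
Qed.

End Modulus.
Arguments nm {R} z : simpl never.

(** * Integrals along segments and Cauchy's theorem *)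

Section Average.
Variable R : realType.
Local Notation C := R[i].
Implicit Types p q r z w : C.

Definition mid p q : C := 2^-1 * (p + q).

Lemma midC p q : mid p q = mid q p. Proof. by rewrite /mid addrC. Qed.
Lemma midpp p : mid p p = p.
Proof. by rewrite /mid; field. Qed.
Lemma nm_half : nm (2^-1 : C) = 2^-1.
Proof. by rewrite nmV nm_nat. Qed.

(* The average of [h] at the midpoints of [2^n] equal pieces of the segment [p, q]. *)
Fixpoint av (V : lmodType C) n (h : C -> V) p q : V :=
  if n is m.+1 then 2^-1 *: (av m h p (mid p q) + av m h (mid p q) q) else h (mid p q).

Definition midclosed (E : set C) := forall p q, E p -> E q -> E (mid p q).
Definition climclosed (E : set C) := forall u l, (forall n, E (u n)) -> clim u l -> E l.
(** Stands for the closed convex sets of the plane: bisection uses only midpoints, and nested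
    bisections only sequential limits. General convex combinations are recovered in [sg_sub]. *)
Definition cconv E := midclosed E /\ climclosed E.

Lemma av_in (V : lmodType C) (B : set V) (E : set C) n (h : C -> V) p q :
  midclosed E -> (forall x y, B x -> B y -> B (2^-1 *: (x + y))) ->
  (forall z, E z -> B (h z)) -> E p -> E q -> B (av n h p q).
Proof.
move=> mE mB hB; elim: n p q => [|n IH] p q Ep Eq /=; first exact/hB/mE.
by apply: mB; apply: IH => //; exact: mE.
Qed.

(** Averages are finite sums, so a functional passes through them at every level [n]; this reduces
    vector integrals to scalar ones. *)
Lemma av_lin (V W : lmodType C) (f : V -> W) n (h : C -> V) p q :
  (forall (c : C) x y, f (c *: x + y) = c *: f x + f y) ->
  f (av n h p q) = av n (fun z => f (h z)) p q.
Proof.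
move=> lf.
have fD x y : f (x + y) = f x + f y by rewrite -[x]scale1r lf !scale1r.
have f0 : f 0 = 0 by apply: (addrI (f 0)); rewrite -fD !addr0.
have fZ c x : f (c *: x) = c *: f x by rewrite -[c *: x]addr0 lf f0 addr0.
by elim: n p q => [|n IH] p q //=; rewrite fZ fD !IH.
Qed.

Lemma av_eq (V : lmodType C) (E : set C) n (h h' : C -> V) p q :
  midclosed E -> (forall z, E z -> h z = h' z) -> E p -> E q -> av n h p q = av n h' p q.
Proof.
move=> mE hh; elim: n p q => [|n IH] p q Ep Eq /=; first exact/hh/mE.
by rewrite !IH//; exact: mE.
Qed.

Lemma av_rev (V : lmodType C) n (h : C -> V) p q : av n h q p = av n h p q.
Proof.
by elim: n p q => [|n IH] p q /=; rewrite midC // IH (IH p) addrC.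
Qed.

Lemma mid_affine a b p q : mid (a * p + b) (a * q + b) = a * mid p q + b.
Proof. by rewrite /mid; field. Qed.

Lemma av_affine (V : lmodType C) n (h : C -> V) a b p q :
  av n (fun z => h (a * z + b)) p q = av n h (a * p + b) (a * q + b).
Proof. by elim: n p q => [|n IH] p q /=; rewrite mid_affine// !IH. Qed.

Lemma avD (V : lmodType C) n (h h' : C -> V) p q :
  av n (fun z => h z + h' z) p q = av n h p q + av n h' p q.
Proof. by elim: n p q => [|n IH] p q //=; rewrite !IH addrACA scalerDr. Qed.

Lemma avZ (V : lmodType C) n (h : C -> V) c p q :
  av n (fun z => c *: h z) p q = c *: av n h p q.
Proof.
by elim: n p q => [|n IH] p q //=; rewrite !IH -scalerDr !scalerA mulrC.
Qed.

Local Notation avC := (@av C^o).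

Lemma av_cst n (c : C) p q : avC n (fun=> c) p q = c.
Proof. by elim: n p q => [|n IH] p q //=; rewrite !IH; exact: midpp. Qed.

(** The midpoint rule is exact for affine functions, which gives the integral of the affine part in
    Goursat's estimate. *)
Lemma av_id n p q : avC n id p q = mid p q.
Proof.
elim: n p q => [|n IH] p q //=; rewrite !IH.
change (2^-1 * (mid p (mid p q) + mid (mid p q) q) = mid p q); by rewrite /mid; field.
Qed.

Definition intg (h : C -> C) p q := exists l, clim (fun n => avC n h p q) l.
(* The integral from [p] to [q], and [0] when the averages diverge. *)
Definition J (h : C -> C) p q : C :=
  (q - p) * xget 0 [set l | clim (fun n => avC n h p q) l].

Lemma J_lim h p q l : clim (fun n => avC n h p q) l -> J h p q = (q - p) * l.
Proof.
move=> hl; rewrite /J; congr (_ * _).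
by case: xgetP => [x _ /= hx|/(_ l)//]; exact: clim_uniq hx hl.
Qed.

Lemma J_ext (E : set C) h h' p q : midclosed E -> (forall z, E z -> h z = h' z) ->
  E p -> E q -> J h p q = J h' p q.
Proof.
move=> mE hh Ep Eq; rewrite /J; congr (_ * xget _ _); apply/funext => l.
by congr (clim _ _); apply/funext => n; exact: (@av_eq C^o E).
Qed.

Lemma intg_ext (E : set C) h h' p q : midclosed E -> (forall z, E z -> h z = h' z) ->
  E p -> E q -> intg h p q -> intg h' p q.
Proof.
move=> mE hh Ep Eq [l hl]; exists l; apply: clim_ext hl => n.
exact: (@av_eq C^o E).
Qed.

Lemma J_rev h p q : J h q p = - J h p q.
Proof.
rewrite /J -mulNr opprB; congr (_ * xget _ _); apply/funext => l.
by congr (clim _ _); apply/funext => n; rewrite av_rev.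
Qed.

Lemma J_affine h a b p q :
  a * J (fun z => h (a * z + b)) p q = J h (a * p + b) (a * q + b).
Proof.
rewrite /J mulrA; congr (_ * xget _ _); first by rewrite opprD addrACA subrr addr0 mulrBr.
by apply/funext => l; congr (clim _ _); apply/funext => n; rewrite -(@av_affine C^o).
Qed.

Lemma intgD h h' p q : intg h p q -> intg h' p q -> intg (fun z => h z + h' z) p q.
Proof.
move=> [l hl] [l' hl']; exists (l + l'); apply: clim_ext (climD hl hl') => n.
by rewrite (@avD C^o).
Qed.

Lemma JD h h' p q : intg h p q -> intg h' p q ->
  J (fun z => h z + h' z) p q = J h p q + J h' p q.
Proof.
move=> [l hl] [l' hl']; rewrite (J_lim hl) (J_lim hl') -mulrDr; apply: J_lim.
by apply: clim_ext (climD hl hl') => n; rewrite (@avD C^o).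
Qed.

Lemma intgZ c h p q : intg h p q -> intg (fun z => c * h z) p q.
Proof.
move=> [l hl]; exists (c * l); apply: clim_ext (climZ c hl) => n.
exact: (esym (@avZ C^o n h c p q)).
Qed.

Lemma JZ c h p q : intg h p q -> J (fun z => c * h z) p q = c * J h p q.
Proof.
move=> [l hl]; rewrite (J_lim hl) mulrCA; apply: J_lim.
apply: clim_ext (climZ c hl) => n; exact: (esym (@avZ C^o n h c p q)).
Qed.

Lemma JB h h' p q : intg h p q -> intg h' p q ->
  J (fun z => h z - h' z) p q = J h p q - J h' p q.
Proof.
move=> i1 i2; rewrite -mulN1r -JZ// -JD//; last exact: intgZ.
by congr (J _ _ _); apply/funext => z; rewrite mulN1r.
Qed.

Lemma intgB h h' p q : intg h p q -> intg h' p q -> intg (fun z => h z - h' z) p q.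
Proof.
move=> i1 i2; have := intgD i1 (intgZ (-1) i2).
by congr (intg _ _ _); apply/funext => z; rewrite mulN1r.
Qed.

Lemma intg_cst c p q : intg (fun=> c) p q.
Proof. by exists c; apply: clim_ext (clim_cst c) => n; rewrite av_cst. Qed.
Lemma J_cst c p q : J (fun=> c) p q = (q - p) * c.
Proof. by apply: J_lim; apply: clim_ext (clim_cst c) => n; rewrite av_cst. Qed.
Lemma intg_id p q : intg id p q.
Proof. by exists (mid p q); apply: clim_ext (clim_cst _) => n; rewrite av_id. Qed.
Lemma J_id p q : J id p q = (q - p) * mid p q.
Proof. by apply: J_lim; apply: clim_ext (clim_cst _) => n; rewrite av_id. Qed.
(** Level [n + 1] on the whole segment is by definition the mean of level [n] on its halves.
    Additivity is thus immediate at the midpoint, and segments are never split anywhere else. *)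
Lemma J_split h p q : intg h p (mid p q) -> intg h (mid p q) q ->
  J h p q = J h p (mid p q) + J h (mid p q) q.
Proof.
move=> [l hl] [l' hl'].
rewrite (J_lim hl) (J_lim hl') (@J_lim h p q (2^-1 * (l + l'))).
  by rewrite /mid; field.
by apply: climS; exact: (climZ _ (climD hl hl')).
Qed.

Lemma climclosed_nm (M : R) (o : C) : climclosed [set z | nm (z - o) <= M].
Proof.
move=> u l uM ul /=; apply/ler_addgt0Pl => e /ul[N /(_ _ (leqnn N)) h].
by apply: (le_trans (nm_tri (u N) _ _)); apply: lerD; [rewrite nmBC|exact: uM].
Qed.

Lemma midclosed_nm (M : R) (o : C) : midclosed [set z | nm (z - o) <= M].
Proof.
move=> p q /= hp hq; rewrite /mid.
have -> : 2^-1 * (p + q) - o = 2^-1 * ((p - o) + (q - o)) by field.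
rewrite nmM nm_half ler_pdivrMl//; apply: (le_trans (nmD _ _)); rewrite mulr_natl mulr2n.
exact: lerD.
Qed.

(** A mean value statement: the averages stay in [B], hence so does their limit. Discs [B] give the
    norm bound [J_bound], a half-plane gives [kappa_neq0]. *)
Lemma J_in (E B : set C) h p q : midclosed E -> cconv B -> (forall z, E z -> B (h z)) ->
  E p -> E q -> intg h p q -> exists2 l, B l & J h p q = (q - p) * l.
Proof.
move=> mE [mB cB] hB Ep Eq [l hl]; exists l; last exact: J_lim.
apply: cB hl => n; exact: (@av_in C^o B E).
Qed.

Lemma J_bound (E : set C) h p q (M : R) : 0 <= M -> midclosed E ->
  (forall z, E z -> nm (h z) <= M) -> E p -> E q -> nm (J h p q) <= nm (q - p) * M.
Proof.
move=> M0 mE hM Ep Eq.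
have [ih|nih] := pselect (intg h p q).
  have [||l /=] := @J_in E [set z | nm (z - 0) <= M] h p q mE _ _ Ep Eq ih.
  - by split; [exact: midclosed_nm|exact: climclosed_nm].
  - by move=> z /hM; rewrite /= subr0.
  - by rewrite subr0 => lM ->; rewrite nmM ler_wpM2l// nm_ge0.
(* If the averages diverge, the integral is [0] by default and the bound holds trivially. *)
rewrite /J; case: xgetP => [x _ /= hx|_]; first by case: nih; exists x.
by rewrite mulr0 nm0 mulr_ge0// nm_ge0.
Qed.

Lemma cconvI E E' : cconv E -> cconv E' -> cconv (E `&` E').
Proof.
move=> [m c] [m' c']; split=> [p q [? ?] [? ?]|u l h ul].
  by split; [exact: m|exact: m'].
by split; [apply: c ul => n; case: (h n)|apply: c' ul => n; case: (h n)].
Qed.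

Lemma cconv_disc o (M : R) : cconv [set z | nm (z - o) <= M].
Proof. by split; [exact: midclosed_nm|exact: climclosed_nm]. Qed.

Lemma cconv_half (a : C) (c : R) : cconv [set z | c <= Re (a * z)].
Proof.
have ReD (x y : C) : Re (x + y) = Re x + Re y by case: x y => [? ?] [? ?].
split=> [p q /= hp hq|u l h ul /=].
  have -> : a * mid p q = (2^-1 : R)%:C%C * (a * p + a * q).
    by rewrite /mid rmorphV ?unitfE ?pnatr_eq0// rmorph_nat; ring.
  have -> : forall (r : R) (x : C), Re (r%:C%C * x) = r * Re x.
    by move=> r [x y] /=; rewrite mul0r subr0.
  rewrite ReD; lra.
have /ler_addgt0Pl : forall e, 0 < e -> c <= e + Re (a * l); last by [].
move=> e e0; have [N /(_ _ (leqnn N)) hN] := climZ a ul e0.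
apply: (le_trans (h N)); rewrite -lerBlDr.
have -> : Re (a * u N) - Re (a * l) = Re (a * u N - a * l).
  by case: (a * u N) (a * l) => [? ?] [? ?].
by apply: (le_trans _ hN); apply: (le_trans (ler_norm _)); exact: nm_Re.
Qed.

Definition per p q r : R := nm (q - p) + nm (r - q) + nm (p - r).

Lemma per_ge0 p q r : 0 <= per p q r.
Proof. by rewrite !addr_ge0// nm_ge0. Qed.

(** The four cases are the triangles of the midpoint subdivision, the last being the middle one. The
    bound on the displacement of the first vertex makes the first vertices of nested triangles a
    Cauchy sequence. *)
Lemma per_child p q r (a b c : C) : 
  (a = p /\ b = mid p q /\ c = mid p r) \/ (a = mid p q /\ b = q /\ c = mid q r) \/
  (a = mid p r /\ b = mid q r /\ c = r) \/ (a = mid q r /\ b = mid p r /\ c = mid p q) ->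
  per a b c = per p q r / 2 /\ nm (a - p) <= per p q r.
Proof.
have H x y (z : C) : z = 2^-1 * (x - y) -> nm z = nm (x - y) / 2.
  by move=> ->; rewrite nmM nm_half mulrC.
have H1 : nm (mid p q - p) = nm (q - p) / 2 by apply: H; rewrite /mid; field.
have H2 : nm (mid p r - p) = nm (p - r) / 2.
  by rewrite nmBC; apply: H; rewrite /mid; field.
have H3 : nm (mid q r - p) <= per p q r.
  have -> : mid q r - p = 2^-1 * ((q - p) - (p - r)) by rewrite /mid; field.
  rewrite nmM nm_half ler_pdivrMl//; apply: (le_trans (nmB _ _)); rewrite /per.
  have := nm_ge0 (q - p); have := nm_ge0 (r - q); have := nm_ge0 (p - r); lra.
have := nm_ge0 (q - p); have := nm_ge0 (r - q); have := nm_ge0 (p - r).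
have Hp : forall a b c a' b' c' : C, a = 2^-1 * a' -> b = 2^-1 * b' -> c = 2^-1 * c' ->
  nm a + nm b + nm c = (nm a' + nm b' + nm c') / 2.
  by move=> ? ? ? ? ? ? -> -> ->; rewrite !nmM nm_half; lra.
move=> N1 N2 N3 [[-> [-> ->]]|[[-> [-> ->]]|[[-> [-> ->]]|[-> [-> ->]]]]]; split.
- by apply: Hp; rewrite /mid; field.
- by rewrite subrr nm0 per_ge0.
- by apply: Hp; rewrite /mid; field.
- rewrite H1 /per; lra.
- by apply: Hp; rewrite /mid; field.
- rewrite H2 /per; lra.
- by rewrite /per [nm (q - p)]nmBC [nm (r - q)]nmBC [nm (p - r)]nmBC; apply: Hp; rewrite /mid; field.
- exact: H3.
Qed.

(** If [P] failed, some child would fail at each stage; the first vertices of these nested triangles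
    converge to a point of [E], where the local hypothesis is contradicted. The factor 2 in the
    local hypothesis is the sum of the geometric series of the perimeters, which bounds the distance
    from a first vertex to the limit. *)
Lemma cousin_tri (E : set C) (P : C -> C -> C -> Prop) : cconv E ->
  (forall p q r, E p -> E q -> E r -> P p (mid p q) (mid p r) ->
     P (mid p q) q (mid q r) -> P (mid p r) (mid q r) r ->
     P (mid q r) (mid p r) (mid p q) -> P p q r) ->
  (forall z, E z -> exists2 d, 0 < d & forall p q r, E p -> E q -> E r ->
     per p q r < d -> nm (p - z) <= 2 * per p q r -> P p q r) ->
  forall p q r, E p -> E q -> E r -> P p q r.
Proof.
move=> [mE cE] Padd Ploc p0 q0 r0 Ep0 Eq0 Er0; apply: contrapT => nP0.
pose bad (T : C * C * C) := [/\ E T.1.1, E T.1.2, E T.2 & ~ P T.1.1 T.1.2 T.2].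
pose pr (T : C * C * C) := per T.1.1 T.1.2 T.2.
have /choice[f fP] : forall T, exists T', bad T ->
   [/\ bad T', pr T' = pr T / 2 & nm (T'.1.1 - T.1.1) <= pr T].
  move=> [[p q] r].
  have [[/= Ep Eq Er nP]|nb] := pselect (bad (p, q, r)); last by exists (p, q, r).
  have : exists T', bad T' /\ ((T'.1.1 = p /\ T'.1.2 = mid p q /\ T'.2 = mid p r) \/
  (T'.1.1 = mid p q /\ T'.1.2 = q /\ T'.2 = mid q r) \/
  (T'.1.1 = mid p r /\ T'.1.2 = mid q r /\ T'.2 = r) \/
  (T'.1.1 = mid q r /\ T'.1.2 = mid p r /\ T'.2 = mid p q)).
    apply: contrapT => nT; apply: nP; apply: Padd => //; apply: contrapT => nP'; apply: nT.
    - by exists (p, mid p q, mid p r); split; [split => //=; exact: mE|tauto].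
    - by exists (mid p q, q, mid q r); split; [split => //=; exact: mE|tauto].
    - by exists (mid p r, mid q r, r); split; [split => //=; exact: mE|tauto].
    - by exists (mid q r, mid p r, mid p q); split; [split => //=; exact: mE|tauto].
  move=> [[[p' q'] r'] [bT' /= hT']]; exists (p', q', r') => _.
  by have [] := per_child hT'.
pose T n := iter n f (p0, q0, r0).
have Tbad n : bad (T n).
  by elim: n => [//|n IH]; have [] := fP _ IH.
have Tper n : pr (T n) = pr (T 0%N) * 2^-1 ^+ n.
  elim: n => [|n IH]; first by rewrite expr0 mulr1.
  by have [_ -> _] := fP _ (Tbad n); rewrite IH exprSr mulrA.
have [n|z zl hz] := @geometric_cauchy _ (fun n => (T n).1.1) (pr (T 0%N)).
  by rewrite -Tper; have [] := fP _ (Tbad n).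
have Ez : E z by apply: cE zl => n; have [] := Tbad n.
have [d d0 hd] := Ploc z Ez.
have [n hn] : exists n, pr (T n) < d.
  have := @cvg_geometric R (pr (T 0%N)) 2^-1.
  rewrite ger0_norm ?invr_ge0// invf_lt1// ltr1n => /(_ isT)/cvgrPdist_lt/(_ _ d0)[N _ hN].
  exists N; have := hN N (leqnn _) => /=; rewrite sub0r normrN Tper.
  by apply: le_lt_trans; exact: ler_norm.
have [E1 E2 E3 nP] := Tbad n; apply: nP; apply: hd => //.
by have := hz n; rewrite -Tper.
Qed.

(** The degenerate triangle [p, q, q], with [P] required on all three sides, reduces bisection of
    segments to bisection of triangles. *)
Lemma cousin_seg (E : set C) (P : C -> C -> Prop) : cconv E ->
  (forall p q, E p -> E q -> P p (mid p q) -> P (mid p q) q -> P p q) ->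
  (forall z, E z -> exists2 d, 0 < d & forall p q, E p -> E q ->
     nm (p - z) < d -> nm (q - z) < d -> P p q) ->
  forall p q, E p -> E q -> P p q.
Proof.
move=> cE Padd Ploc p q Ep Eq.
suff [] : P p q /\ P q q /\ P p q by [].
apply: (@cousin_tri E (fun p q r => P p q /\ P q r /\ P p r)) => //.
  move=> {}p {}q r {}Ep {}Eq Er [a1 [_ a3]] [b1 [b2 _]] [_ [c2 c3]] _.
  by split; [|split]; apply: Padd.
move=> z Ez; have [d d0 hd] := Ploc z Ez; exists (d / 3); first by rewrite divr_gt0.
move=> {}p {}q r {}Ep {}Eq Er; rewrite /per => h1 h2.
have := nm_ge0 (q - p); have := nm_ge0 (r - q); have := nm_ge0 (p - r) => N1 N2 N3.
have hp : nm (p - z) < d by lra.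
have hq : nm (q - z) < d by have := nm_tri p q z; lra.
have hr : nm (r - z) < d by have := nm_tri p r z; rewrite (nmBC r p); lra.
by split; [|split]; apply: hd.
Qed.

Definition ccont (h : C -> C) z := forall e : R, 0 < e ->
  exists2 d : R, 0 < d & forall w, nm (w - z) < d -> nm (h w - h z) <= e.

(** Bisection replaces uniform continuity: near a point all averages are within [e / 2] of the value
    there, and since an average is the mean of those over the halves, the Cauchy bound [e] passes to
    the whole without loss. *)
Lemma intg_cont E h p q : cconv E -> (forall z, E z -> ccont h z) -> E p -> E q -> intg h p q.
Proof.
move=> cE hc Ep Eq; apply: C_cauchy_cvg => e e0; move: p q Ep Eq.
apply: (@cousin_seg E (fun p q => exists N, forall m n, (N <= m)%N -> (N <= n)%N ->
  nm (avC m h p q - avC n h p q) <= e)) => //.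
  move=> p q Ep Eq [N hN] [N' hN']; exists (maxn N N').+1 => -[//|m] [//|n].
  rewrite !ltnS !geq_max => /andP[m1 m2] /andP[n1 n2] /=.
  rewrite -scalerBr opprD addrACA.
  rewrite -[_ *: _]/(2^-1 * _) nmM nm_half ler_pdivrMl//.
  apply: (le_trans (nmD _ _)); rewrite mulr_natl mulr2n lerD//; [exact: hN|exact: hN'].
move=> z Ez; have [d d0 hd] := hc z Ez _ (divr_gt0 e0 (ltr0n R 2)); exists d => //.
move=> p q Ep Eq hp hq; exists 0%N => m n _ _.
have H k : nm (avC k h p q - h z) <= e / 2.
  apply: (@av_in C^o [set x | nm (x - h z) <= e / 2] [set w | nm (w - z) < d]) => //.
    move=> x y /= hx hy; rewrite /mid.
    have -> : 2^-1 * (x + y) - z = 2^-1 * ((x - z) + (y - z)) by field.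
    by rewrite nmM nm_half; have := nmD (x - z) (y - z); lra.
  exact: midclosed_nm.
apply: (le_trans (nm_tri (h z) _ _)); rewrite [leRHS]splitr lerD//.
by rewrite nmBC.
Qed.

End Average.
Arguments J {R}.
Arguments av {R V}.

(** * Complex differentiability and Goursat's theorem *)

Section Differentiability.
Variable R : realType.
Local Notation C := R[i].
Implicit Types (h k : C -> C) (z w o : C).

Lemma ccont_cst c z : ccont (fun=> c) z.
Proof. by move=> e e0; exists 1 => // w _; rewrite subrr nm0 ltW. Qed.

Lemma ccont_id z : ccont id z.
Proof. by move=> e e0; exists e => // w /ltW. Qed.

Lemma ccont_near h k z d : 0 < d -> (forall w, nm (w - z) < d -> h w = k w) ->
  ccont h z -> ccont k z.
Proof.
move=> d0 hk hc e /hc[d' d'0 hd']; exists (Num.min d d'); first by rewrite lt_min d0.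
move=> w; rewrite lt_min => /andP[wd wd']; rewrite -!hk//; first exact: hd'.
by rewrite subrr nm0.
Qed.

Lemma ccontD h k z : ccont h z -> ccont k z -> ccont (fun w => h w + k w) z.
Proof.
move=> hc kc e e0; have e2 : 0 < e / 2 by rewrite divr_gt0.
have [d d0 hd] := hc _ e2; have [d' d'0 hd'] := kc _ e2.
exists (Num.min d d'); first by rewrite lt_min d0.
move=> w; rewrite lt_min => /andP[wd wd'].
by rewrite opprD addrACA [e]splitr (le_trans (nmD _ _))// lerD ?hd ?hd'.
Qed.

Lemma ccontM h k z : ccont h z -> ccont k z -> ccont (fun w => h w * k w) z.
Proof.
move=> hc kc e e0; pose m := 1 + nm (h z) + nm (k z).
have h0 := nm_ge0 (h z); have k0 := nm_ge0 (k z).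
have m0 : 0 < m by rewrite /m; lra.
pose e' := Num.min 1 (e / m).
have e'0 : 0 < e' by rewrite lt_min ltr01 divr_gt0.
have [d d0 hd] := hc _ e'0; have [d' d'0 hd'] := kc _ e'0.
exists (Num.min d d'); first by rewrite lt_min d0.
move=> w; rewrite lt_min => /andP[/hd wd /hd' wd'].
have -> : h w * k w - h z * k z = (h w - h z) * (k w - k z) + h z * (k w - k z) + (h w - h z) * k z by ring.
have e1 : e' <= 1 by rewrite ge_min lexx.
have em : e' * m <= e by rewrite -ler_pdivlMr// ge_min lexx orbT.
apply: (le_trans (nmD _ _)); apply: (le_trans (lerD (nmD _ _) (lexx _))).
rewrite !nmM; have a0 := nm_ge0 (h w - h z); have b0 := nm_ge0 (k w - k z).
apply: le_trans em; rewrite /m; nra.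
Qed.

Lemma ccontV h z : h z != 0 -> ccont h z -> ccont (fun w => (h w)^-1) z.
Proof.
move=> hz hc e e0; have n0 : 0 < nm (h z) by rewrite nm_gt0.
pose e' := Num.min (nm (h z) / 2) (e * nm (h z) ^+ 2 / 2).
have e'0 : 0 < e' by rewrite lt_min !divr_gt0// mulr_gt0// exprn_gt0.
have [d d0 hd] := hc _ e'0; exists d => // w /hd wd.
have e1 : e' <= nm (h z) / 2 by rewrite ge_min lexx.
have e2 : e' <= e * nm (h z) ^+ 2 / 2 by rewrite ge_min lexx orbT.
have hw2 : nm (h z) / 2 <= nm (h w).
  have := nm_tri (h w) (h z) 0; rewrite !subr0 nmBC; lra.
have hw : h w != 0 by rewrite -nm_gt0; lra.
have -> : (h w)^-1 - (h z)^-1 = (h z - h w) * (h w * h z)^-1 by field; rewrite hw hz.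
rewrite nmM nmV nmM ler_pdivrMr ?mulr_gt0 ?nm_gt0// nmBC.
apply: (le_trans wd); apply: (le_trans e2); rewrite expr2 -mulrA ler_pM2l// mulrAC ler_pM2r//.
Qed.

(* Complex differentiability at [z] in Caratheodory's form. *)
Definition cdiff h z := exists2 f, ccont f z &
  exists2 d, 0 < d & forall w, nm (w - z) < d -> h w = h z + f w * (w - z).

Lemma cdiff_cont h z : cdiff h z -> ccont h z.
Proof.
move=> [f fc [d d0 fd]]; apply: (ccont_near d0 (h := fun w => h z + f w * (w - z))).
  by move=> w /fd.
apply: ccontD; first exact: ccont_cst.
apply: ccontM => //; apply: ccontD; [exact: ccont_id|exact: ccont_cst].
Qed.

Lemma cdiff_near h k z d : 0 < d -> (forall w, nm (w - z) < d -> h w = k w) ->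
  cdiff h z -> cdiff k z.
Proof.
move=> d0 hk [f fc [d' d'0 hd']]; exists f => //.
exists (Num.min d d'); first by rewrite lt_min d0.
move=> w; rewrite lt_min => /andP[wd wd']; rewrite -!hk//; first exact: hd'.
by rewrite subrr nm0.
Qed.

Lemma cdiff_cst c z : cdiff (fun=> c) z.
Proof.
exists (fun=> 0); first exact: ccont_cst.
by exists 1 => // w _; rewrite mul0r addr0.
Qed.

Lemma cdiff_id z : cdiff id z.
Proof.
exists (fun=> 1); first exact: ccont_cst.
by exists 1 => // w _; rewrite mul1r addrC subrK.
Qed.

Lemma cdiffD h k z : cdiff h z -> cdiff k z -> cdiff (fun w => h w + k w) z.
Proof.
move=> [f fc [d d0 fd]] [g gc [d' d'0 gd]]; exists (fun w => f w + g w); first exact: ccontD.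
exists (Num.min d d'); first by rewrite lt_min d0.
by move=> w; rewrite lt_min => /andP[/fd -> /gd ->]; ring.
Qed.

Lemma cdiffM h k z : cdiff h z -> cdiff k z -> cdiff (fun w => h w * k w) z.
Proof.
move=> dh dk; have := cdiff_cont dk; move: dh dk.
move=> [f fc [d d0 fd]] [g gc [d' d'0 gd]] kc.
exists (fun w => f w * k w + h z * g w).
  by apply: ccontD; apply: ccontM => //; exact: ccont_cst.
exists (Num.min d d'); first by rewrite lt_min d0.
by move=> w; rewrite lt_min => /andP[/fd -> /gd ->]; ring.
Qed.

Lemma cdiffV h z : h z != 0 -> cdiff h z -> cdiff (fun w => (h w)^-1) z.
Proof.
move=> hz dh; have hc := cdiff_cont dh; move: dh => [f fc [d d0 fd]].
have n0 : 0 < nm (h z) / 2 by rewrite divr_gt0// nm_gt0.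
have [d' d'0 hd'] := hc _ n0.
exists (fun w => - f w * ((h w)^-1 * (h z)^-1)).
  apply: ccontM; last by apply: ccontM; [exact: ccontV|exact: ccont_cst].
  have := ccontM (ccont_cst (-1) z) fc.
  by apply: (@ccont_near _ _ _ 1) => // w _; rewrite mulN1r.
exists (Num.min d d'); first by rewrite lt_min d0.
move=> w; rewrite lt_min => /andP[wd wd'].
have hw : h w != 0.
  rewrite -nm_gt0; have := hd' _ wd'; have := nm_tri (h w) (h z) 0.
  by rewrite !subr0 nmBC; lra.
have E : f w * (w - z) = h w - h z by rewrite (fd _ wd) [RHS]addrC addKr.
by rewrite mulrAC mulNr E; field; rewrite hw hz.
Qed.

Lemma cdiffN h z : cdiff h z -> cdiff (fun w => - h w) z.
Proof.
move=> dh; have := cdiffM (cdiff_cst (-1) z) dh.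
by apply: (@cdiff_near _ _ _ 1) => // w _; rewrite mulN1r.
Qed.

Lemma cdiffB h k z : cdiff h z -> cdiff k z -> cdiff (fun w => h w - k w) z.
Proof. by move=> dh dk; apply: cdiffD => //; exact: cdiffN. Qed.

Lemma cdiffX h n z : cdiff h z -> cdiff (fun w => h w ^+ n) z.
Proof.
move=> dh; elim: n => [|n IH]; first exact: cdiff_cst.
have := cdiffM dh IH; apply: (@cdiff_near _ _ _ 1) => // w _; by rewrite exprS.
Qed.

Lemma cdiff_sum (I : Type) (r : seq I) (P : pred I) (F : I -> C -> C) z :
  (forall i, P i -> cdiff (F i) z) -> cdiff (fun w => \sum_(i <- r | P i) F i w) z.
Proof.
move=> dF; elim: r => [|i r IH].
  have := cdiff_cst 0 z; apply: (@cdiff_near _ _ _ 1) => // w _; by rewrite big_nil.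
have [Pi|nPi] := boolP (P i).
  have := cdiffD (dF _ Pi) IH; apply: (@cdiff_near _ _ _ 1) => // w _.
  by rewrite big_cons Pi.
by move: IH; apply: (@cdiff_near _ _ _ 1) => // w _; rewrite big_cons (negbTE nPi).
Qed.

Lemma cdiff_affine h a b z : cdiff h (a * z + b) -> cdiff (fun w => h (a * w + b)) z.
Proof.
move=> [f fc [d d0 fd]].
have a1 : 0 < nm a + 1 by rewrite ltr_pwDr// nm_ge0.
have H w (d1 : R) : nm (w - z) < d1 / (nm a + 1) -> nm (a * w + b - (a * z + b)) < d1.
  rewrite opprD addrACA subrr addr0 -mulrBr nmM ltr_pdivlMr// => hw.
  by apply: le_lt_trans hw; rewrite mulrC ler_wpM2l ?nm_ge0// lerDl.
exists (fun w => f (a * w + b) * a).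
  apply: ccontM; last exact: ccont_cst.
  move=> e /fc[d1 d10 hd1]; exists (d1 / (nm a + 1)); first by rewrite divr_gt0.
  by move=> w /H; exact: hd1.
exists (d / (nm a + 1)); first by rewrite divr_gt0.
by move=> w /H/fd ->; ring.
Qed.

Lemma cdiff_subV z w : w != z -> cdiff (fun w => (w - z)^-1) w.
Proof.
move=> wz; apply: (cdiffV (h := fun w => w - z)); first by rewrite subr_eq0.
by apply: cdiffB; [exact: cdiff_id|exact: cdiff_cst].
Qed.

Lemma intg_diff E h p q : cconv E -> (forall z, E z -> cdiff h z) -> E p -> E q -> intg h p q.
Proof. by move=> cE hd; apply: (intg_cont cE) => z /hd/cdiff_cont. Qed.

Definition tri h p q r := J h p q + J h q r + J h r p.

(* Bisection transports the bound |tri h| <= e * perimeter^2, which differentiability gives on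
   small triangles. *)
Theorem goursat E h : cconv E -> (forall z, E z -> cdiff h z) ->
  forall p q r, E p -> E q -> E r -> tri h p q r = 0.
Proof.
move=> cE hd p q r Ep Eq Er; have [mE _] := cE.
have ih x y : E x -> E y -> intg h x y by move=> *; exact: (intg_diff cE).
suff H e : 0 < e -> nm (tri h p q r) <= e * per p q r ^+ 2.
  apply: nm_eq0P => e e0; have P0 := per_ge0 p q r.
  have pp : 0 < per p q r ^+ 2 + 1 by rewrite ltr_pwDr// sqr_ge0.
  apply: (le_trans (H _ (divr_gt0 e0 pp))).
  by rewrite mulrAC ler_pdivrMr// ler_pM2l// lerDl.
move=> e0; move: p q r Ep Eq Er.
apply: (@cousin_tri _ E (fun p q r => nm (tri h p q r) <= e * per p q r ^+ 2)) => //.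
  move=> p q r Ep Eq Er.
  have [-> _] := @per_child _ p q r p (mid p q) (mid p r) ltac:(tauto).
  have [-> _] := @per_child _ p q r (mid p q) q (mid q r) ltac:(tauto).
  have [-> _] := @per_child _ p q r (mid p r) (mid q r) r ltac:(tauto).
  have [-> _] := @per_child _ p q r (mid q r) (mid p r) (mid p q) ltac:(tauto).
  have Ha := mE _ _ Ep Eq; have Hb := mE _ _ Ep Er; have Hc := mE _ _ Eq Er.
  have -> : tri h p q r = tri h p (mid p q) (mid p r) + tri h (mid p q) q (mid q r)
     + tri h (mid p r) (mid q r) r + tri h (mid q r) (mid p r) (mid p q).
    rewrite /tri (J_split (p := p) (q := q)) ?(J_split (p := q) (q := r)) ?(J_split (p := r) (q := p)) ?(midC r p); try exact: ih.
    rewrite (J_rev h (mid p q) (mid p r)) (J_rev h (mid q r) (mid p q)) (J_rev h (mid p r) (mid q r)).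
    ring.
  move=> h1 h2 h3 h4.
  apply: (le_trans (nmD _ _)); apply: (le_trans (lerD (nmD _ _) (lexx _))).
  apply: (le_trans (lerD (lerD (nmD _ _) (lexx _)) (lexx _))).
  (* Four children of half the perimeter reproduce the bound exactly, since
     [4 * (P / 2) ^ 2 = P ^ 2]. *)
  have -> : e * per p q r ^+ 2 = e * (per p q r / 2) ^+ 2 + e * (per p q r / 2) ^+ 2
      + e * (per p q r / 2) ^+ 2 + e * (per p q r / 2) ^+ 2 by field.
  by rewrite !lerD.
move=> z Ez; have [f fc [d d0 fd]] := hd z Ez.
have [d' d'0 hd'] := fc _ (divr_gt0 e0 (ltr0n R 3)).
have m0 : 0 < Num.min d d' by rewrite lt_min d0.
exists (Num.min d d' / 4); first by rewrite divr_gt0.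
move=> p q r Ep Eq Er hper hpz.
set P := per p q r in hper hpz *.
have P0 : 0 <= P by exact: per_ge0.
(* The first vertex is within [2 * P] of [z] and the others at most [P] further; [3 * P] also
   cancels the 3 in the choice of [e / 3]. *)
pose D := E `&` [set w | nm (w - z) <= 3 * P].
have cD : cconv D by apply: cconvI => //; exact: cconv_disc.
have N1 := nm_ge0 (q - p); have N2 := nm_ge0 (r - q); have N3 := nm_ge0 (p - r).
have Dp : D p by split=> //=; lra.
have Dq : D q.
  by split => //=; have := nm_tri p q z; move: hpz; rewrite /P /per; lra.
have Dr : D r.
  by split => //=; have := nm_tri p r z; move: hpz; rewrite /P /per (nmBC r p); lra.
(* The error of the affine approximation at [z]; the affine part integrates to 0 around the
   triangle. *)
pose rho w := h w - (f z * w + (h z - f z * z)).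
have rhoD w : D w -> nm (rho w) <= e * P.
  move=> [_ /= wz]; have wm : nm (w - z) < Num.min d d' by lra.
  move: wm; rewrite lt_min => /andP[wd wd'].
  rewrite /rho (fd _ wd) (_ : _ - _ = (f w - f z) * (w - z)); last by ring.
  rewrite nmM; have := hd' _ wd' => H1; have := nm_ge0 (f w - f z) => H2.
  have H3 := nm_ge0 (w - z).
  have : nm (f w - f z) * nm (w - z) <= (e / 3) * (3 * P) by apply: ler_pM.
  by rewrite mulrA divfK.
have il x y : intg (fun w => f z * w + (h z - f z * z)) x y.
  by apply: intgD; [apply: intgZ; exact: intg_id|exact: intg_cst].
have Jl x y : J (fun w => f z * w + (h z - f z * z)) x y = (y - x) * (f z * mid x y + (h z - f z * z)).
  rewrite JD; [|by apply: intgZ; exact: intg_id|exact: intg_cst].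
  by rewrite JZ ?J_id ?J_cst; [ring|exact: intg_id].
have Jrho x y : D x -> D y -> J h x y = J rho x y + (y - x) * (f z * mid x y + (h z - f z * z)).
  by move=> [Ex _] [Ey _]; rewrite /rho JB//; [rewrite Jl subrK|exact: ih].
have -> : tri h p q r = J rho p q + J rho q r + J rho r p.
  by rewrite /tri !Jrho// /mid; field.
have Jb x y : D x -> D y -> nm (J rho x y) <= nm (y - x) * (e * P).
  move=> Dx Dy; have [mD _] := cD.
  exact: (J_bound (mulr_ge0 (ltW e0) P0) mD rhoD).
apply: (le_trans (nmD _ _)); apply: (le_trans (lerD (nmD _ _) (lexx _))).
apply: (le_trans (lerD (lerD (Jb _ _ Dp Dq) (Jb _ _ Dq Dr)) (Jb _ _ Dr Dp))).
by rewrite -!mulrDl -/(per p q r) -/P expr2 mulrCA.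
Qed.

Lemma quad E h : cconv E -> (forall z, E z -> cdiff h z) ->
  forall p q r s, E p -> E q -> E r -> E s -> J h p q + J h q r + J h r s + J h s p = 0.
Proof.
move=> cE hd p q r s Ep Eq Er Es.
have := goursat cE hd Ep Eq Er; have := goursat cE hd Ep Er Es.
by rewrite /tri (J_rev h p r) => h1 h2; rewrite -[RHS]addr0 -{1}h1 -{1}h2; ring.
Qed.

End Differentiability.

(** * Cauchy's formula on squares *)

Section Cauchy.
Variable R : realType.
Local Notation C := R[i].
Implicit Types (h : C -> C) (z w o : C) (s r : R).

Lemma ReD z w : Re (z + w) = Re z + Re w. Proof. by case: z w => [? ?] [? ?]. Qed.
Lemma ReB z w : Re (z - w) = Re z - Re w. Proof. by case: z w => [? ?] [? ?]. Qed.
Lemma ReRM r z : Re (r%:C%C * z) = r * Re z.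
Proof. by case: z => [? ?]; rewrite /= mul0r subr0. Qed.
Lemma ImD z w : Im (z + w) = Im z + Im w. Proof. by case: z w => [? ?] [? ?]. Qed.
Lemma ImRM r z : Im (r%:C%C * z) = r * Im z.
Proof. by case: z => [? ?]; rewrite /= mul0r addr0. Qed.

Lemma nm_iX n : nm ('i%C ^+ n : C) = 1.
Proof. by rewrite nmX nm_i expr1n. Qed.

Lemma i4 : 'i%C ^+ 4 = 1 :> C.
Proof. by rewrite (_ : 4 = 2 * 2)%N// exprM sqr_i sqrrN expr1n. Qed.

Lemma iN_iX n : (- 'i%C) ^+ n * 'i%C ^+ n = 1 :> C.
Proof. by rewrite -exprMn mulNr -expr2 sqr_i opprK expr1n. Qed.

(** Corner [n] modulo 4 of the square of centre [o] and half-side [s], counterclockwise; its sides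
    have length [2 * s]. *)
Definition cor o s n : C := o + s%:C%C * ((1 + 'i%C) * 'i%C ^+ n).

Lemma cor4 o s : cor o s 4 = cor o s 0.
Proof. by rewrite /cor i4 expr0. Qed.

Lemma nm_1i : nm (1 + 'i%C : C) <= 2.
Proof. by apply: (le_trans (nmD _ _)); rewrite nm1 nm_i. Qed.

Lemma nm_cor o s n : 0 <= s -> nm (cor o s n - o) <= 2 * s.
Proof.
move=> s0; rewrite /cor addrAC subrr add0r !nmM nmR nm_iX mulr1 ger0_norm// mulrC.
by rewrite ler_wpM2r// nm_1i.
Qed.

Lemma nm_cor_side o s n : 0 <= s -> nm (cor o s n.+1 - cor o s n) = 2 * s.
Proof.
move=> s0; rewrite /cor opprD addrACA subrr add0r.
have -> : s%:C%C * ((1 + 'i%C) * 'i%C ^+ n.+1) - s%:C%C * ((1 + 'i%C) * 'i%C ^+ n)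
   = s%:C%C * ('i%C ^+ 2 - 1) * 'i%C ^+ n :> C by rewrite exprS; ring.
rewrite sqr_i !nmM nm_iX nmR ger0_norm// mulr1 mulrC; congr (_ * _).
by rewrite -opprD nmN (_ : 1 + 1 = 2%:R)// nm_nat.
Qed.

(* The side [n] of the square [cor z s] lies on the boundary of this half-plane, which misses the
   centre [z]. *)
Definition outer z s n : set C :=
  [set w | s + Re ((- 'i%C) ^+ n.+1 * z) <= Re ((- 'i%C) ^+ n.+1 * w)].

Lemma outerE z s n w : outer z s n w <-> s <= Re ((- 'i%C) ^+ n.+1 * (w - z)).
Proof. by rewrite /outer/= mulrBr ReB lerBrDr. Qed.

Lemma outer_nm z s n w : outer z s n w -> s <= nm (w - z).
Proof.
move/outerE => h; apply: (le_trans h); apply: (le_trans (ler_norm _)).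
by apply: (le_trans (nm_Re _)); rewrite nmM nmX nmN nm_i expr1n mul1r.
Qed.

Lemma outer_cconv z s n : cconv (outer z s n).
Proof. exact: cconv_half. Qed.

(** The factor [(- 'i) ^ (n + 1)] turns the outward normal of side [n] into 1, so the real part
    measures the height of the side above a point. It is [s] above [o], and moving from [o] to [z]
    costs at most [nm (z - o)]. *)
Lemma outer_cor o z s s' n : s' <= s - nm (z - o) ->
  outer z s' n (cor o s n) /\ outer z s' n (cor o s n.+1).
Proof.
move=> h.
have H : - nm (z - o) <= Re ((- 'i%C) ^+ n.+1 * (o - z)).
  rewrite -[leRHS]opprK lerN2 -[- Re _]mulN1r.
  apply: (le_trans (ler_norm _)); rewrite normrM normrN1 mul1r.
  by apply: (le_trans (nm_Re _)); rewrite nmM nmX nmN nm_i expr1n mul1r nmBC.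
have iN : (- 'i%C) * 'i%C = 1 :> C by rewrite mulNr -expr2 sqr_i opprK.
split; apply/outerE.
  have -> : (- 'i%C) ^+ n.+1 * (cor o s n - z) =
     (- 'i%C) ^+ n.+1 * (o - z) + s%:C%C * (1 - 'i%C) :> C.
    rewrite /cor; transitivity ((- 'i%C) ^+ n.+1 * (o - z) +
      s%:C%C * (((- 'i%C) ^+ n * 'i%C ^+ n) * (- 'i%C + (- 'i%C) * 'i%C))  : C).
      by rewrite !exprS; ring.
    by rewrite iN_iX iN mul1r (addrC (- _)).
  by rewrite ReD ReRM /= oppr0 addr0 mulr1; lra.
have -> : (- 'i%C) ^+ n.+1 * (cor o s n.+1 - z) =
   (- 'i%C) ^+ n.+1 * (o - z) + s%:C%C * (1 + 'i%C) :> C.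
  rewrite /cor; transitivity ((- 'i%C) ^+ n.+1 * (o - z) +
    s%:C%C * (((- 'i%C) ^+ n.+1 * 'i%C ^+ n.+1) * (1 + 'i%C))  : C).
    by rewrite !exprS; ring.
  by rewrite iN_iX mul1r.
by rewrite ReD ReRM /= addr0 mulr1; lra.
Qed.

Definition sqI h o s : C := \sum_(k < 4) J h (cor o s k) (cor o s k.+1).

Lemma sqI_bound h o s (E : nat -> set C) (M : R) : 0 <= s -> 0 <= M ->
  (forall k, (k < 4)%N -> [/\ midclosed (E k), E k (cor o s k), E k (cor o s k.+1) &
     forall w, E k w -> nm (h w) <= M]) ->
  nm (sqI h o s) <= 8 * s * M.
Proof.
move=> s0 M0 hE; apply: (le_trans (nm_sum _ _ _)).
have : \sum_(k < 4) nm (J h (cor o s k) (cor o s k.+1)) <= \sum_(k < 4) 2 * s * M.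
  apply: ler_sum => k _; have [mE E1 E2 hM] := hE k (ltn_ord k).
  by apply: (le_trans (J_bound M0 mE hM E1 E2)); rewrite nm_cor_side.
by move=> /le_trans; apply; rewrite !big_ord_recr big_ord0 /=; lra.
Qed.

(** The region between the squares is cut into four quadrilaterals, one per side, each in its own
    convex set of differentiability. The cuts joining corresponding corners cancel because corner 4
    is corner 0. *)
Lemma annulus h o s z s' (E : nat -> set C) :
  (forall k, (k < 4)%N -> [/\ cconv (E k), forall w, E k w -> cdiff h w &
     [/\ E k (cor o s k), E k (cor o s k.+1), E k (cor z s' k) & E k (cor z s' k.+1)]]) ->
  sqI h o s = sqI h z s'.
Proof.
move=> hE; apply/eqP; rewrite -subr_eq0 /sqI -sumrB; apply/eqP.
transitivity (\sum_(k < 4) (J h (cor o s k) (cor z s' k) - J h (cor o s k.+1) (cor z s' k.+1))).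
  apply: eq_bigr => k _; have [cE dE [E1 E2 E3 E4]] := hE k (ltn_ord k).
  have := quad cE dE E1 E2 E4 E3.
  rewrite (J_rev h (cor z s' k) (cor z s' k.+1)) (J_rev h (cor o s k) (cor z s' k)) => e.
  by apply/eqP; rewrite -subr_eq0; apply/eqP; rewrite -[RHS]e; ring.
by rewrite !big_ord_recr big_ord0 /= !cor4; ring.
Qed.

(* [kappa] is [2 i pi], but only [kappa != 0] is needed. *)
Definition kappa : C := sqI (fun w => w^-1) 0 1.

Lemma cdiff_inv z : z != 0 -> cdiff (fun w => w^-1) z.
Proof. by move=> z0; apply: cdiffV => //; exact: cdiff_id. Qed.

Lemma outer0 s n w : 0 < s -> outer 0 s n w -> w != 0.
Proof. by move=> s0 /outer_nm; rewrite subr0 -nm_gt0; exact: lt_le_trans. Qed.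

Lemma sqI_inv_scale z s : 0 < s -> sqI (fun w => (w - z)^-1) z s = kappa.
Proof.
move=> s0; apply: eq_bigr => k _; have s00 : s%:C%C != 0 :> C.
  by rewrite -(rmorph0 (real_complex R)) (inj_eq (@complexI R)) gt_eqF.
have corE n : cor z s n = s%:C%C * cor 0 1 n + z by rewrite /cor; ring.
rewrite !corE -(J_affine (fun w => (w - z)^-1) s%:C%C z).
have [e1 e2] := @outer_cor 0 0 1 1 k ltac:(by rewrite subr0 nm0 subr0).
have cE := outer_cconv 0 1 k; have [mE _] := cE.
rewrite -JZ; first last.
  apply: (intg_ext (h := fun w => s%:C%C^-1 * w^-1) mE _ e1 e2).
    by move=> w Ew; rewrite addrK invfM mulrC.
  apply: intgZ; apply: (intg_diff cE _ e1 e2) => w /(outer0 ltr01); exact: cdiff_inv.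
apply: (J_ext mE _ e1 e2) => w Ew.
by rewrite addrK invfM mulrA divff// mul1r.
Qed.

(** The domain is left abstract so that the formula serves both a disc of radius [2 * s] and the
    closed square itself, which is where the multiplier of Hartogs' lemma is differentiable. *)
Definition sqdom (D : set C) o s :=
  [/\ cconv D, forall k, D (cor o s k) & forall w, nm (w - o) <= s -> D w].

Lemma sqdom_disc o r s : 0 < s -> 2 * s <= r -> sqdom [set w | nm (w - o) <= r] o s.
Proof.
move=> s0 sr; split; first exact: cconv_disc.
  by move=> k; apply: (le_trans (nm_cor o k (ltW s0))).
by move=> w /=; lra.
Qed.

(** The square is shrunk to one about [z] of half-side [s']. There the perimeter [8 * s']
    compensates the kernel, at most [1 / s'], so the integral of [(F w - F z) / (w - z)] is small by
    continuity of [F] at [z]. *)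
Lemma cauchy_formula F D o s z : 0 < s -> sqdom D o s ->
  (forall w, D w -> cdiff F w) -> nm (z - o) < s ->
  sqI (fun w => F w * (w - z)^-1) o s = kappa * F z.
Proof.
move=> s0 [cD corD discD] dF zs.
have z0 := nm_ge0 (z - o).
have key s' : 0 < s' -> 2 * s' <= s - nm (z - o) ->
    sqI (fun w => F w * (w - z)^-1) o s = sqI (fun w => F w * (w - z)^-1) z s'.
  move=> s'0 s's; apply: (annulus (E := fun k => D `&` outer z s' k)) => k _; split.
  - by apply: cconvI => //; exact: outer_cconv.
  - move=> w [/dF dw /outer_nm ow]; apply: cdiffM => //; apply: cdiff_subV.
    by rewrite -subr_eq0 -nm_gt0; exact: lt_le_trans ow.
  - have [a1 a2] := @outer_cor o z s s' k ltac:(lra).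
    have [a3 a4] := @outer_cor z z s' s' k ltac:(by rewrite subrr nm0 subr0).
    have D2 n : D (cor z s' n).
      apply: discD; apply: (le_trans (nm_tri z _ _)); have := nm_cor z n (ltW s'0); lra.
    by split; split.
apply/eqP; rewrite -subr_eq0; apply/eqP/nm_eq0P => e e0.
have zr : D z by apply: discD; exact: ltW.
have [d d0 hd] := cdiff_cont (dF _ zr) (divr_gt0 e0 (ltr0n R 8)).
pose s' := Num.min ((s - nm (z - o)) / 2) (d / 4).
have s'0 : 0 < s' by rewrite lt_min !divr_gt0// subr_gt0.
have s'1 : 2 * s' <= s - nm (z - o).
  have : s' <= (s - nm (z - o)) / 2 by rewrite ge_min lexx.
  lra.
have s'2 : s' <= d / 4 by rewrite ge_min lexx orbT.
rewrite (key s')// -(sqI_inv_scale z s'0) mulrC.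
pose E k := [set w | nm (w - z) <= 2 * s'] `&` outer z s' k.
have cE k : cconv (E k) by apply: cconvI; [exact: cconv_disc|exact: outer_cconv].
have Ecor k : E k (cor z s' k) /\ E k (cor z s' k.+1).
  have [a3 a4] := @outer_cor z z s' s' k ltac:(by rewrite subrr nm0 subr0).
  by split; split => //; exact: (nm_cor _ _ (ltW s'0)).
have Ene k w : E k w -> w - z != 0.
  by move=> [_ /outer_nm ow]; rewrite -nm_gt0; exact: lt_le_trans ow.
have Edf k w : E k w -> cdiff F w.
  move=> [/= wz _]; apply: dF; apply: discD; have := nm_tri z w o; lra.
have Edi k w : E k w -> cdiff (fun w => (w - z)^-1) w.
  by move=> /Ene; rewrite subr_eq0; exact: cdiff_subV.
have -> : sqI (fun w => F w * (w - z)^-1) z s' - F z * sqI (fun w => (w - z)^-1) z s' =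
   sqI (fun w => F w * (w - z)^-1 - F z * (w - z)^-1) z s'.
  rewrite /sqI mulr_sumr -sumrB; apply: eq_bigr => k _; have [E1 E2] := Ecor k.
  have i1 : intg (fun w => F w * (w - z)^-1) (cor z s' k) (cor z s' k.+1).
    apply: (intg_diff (cE k)) => // w Ew; apply: cdiffM; [exact: Edf Ew|exact: Edi Ew].
  have i2 : intg (fun w => (w - z)^-1) (cor z s' k) (cor z s' k.+1).
    by apply: (intg_diff (cE k)) => // w Ew; exact: Edi Ew.
  by rewrite JB//; [rewrite JZ|exact: intgZ].
have -> : e = 8 * s' * (e / 8 / s') by field; rewrite gt_eqF.
apply: (sqI_bound (E := E)); [exact: ltW|by rewrite !divr_ge0// ltW|].
move=> k _; have [E1 E2] := Ecor k; have [mE _] := cE k; split => // w [/= wz /outer_nm ow].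
rewrite -mulrBl nmM nmV ler_pM ?nm_ge0 ?invr_ge0 ?nm_ge0//.
  by apply: hd; apply: (le_lt_trans wz); lra.
by rewrite lef_pV2 ?posrE//; exact: lt_le_trans ow.
Qed.

(** Integrating [1 / w] is invariant under rotation by ['i], so the four sides contribute equally.
    On the top side [1 / w] stays in a closed half-plane that misses 0, and by [J_in] so does its
    mean. *)
Lemma kappa_neq0 : kappa != 0.
Proof.
have in0 : 'i%C != 0 :> C by rewrite -nm_gt0 nm_i.
have -> : kappa = 4%:R * J (fun w => w^-1) (1 + 'i%C) (-1 + 'i%C).
  rewrite /kappa /sqI (_ : 4%:R * _ = \sum_(k < 4) J (fun w => w^-1) (1 + 'i%C) (-1 + 'i%C) :> C); last first.
    by rewrite sumr_const card_ord mulr_natl.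
  apply: eq_bigr => k _.
  have corE n : cor 0 1 (k + n)%N = 'i%C ^+ k * ((1 + 'i%C) * 'i%C ^+ n) + 0 :> C.
    by rewrite /cor exprD mul1r; ring.
  have := corE 0%N; have := corE 1%N; rewrite addn0 addn1 expr0 expr1 mulr1.
  have -> : (1 + 'i%C) * 'i%C = -1 + 'i%C :> C by rewrite mulrDl mul1r -expr2 sqr_i addrC.
  move=> -> ->; rewrite -J_affine.
  have [e1 e2] := @outer_cor 0 0 1 1 0 ltac:(by rewrite subr0 nm0 subr0).
  have cE := outer_cconv 0 1 0; have [mE _] := cE.
  have c0 : cor 0 1 0 = 1 + 'i%C :> C by rewrite /cor expr0 mulr1 mul1r add0r.
  have c1 : cor 0 1 1 = -1 + 'i%C :> C.
    by rewrite /cor expr1 mul1r add0r mulrDl mul1r -expr2 sqr_i addrC.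
  rewrite c0 in e1; rewrite c1 in e2.
  rewrite -JZ; first last.
    apply: (intg_ext (h := fun w => ('i%C ^+ k)^-1 * w^-1) mE _ e1 e2).
      by move=> w Ew; rewrite addr0 invfM mulrC.
    apply: intgZ; apply: (intg_diff cE _ e1 e2) => w /(outer0 ltr01); exact: cdiff_inv.
  apply: (J_ext mE _ e1 e2) => w Ew.
  by rewrite addr0 invfM mulrA divff ?mul1r// expf_neq0.
rewrite mulf_neq0 ?pnatr_eq0//.
pose E : set C := [set z | 1 <= Re ((- 'i%C) * z)] `&` [set z | nm (z - 0) <= 2].
have cE : cconv E by apply: cconvI; [exact: cconv_half|exact: cconv_disc].
have E1 : E (1 + 'i%C).
  split; first by rewrite /=; lra.
  by change (nm (1 + 'i%C - 0 : C) <= 2); rewrite subr0 nm_1i.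
have E2 : E (-1 + 'i%C).
  split; first by rewrite /=; lra.
  change (nm (-1 + 'i%C - 0 : C) <= 2).
  by rewrite subr0 (le_trans (nmD _ _))// nmN nm1 nm_i.
have ne w : E w -> w != 0.
  by move=> [/= h _]; apply/eqP => w0; move: h; rewrite w0 mulr0 /= ler10.
pose B : set C := [set z | 1 / 4 <= Re ('i%C * z)].
have cB : cconv B by exact: cconv_half.
(* For [w = a + i b] the real part of [i / w] is [b / (a ^ 2 + b ^ 2)], with [b >= 1] and
   denominator at most 4. *)
have hB w : E w -> B w^-1.
  move=> Ew; have w0 := ne _ Ew; case: Ew; case: w w0 => a b w0 /=.
  rewrite !subr0 /B/= /nm/= => b1 ab.
  have b1' : 1 <= b by lra.
  have ab2 : a ^+ 2 + b ^+ 2 <= 4.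
    have p0 : 0 <= a ^+ 2 + b ^+ 2 by rewrite addr_ge0 ?sqr_ge0.
    rewrite -(sqr_sqrtr p0) (_ : 4 = 2 ^+ 2 :> R); last by rewrite -natrX.
    by apply: lerXn2r; rewrite ?nnegrE ?sqrtr_ge0.
  have ab0 : 0 < a ^+ 2 + b ^+ 2 by nra.
  have -> : 0 * (a / (a ^+ 2 + b ^+ 2)) - 1 * - (b / (a ^+ 2 + b ^+ 2)) = b / (a ^+ 2 + b ^+ 2) by ring.
  by rewrite ler_pdivlMr//; lra.
have [mE _] := cE.
have [|l Bl ->] := J_in mE cB hB E1 E2.
  by apply: (intg_diff cE _ E1 E2) => w /ne; exact: cdiff_inv.
rewrite mulf_neq0//.
  by rewrite -nm_gt0 opprD addrACA subrr addr0 -opprD nmN (_ : 1 + 1 = 2%:R)// nm_nat.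
by apply/eqP => l0; move: Bl; rewrite /B/= l0 mulr0 /=; lra.
Qed.

Lemma nm_kappa_gt0 : 0 < nm kappa.
Proof. by rewrite nm_gt0 kappa_neq0. Qed.

End Cauchy.
Arguments kappa {R}.

(** * Cauchy estimates, the identity theorem and parameter integrals *)

Section CauchyEstimates.
Variable R : realType.
Local Notation C := R[i].
Implicit Types (h F : C -> C) (z w o p q : C) (s r : R).

Definition sg p q : set C := [set z | exists2 t : R, 0 <= t <= 1 & z = p + t%:C%C * (q - p)].

Lemma sg_l p q : sg p q p.
Proof. by exists 0; rewrite ?lexx ?ler01// mul0r addr0. Qed.

Lemma sg_r p q : sg p q q.
Proof. by exists 1; rewrite ?lexx ?ler01// mul1r addrC subrK. Qed.

Lemma half_real : (2^-1 : R)%:C%C = 2^-1 :> C.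
Proof. by rewrite rmorphV ?unitfE ?pnatr_eq0// rmorph_nat. Qed.

Lemma sg_mid p q : midclosed (sg p q).
Proof.
move=> _ _ [t t01 ->] [t' t'01 ->]; exists (2^-1 * (t + t')); first lra.
by rewrite /mid rmorphM /= half_real rmorphD /=; field.
Qed.

Lemma seg_bounded E h p q : cconv E -> (forall z, E z -> ccont h z) -> E p -> E q ->
  exists2 M, 0 <= M & forall w, sg p q w -> nm (h w) <= M.
Proof.
move=> cE hc; move: p q; apply: (@cousin_seg _ E (fun p q => exists2 M, 0 <= M &
    forall w, sg p q w -> nm (h w) <= M)) => //.
  move=> p q Ep Eq [M M0 hM] [M' M'0 hM']; exists (M + M'); first exact: addr_ge0.
  move=> _ [t /andP[t0 t1] ->]; have [t2|t2] := leP t 2^-1.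
    rewrite (le_trans (hM _ _)) ?lerDl//; exists (2 * t); first lra.
    by rewrite /mid rmorphM rmorph_nat; field.
  rewrite (le_trans (hM' _ _)) ?lerDr//; exists (2 * t - 1); first lra.
  by rewrite /mid rmorphB rmorph1 rmorphM rmorph_nat; field.
move=> z /hc/(_ _ ltr01)[d d0 hd]; exists d => // p q _ _ hp hq.
exists (nm (h z) + 1); first by rewrite addr_ge0// nm_ge0.
move=> _ [t /andP[t0 t1] ->]; rewrite -[h (_ + _)](subrK (h z)) addrC.
apply: (le_trans (nmD _ _)); rewrite lerD2l; apply: hd.
have -> : p + t%:C%C * (q - p) - z = (1 - t)%:C%C * (p - z) + t%:C%C * (q - z).
  by rewrite rmorphB rmorph1; ring.
apply: (le_lt_trans (nmD _ _)); rewrite !nmM !nmR !ger0_norm ?subr_ge0//.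
set x := nm (p - z) in hp *; set y := nm (q - z) in hq *.
have xm : x <= Num.max x y by rewrite le_max lexx.
have ym : y <= Num.max x y by rewrite le_max lexx orbT.
apply: (@le_lt_trans _ _ (Num.max x y)); last by rewrite gt_max hp.
by nra.
Qed.

Definition side o s k := sg (cor o s k) (cor o s k.+1).

Lemma sides_bounded o s r F : 0 <= s -> 2 * s <= r ->
  (forall w, nm (w - o) <= r -> ccont F w) ->
  exists2 M, 0 <= M & forall k w, (k < 4)%N -> side o s k w -> nm (F w) <= M.
Proof.
move=> s0 sr Fc.
have H k : exists M, 0 <= M /\ forall w, side o s k w -> nm (F w) <= M.
  have [M M0 hM] := @seg_bounded [set w | nm (w - o) <= r] F (cor o s k) (cor o s k.+1)
    (cconv_disc o r) Fc (le_trans (nm_cor o k s0) sr) (le_trans (nm_cor o k.+1 s0) sr).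
  by exists M.
have [[M0 [? h0]] [M1 [? h1]] [M2 [? h2]] [M3 [? h3]]] := And4 (H 0%N) (H 1%N) (H 2%N) (H 3%N).
exists (M0 + M1 + M2 + M3); first by rewrite !addr_ge0.
move=> [|[|[|[|//]]]] w _.
- by move=> /h0 ?; lra.
- by move=> /h1 ?; lra.
- by move=> /h2 ?; lra.
- by move=> /h3 ?; lra.
Qed.

(** The perimeter [8 * s] times the bound [2 / s] of the kernel, for points within [s / 2] of the
    centre, divided by the modulus of [kappa]. *)
Definition K0 : R := 16 / nm (kappa : C).
Lemma K0_gt0 : 0 < K0. Proof. by rewrite divr_gt0// nm_kappa_gt0. Qed.

Section Square.
Variables (F : C -> C) (D : set C) (o : C) (s M : R).
Hypotheses (s0 : 0 < s) (sr : sqdom D o s) (M0 : 0 <= M).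
Hypothesis dF : forall w, D w -> cdiff F w.
Hypothesis FM : forall k w, (k < 4)%N -> side o s k w -> nm (F w) <= M.

Let E z k := side o s k `&` outer z (s / 2) k.

Let Ecor z k : nm (z - o) <= s / 2 -> E z k (cor o s k) /\ E z k (cor o s k.+1).
Proof.
move=> hz; have [a1 a2] := @outer_cor _ o z s (s / 2) k ltac:(lra).
by split; split => //; [exact: sg_l|exact: sg_r].
Qed.

Let Emid z k : midclosed (E z k).
Proof.
have [mo _] := outer_cconv z (s / 2) k.
by move=> p q [? ?] [? ?]; split; [exact: sg_mid|exact: mo].
Qed.

Let intgF z (g : C -> C) k : nm (z - o) <= s / 2 ->
  (forall w, nm (w - z) >= s / 2 -> cdiff g w) ->
  intg (fun w => F w * g w) (cor o s k) (cor o s k.+1).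
Proof.
move=> hz gd; have [[_ e1] [_ e2]] := Ecor k hz.
have [cD corD _] := sr.
apply: (intg_diff (E := D `&` outer z (s / 2) k)).
- by apply: cconvI => //; exact: outer_cconv.
- by move=> w [/dF dw /outer_nm ow]; apply: cdiffM => //; exact: gd.
- by split.
- by split.
Qed.

Let outer_inv z w : s / 2 <= nm (w - z) -> w - z != 0 /\ nm (w - z)^-1 <= 2 / s.
Proof.
move=> h; have h0 : 0 < nm (w - z) by apply: lt_le_trans h; rewrite divr_gt0.
split; first by rewrite -nm_gt0.
by rewrite nmV -[2 / s]invrK invf_div lef_pV2 ?posrE// divr_gt0.
Qed.

Let half_lt x : x <= s / 2 -> x < s.
Proof. by move: s0 => ? h; lra. Qed.

Lemma cauchy_bound z : nm (z - o) <= s / 2 -> nm (F z) <= K0 * M.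
Proof.
move=> hz; rewrite /K0 mulrAC ler_pdivlMr ?nm_kappa_gt0// mulrC -nmM.
rewrite -(cauchy_formula s0 sr dF); last exact: half_lt hz.
have -> : 16 * M = 8 * s * (M * (2 / s)) by field; rewrite gt_eqF.
apply: (sqI_bound (E := E z)) => [||k k4]; [exact: ltW|by rewrite mulr_ge0// divr_ge0// ltW|].
have [e1 e2] := Ecor k hz; split => // w [sw /outer_nm/outer_inv[_ ow]].
by rewrite nmM ler_pM ?nm_ge0//; exact: FM sw.
Qed.

Lemma cauchy_lip z z' : nm (z - o) <= s / 2 -> nm (z' - o) <= s / 2 ->
  nm (F z' - F z) <= K0 * M * (2 / s) * nm (z' - z).
Proof.
move=> hz hz'; rewrite /K0 !(mulrAC _ (nm kappa)^-1) ler_pdivlMr ?nm_kappa_gt0//.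
rewrite mulrC -nmM mulrBr -!(cauchy_formula s0 sr dF); [|exact: half_lt..].
have -> : sqI (fun w => F w * (w - z')^-1) o s - sqI (fun w => F w * (w - z)^-1) o s
    = sqI (fun w => F w * (w - z')^-1 - F w * (w - z)^-1) o s.
  rewrite /sqI -sumrB; apply: eq_bigr => k _; rewrite JB//.
    by apply: (intgF (z := z')) => // w /outer_inv[]; rewrite subr_eq0 => + _; exact: cdiff_subV.
  by apply: (intgF (z := z)) => // w /outer_inv[]; rewrite subr_eq0 => + _; exact: cdiff_subV.
have -> : 16 * M * (2 / s) * nm (z' - z) = 8 * s * (M * (nm (z' - z) * (2 / s * (2 / s)))).
  by field; rewrite gt_eqF.
have i0 : 0 <= 2 / s by rewrite divr_ge0// ltW.
apply: (sqI_bound (E := fun k => E z k `&` E z' k)) => [||k k4].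
- exact: ltW.
- exact: (mulr_ge0 M0 (mulr_ge0 (nm_ge0 _) (mulr_ge0 i0 i0))).
- have [e1 e2] := Ecor k hz; have [e3 e4] := Ecor k hz'.
  split; [|by []|by []|].
    by move=> p q [? ?] [? ?]; split; exact: Emid.
  move=> w [[sw /outer_nm/outer_inv[n1 o1]] [_ /outer_nm/outer_inv[n2 o2]]].
  have -> : F w * (w - z')^-1 - F w * (w - z)^-1 = F w * ((z' - z) * ((w - z')^-1 * (w - z)^-1)).
    by field; rewrite n1 n2.
  rewrite !nmM; apply: ler_pM; [exact: nm_ge0|by rewrite !mulr_ge0 ?nm_ge0//|exact: FM sw|].
  by rewrite ler_wpM2l ?nm_ge0// ler_pM// nm_ge0.
Qed.

(** The divided second difference of the Cauchy kernel is [a - b] times a product of three kernels.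
    Difference quotients at a point are therefore Lipschitz in the increment, with a constant that
    depends only on [M] and [s]. *)
Lemma cauchy_quot z a b : nm (z - o) <= s / 2 -> nm (z + a - o) <= s / 2 ->
  nm (z + b - o) <= s / 2 -> a != 0 -> b != 0 ->
  nm ((F (z + a) - F z) * a^-1 - (F (z + b) - F z) * b^-1) <= K0 * M * (2 / s) ^+ 2 * nm (a - b).
Proof.
move=> hz hza hzb a0 b0; rewrite /K0 !(mulrAC _ (nm kappa)^-1) ler_pdivlMr ?nm_kappa_gt0//.
rewrite mulrC -nmM mulrBr [X in nm (X - _)]mulrA [X in nm (_ - X)]mulrA !mulrBr.
rewrite -!(cauchy_formula s0 sr dF); [|exact: half_lt..].
have I c : nm (c - o) <= s / 2 -> forall k, intg (fun w => F w * (w - c)^-1) (cor o s k) (cor o s k.+1).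
  move=> hc k; apply: (intgF (z := c)) => // w /outer_inv[]; rewrite subr_eq0 => + _; exact: cdiff_subV.
have Dq c d : c != 0 -> nm (d - o) <= s / 2 -> nm (z + c - o) <= s / 2 -> d = z ->
   (sqI (fun w => F w * (w - (z + c))^-1) o s - sqI (fun w => F w * (w - z)^-1) o s) * c^-1
   = sqI (fun w => c^-1 * (F w * (w - (z + c))^-1 - F w * (w - z)^-1)) o s.
  move=> c0 _ hc _; rewrite mulrC /sqI -sumrB mulr_sumr; apply: eq_bigr => k _.
  by rewrite -JB ?JZ//; [apply: intgB|..]; apply: I.
rewrite (Dq a z)// (Dq b z)//.
have SB g h : (forall k, intg g (cor o s k) (cor o s k.+1)) ->
   (forall k, intg h (cor o s k) (cor o s k.+1)) ->
   sqI g o s - sqI h o s = sqI (fun w => g w - h w) o s.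
  by move=> ig ih; rewrite /sqI -sumrB; apply: eq_bigr => k _; rewrite JB.
rewrite SB; [|by move=> k; apply: intgZ; apply: intgB; exact: I..].
have -> : 16 * M * (2 / s) ^+ 2 * nm (a - b) = 8 * s * (M * (nm (a - b) * (2 / s * (2 / s) * (2 / s)))).
  by field; rewrite gt_eqF.
have i0 : 0 <= 2 / s by rewrite divr_ge0// ltW.
apply: (sqI_bound (E := fun k => E z k `&` E (z + a) k `&` E (z + b) k)) => [||k k4].
- exact: ltW.
- exact: (mulr_ge0 M0 (mulr_ge0 (nm_ge0 _) (mulr_ge0 (mulr_ge0 i0 i0) i0))).
- have [e1 e2] := Ecor k hz; have [e3 e4] := Ecor k hza; have [e5 e6] := Ecor k hzb.
  split; [|by []|by []|].
    by move=> p q [[? ?] ?] [[? ?] ?]; split; [split|]; exact: Emid.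
  move=> w [[[sw /outer_nm/outer_inv[n1 o1]] [_ /outer_nm/outer_inv[n2 o2]]] [_ /outer_nm/outer_inv[n3 o3]]].
  have -> : a^-1 * (F w * (w - (z + a))^-1 - F w * (w - z)^-1) -
    b^-1 * (F w * (w - (z + b))^-1 - F w * (w - z)^-1) =
    F w * ((a - b) * ((w - z)^-1 * (w - (z + a))^-1 * (w - (z + b))^-1)).
    by field; rewrite n1 n2 n3 a0 b0.
  rewrite !nmM; apply: ler_pM; [exact: nm_ge0|by rewrite !mulr_ge0 ?nm_ge0//|exact: FM sw|].
  rewrite ler_wpM2l ?nm_ge0//; apply: ler_pM => //; rewrite ?nm_ge0 ?mulr_ge0 ?nm_ge0//.
  exact: (ler_pM (nm_ge0 _) (nm_ge0 _) o1 o2).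
Qed.

End Square.

Lemma geom_small (c x : R) e : 0 <= x -> x < 1 -> 0 < e -> exists n : nat, c * x ^+ n < e.
Proof.
move=> x0 x1 e0; have := @cvg_geometric R c x.
rewrite ger0_norm// => /(_ x1)/cvgrPdist_lt/(_ _ e0)[N _ hN].
exists N; have := hN N (leqnn _) => /=; rewrite sub0r normrN.
by apply: le_lt_trans; exact: ler_norm.
Qed.

(* Landau's trick: powers remove the constant from a Cauchy-type estimate. *)
Lemma landau_trick (x M c : R) : 0 <= x -> 0 <= M -> (forall n, x ^+ n <= c * M ^+ n) -> x <= M.
Proof.
move=> x0 M0 h; rewrite leNgt; apply/negP => Mx.
have xp : 0 < x by exact: le_lt_trans Mx.
have [n] := @geom_small c (M / x) 1 ltac:(by rewrite divr_ge0) ltac:(by rewrite ltr_pdivrMr ?mul1r) ltr01.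
by rewrite expr_div_n mulrA ltr_pdivrMr ?exprn_gt0// mul1r ltNge h.
Qed.

Lemma max_square F D o s M z : 0 < s -> sqdom D o s -> 0 <= M ->
  (forall w, D w -> cdiff F w) ->
  (forall k w, (k < 4)%N -> side o s k w -> nm (F w) <= M) ->
  nm (z - o) <= s / 2 -> nm (F z) <= M.
Proof.
move=> s0 sr M0 dF FM zs; apply: (@landau_trick _ _ K0 (nm_ge0 _) M0) => n.
rewrite -nmX; apply: (cauchy_bound (F := fun w => F w ^+ n) s0 sr (exprn_ge0 n M0)) => //.
  by move=> w /dF dw; exact: cdiffX.
  by move=> k w k4 /(FM _ _ k4) h; rewrite nmX lerXn2r// nnegrE// nm_ge0.
Qed.

(** Since [F] vanishes near [z1], the quotient by [(w - z1) ^ N] is still differentiable, its value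
    at [z1] being 0. Cauchy's bound for it gives [nm (F z)] at most a constant times
    [(nm (z - z1) / (r / 4)) ^ N], and the ratio is at most 1/2. No power series is involved. *)
Lemma zero_local F o r z1 : 0 < r -> (forall w, nm (w - o) <= r -> cdiff F w) ->
  nm (z1 - o) <= r / 16 -> (exists2 d, 0 < d & forall w, nm (w - z1) < d -> F w = 0) ->
  forall z, nm (z - o) <= r / 16 -> F z = 0.
Proof.
move=> r0 dF hz1 [d d0 F0] z hz.
have [->|zz1] := eqVneq z z1; first by apply: F0; rewrite subrr nm0.
have n0 : 0 < nm (z - z1) by rewrite nm_gt0 subr_eq0.
have s0 : 0 < r / 4 by rewrite divr_gt0.
have sr : 2 * (r / 4) <= r / 2 by lra.
have dF1 w : nm (w - z1) <= r / 2 -> cdiff F w.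
  by move=> h; apply: dF; have := nm_tri z1 w o; lra.
have [M M0 hM] := sides_bounded (ltW s0) sr (fun w wr => cdiff_cont (dF1 w wr)).
have zs : nm (z - z1) <= r / 4 / 2.
  by have := nm_tri o z z1; rewrite (nmBC o z1); lra.
pose G N w := F w * ((w - z1)^-1) ^+ N.
have dG N w : nm (w - z1) <= r / 2 -> cdiff (G N) w.
  move=> hw; have [->|wz1] := eqVneq w z1.
    have := cdiff_cst 0 z1; apply: (cdiff_near d0) => w' /F0 hw'.
    by rewrite /G hw' mul0r.
  by apply: cdiffM; [exact: dF1|apply: cdiffX; exact: cdiff_subV].
have bG N : nm (G N z) <= K0 * (M * ((r / 4)^-1) ^+ N).
  apply: (cauchy_bound s0 (sqdom_disc z1 s0 sr) _ (dG N) _ zs).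
    by rewrite mulr_ge0// exprn_ge0// invr_ge0 ltW.
  move=> k w k4 sw; rewrite /G nmM; apply: ler_pM; rewrite ?nm_ge0//; first exact: hM sw.
  have ow : r / 4 <= nm (w - z1).
    have [a1 a2] := @outer_cor _ z1 z1 (r/4) (r / 4) k ltac:(by rewrite subrr nm0 subr0).
    move: sw => [t t01 ->]; apply: (outer_nm (n := k)); move: a1 a2.
    rewrite /outer/= => h1 h2; rewrite mulrDr mulrCA ReD ReRM mulrBr ReB.
    by nra.
  rewrite nmX nmV; apply: lerXn2r; rewrite ?nnegrE ?invr_ge0 ?nm_ge0//; first by rewrite ltW.
  by rewrite lef_pV2 ?posrE//; exact: lt_le_trans ow.
apply: nm_eq0P => e e0.
have [N] := @geom_small (K0 * M) 2^-1 e ltac:(by rewrite invr_ge0) ltac:(by rewrite invf_lt1// ltr1n) e0.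
move=> /ltW; apply: le_trans; have := bG N.
rewrite /G nmM nmX nmV -ler_pdivlMr ?exprn_gt0 ?invr_gt0// => /le_trans; apply.
have -> : K0 * (M * (r / 4)^-1 ^+ N) / (nm (z - z1))^-1 ^+ N = K0 * M * ((r / 4)^-1 * nm (z - z1)) ^+ N.
  by rewrite exprMn -[X in _ * _ * X]exprVn !mulrA invrK.
have KM : 0 <= K0 * M by exact: mulr_ge0 (ltW K0_gt0) M0.
have r4 : 0 <= (r / 4)^-1 by rewrite invr_ge0 ltW.
rewrite ler_wpM2l//; apply: lerXn2r; rewrite ?nnegrE ?invr_ge0//; first exact: mulr_ge0 r4 (ltW n0).
by rewrite mulrC ler_pdivrMr//; lra.
Qed.

Definition holo F z := exists2 r : R, 0 < r & forall w, nm (w - z) <= r -> cdiff F w.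

Definition near0 F z := exists2 d : R, 0 < d & forall w, nm (w - z) < d -> F w = 0.

Lemma identity_thm E F p q : cconv E -> (forall z, E z -> holo F z) -> E p -> E q ->
  near0 F p -> near0 F q.
Proof.
move=> cE hF; move: p q; apply: (@cousin_seg _ E (fun p q => near0 F p -> near0 F q)) => //.
  by move=> p q _ _ h1 h2 /h1/h2.
move=> z /hF[r r0 dF]; exists (r / 16); first by rewrite divr_gt0.
move=> p q _ _ hp hq Fp; have := zero_local r0 dF (ltW hp) Fp => Z.
exists (r / 16 - nm (q - z)); first by rewrite subr_gt0.
by move=> w hw; apply: Z; have := nm_tri q w z; lra.
Qed.

(** Lipschitz difference quotients converge along the increments [d / 2 * 2 ^ - n], and then along
    all increments. Completed by this limit at [z], the quotient is the slope function that [cdiff]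
    asks for. *)
Lemma cdiff_of_quot (g : C -> C) z (d L : R) : 0 < d ->
  (forall a b, a != 0 -> b != 0 -> nm a < d -> nm b < d ->
    nm ((g (z + a) - g z) * a^-1 - (g (z + b) - g z) * b^-1) <= L * nm (a - b)) ->
  cdiff g z.
Proof.
move=> d0 hL.
pose a n : C := (d / 2 * 2^-1 ^+ n)%:C%C.
have x0 n : 0 < d / 2 * 2^-1 ^+ n by rewrite mulr_gt0 ?divr_gt0 ?exprn_gt0 ?invr_gt0.
have nma n : nm (a n) = d / 2 * 2^-1 ^+ n by rewrite nmR ger0_norm// ltW.
have an0 n : a n != 0 by rewrite -nm_gt0 nma.
have and n : nm (a n) < d.
  rewrite nma (@le_lt_trans _ _ (d / 2))//; last by lra.
  by rewrite ger_pMr ?divr_gt0// exprn_ile1 ?invr_ge0// invf_le1// ler1n.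
pose Q x := (g (z + x) - g z) * x^-1.
have L0 : 0 <= L.
  have := hL _ _ (an0 0%N) (an0 1%N) (and 0%N) (and 1%N) => /(le_trans (nm_ge0 _)).
  rewrite pmulr_lge0// nm_gt0 subr_eq0; apply/eqP => /(congr1 nm).
  rewrite !nma expr0 expr1; lra.
have [n|l ul ql] := @geometric_cauchy _ (fun n => Q (a n)) (L * (d / 2)).
  apply: (le_trans (hL _ _ (an0 _) (an0 _) (and _) (and _))); rewrite -mulrA ler_wpM2l//.
  rewrite nmBC -rmorphB nmR exprS.
  have -> : d / 2 * 2^-1 ^+ n - d / 2 * (2^-1 * 2^-1 ^+ n) = (d / 2 * 2^-1 ^+ n) / 2 by field.
  by rewrite ger0_norm ?divr_ge0 ?ltW//; have := x0 n; lra.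
have hl x : x != 0 -> nm x < d -> nm (Q x - l) <= L * nm x.
  move=> xn0 xd; apply/ler_addgt0Pl => e e0.
  have [N] := @geom_small (3 * (L * (d / 2))) 2^-1 e ltac:(by rewrite invr_ge0) ltac:(by rewrite invf_lt1// ltr1n) e0.
  move=> he; apply: (le_trans (nm_tri (Q (a N)) _ _)).
  have h1 := hL _ _ xn0 (an0 N) xd (and N); have h2 := ql N.
  have h3 : L * nm (x - a N) <= L * nm x + L * (d / 2 * 2^-1 ^+ N).
    by rewrite -mulrDr -nma ler_wpM2l// nmB.
  rewrite -/(Q x) -/(Q (a N)) in h1; nra.
exists (fun w => if w == z then l else Q (w - z)).
  move=> e e0; have L1 : 0 < L + 1 by rewrite ltr_pwDr.
  exists (Num.min d (e / (L + 1))); first by rewrite lt_min d0 divr_gt0.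
  move=> w; rewrite lt_min => /andP[wd we]; rewrite eqxx.
  case: eqVneq => [_|wz]; first by rewrite subrr nm0 ltW.
  apply: (le_trans (hl _ _ wd)); first by rewrite subr_eq0.
  move: we; rewrite ltr_pdivlMr// => /ltW; apply: le_trans; rewrite mulrC ler_wpM2l ?nm_ge0//.
  by rewrite lerDl.
exists 1 => // w _; case: eqVneq => [->|wz]; first by rewrite subrr mulr0 addr0.
rewrite /Q [z + _]addrC subrK divfK ?subr_eq0//.
by rewrite addrC subrK.
Qed.

Lemma param_integral (F : C -> C -> C) (E : set C) p q r M :
  midclosed E -> E p -> E q -> 0 < r -> 0 <= M ->
  (forall l z, nm l <= r -> E z -> cdiff (F ^~ z) l /\ nm (F l z) <= M) ->
  (forall l, nm l <= r -> intg (F l) p q) ->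
  forall l, nm l <= r / 8 -> cdiff (fun l => J (F l) p q) l.
Proof.
move=> mE Ep Eq r0 M0 hF iF l hl.
have s0 : 0 < r / 2 by rewrite divr_gt0.
have sr : 2 * (r / 2) <= r by lra.
apply: (@cdiff_of_quot _ _ (r / 8) (nm (q - p) * (K0 * M * (2 / (r / 2)) ^+ 2))).
  by rewrite divr_gt0.
move=> a b a0 b0 ha hb.
have la : nm (l + a) <= r / 4 by have := nmD l a; lra.
have lb : nm (l + b) <= r / 4 by have := nmD l b; lra.
have I x : nm x <= r / 4 -> intg (F x) p q by move=> h; apply: iF; lra.
have Il : intg (F l) p q by apply: I; lra.
have Ia := I _ la; have Ib := I _ lb.
have e c : intg (F (l + c)) p q ->
   (J (F (l + c)) p q - J (F l) p q) * c^-1 = J (fun z => c^-1 * (F (l + c) z - F l z)) p q.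
  by move=> Ic; rewrite JZ; [rewrite JB// mulrC|exact: intgB].
rewrite !e// -JB; [|by apply: intgZ; exact: intgB..].
rewrite -mulrA; apply: (J_bound (E := E)) => //.
  have r2 : 0 <= 2 / (r / 2) by rewrite divr_ge0// ltW.
  exact: (mulr_ge0 (mulr_ge0 (mulr_ge0 (ltW K0_gt0) M0) (exprn_ge0 2 r2)) (nm_ge0 _)).
move=> z Ez; rewrite ![_^-1 * _]mulrC.
have d1 w : nm (w - 0) <= r -> cdiff (F ^~ z) w by rewrite subr0 => /hF/(_ Ez)[].
have d2 k w : (k < 4)%N -> side 0 (r / 2) k w -> nm (F w z) <= M.
  move=> k4 [t t01 ->]; set v := _ + _; suff: nm v <= r by move=> /hF/(_ Ez)[].
  rewrite /v -[_ + _]subr0.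
  have h1 := @nm_cor _ 0 (r/2) k (ltW s0); have h2 := @nm_cor _ 0 (r/2) k.+1 (ltW s0).
  set x := cor 0 (r / 2) k in h1 *; set y := cor 0 (r / 2) k.+1 in h2 *.
  have -> : x + t%:C%C * (y - x) - 0 = (1 - t)%:C%C * (x - 0) + t%:C%C * (y - 0) :> C.
    by rewrite rmorphB rmorph1; ring.
  apply: (le_trans (nmD _ _)); rewrite !nmM !nmR !ger0_norm; [|lra..].
  by have := nm_ge0 (x - 0); have := nm_ge0 (y - 0); nra.
by apply: (cauchy_quot s0 (sqdom_disc 0 s0 sr) M0 d1 d2) => //; rewrite subr0; lra.
Qed.

End CauchyEstimates.

(** * Hartogs' theorem on separate holomorphy *)

Section SmallCovers.
Variable R : realType.
Local Notation mu := (@lebesgue_measure R).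

(** Bisection in the strip where the real part is in [[0, 1]], with a predicate that sees only real
    parts. *)
Lemma cousin_R (P : R -> R -> Prop) :
  (forall p q : R, 0 <= p -> p < q -> q <= 1 -> P p ((p + q) / 2) -> P ((p + q) / 2) q -> P p q) ->
  (forall x : R, 0 <= x <= 1 -> exists2 d : R, 0 < d & forall p q : R, 0 <= p -> p < q -> q <= 1 ->
     `|p - x| < d -> `|q - x| < d -> P p q) -> P 0 1.
Proof.
move=> Padd Ploc.
pose E : set R[i] := [set z | 0 <= Re (1 * z)] `&` [set z | -1 <= Re ((-1) * z)].
have EE z : E z -> 0 <= Re z <= 1.
  move=> []; rewrite /= mul1r mulN1r; case: z => a b /= -> /=; lra.
have cE : cconv E by apply: cconvI; exact: cconv_half.
have := @cousin_seg _ E (fun p q => Re p < Re q -> P (Re p) (Re q)) cE.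
move=> /(_ _ _ 0 1); apply => //=; rewrite ?ltr01//.
- move=> p q /EE Ep /EE Eq h1 h2 pq.
  have e : Re (mid p q) = (Re p + Re q) / 2.
    by rewrite /mid -half_real ReRM ReD mulrC.
  by apply: Padd => //; [lra|lra|rewrite -e; apply: h1; rewrite e; lra|rewrite -e; apply: h2; rewrite e; lra].
- move=> z /EE /Ploc[d d0 hd]; exists d => // p q /EE Ep /EE Eq hp hq pq.
  apply: hd => //; [lra|lra|apply: le_lt_trans hp|apply: le_lt_trans hq]; by rewrite -ReB nm_Re.
- by split; rewrite /= mulr0 /= ?lexx; lra.
- by split; rewrite /= ?mulr1/=; lra.
Qed.

(** Half-open, so that the two halves of an interval are disjoint and their measures add up
    exactly. *)
Definition ico (p q : R) : set R := `[p, q[%classic.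

Lemma measurable_ico p q : measurable (ico p q).
Proof. exact: measurable_itv. Qed.

(** Bisection stops at intervals on which [G] holds or which lie in [U]. The latter are the list
    [L]; their half-open versions are disjoint parts of [U], hence the bound on the total length. *)
Lemma interval_cover (U : set R) (G : R -> Prop) : measurable U ->
  (forall x : R, 0 <= x <= 1 ->
    (exists2 d : R, 0 < d & forall y : R, `|y - x| < d -> 0 <= y <= 1 -> G y) \/
    (exists2 d : R, 0 < d & forall y : R, `|y - x| < d -> 0 <= y <= 1 -> U y)) ->
  exists L : seq (R * R), [/\ forall e, e \in L -> e.1 < e.2,
    ((\sum_(e <- L) (e.2 - e.1))%:E <= mu U)%E &
    forall x : R, 0 <= x <= 1 -> G x \/ exists2 e, e \in L & e.1 <= x <= e.2].
Proof.
move=> mU loc.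
suff [L [h1 h2 h3]] : exists L : seq (R * R), [/\ forall e, e \in L -> e.1 < e.2,
    ((\sum_(e <- L) (e.2 - e.1))%:E <= mu (U `&` ico 0%R 1%R))%E &
    forall x : R, 0 <= x <= 1 -> G x \/ exists2 e, e \in L & e.1 <= x <= e.2].
  exists L; split => //; apply: (le_trans h2); apply: le_measure; [rewrite inE|rewrite inE//|by move=> x []].
  by apply: measurableI => //; exact: measurable_ico.
apply: (@cousin_R (fun p q => exists L : seq (R * R), [/\ forall e, e \in L -> e.1 < e.2,
    ((\sum_(e <- L) (e.2 - e.1))%:E <= mu (U `&` ico p q))%E &
    forall x : R, p <= x <= q -> G x \/ exists2 e, e \in L & e.1 <= x <= e.2])).
  move=> p q p0 pq q1 [L [h1 h2 h3]] [L' [h1' h2' h3']]; exists (L ++ L'); split.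
  - by move=> e; rewrite mem_cat => /orP[/h1|/h1'].
  - rewrite big_cat/= EFinD.
    have -> : U `&` ico p q = (U `&` ico p ((p + q) / 2)) `|` (U `&` ico ((p + q) / 2) q).
      apply/seteqP; split => x; rewrite /ico/= !in_itv/=.
        move=> [Ux /andP[xp xq]]; have [xm|xm] := ltP x ((p + q) / 2).
          by left; rewrite xp.
        by right; rewrite xq.
      move=> [[Ux /andP[x1 x2]]|[Ux /andP[x1 x2]]]; split => //; apply/andP; split => //; lra.
    rewrite measureU; [|by apply: measurableI => //; exact: measurable_ico..|].
      exact: leeD.
    apply/seteqP; split => x //= [[_ +] [_ +]]; rewrite /ico/= !in_itv/=; lra.
  - move=> x /andP[xp xq]; have [xm|xm] := lerP x ((p + q) / 2).
      have [|?|[e eL xe]] := h3 x; [lra|by left|right].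
      by exists e => //; rewrite mem_cat eL.
    have [|?|[e eL xe]] := h3' x; [lra|by left|right].
    by exists e => //; rewrite mem_cat eL orbT.
move=> x /loc[[d d0 hd]|[d d0 hd]]; exists d => // p q p0 pq q1 hp hq.
  exists [::]; split => //; first by rewrite big_nil measure_ge0.
  move=> y /andP[py yq]; left; apply: hd; last by lra.
  rewrite ltr_norml; move: hp hq; rewrite !ltr_norml; lra.
have sub : ico p q `<=` U.
  move=> y; rewrite /ico/= in_itv/= => /andP[py yq]; apply: hd; last by lra.
  rewrite ltr_norml; move: hp hq; rewrite !ltr_norml; lra.
exists [:: (p, q)]; split.
- by move=> e; rewrite inE => /eqP ->.
- rewrite big_seq1/= setIidr// /ico lebesgue_measure_itv/= lte_fin pq.
  by rewrite EFinB.
- by move=> y pyq; right; exists (p, q); rewrite ?inE.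
Qed.

(** The complements of the increasing, relatively closed sets [E N] decrease to the empty set, so
    their measure tends to 0. The order of quantifiers matters: [N0] is fixed before [G], and
    [hartogs_coef] takes a different [G] for each index [n]. *)
Lemma exhaustion_cover (E : nat -> set R) (eta : R) : 0 < eta ->
  (forall N (x : R), 0 <= x <= 1 -> ~ E N x ->
     exists2 d : R, 0 < d & forall y : R, `|y - x| < d -> 0 <= y <= 1 -> ~ E N y) ->
  (forall N M, (N <= M)%N -> E N `<=` E M) ->
  (forall x : R, 0 <= x <= 1 -> exists N, E N x) ->
  exists N0, forall N, (N0 <= N)%N -> forall G : R -> Prop,
  (forall x : R, 0 <= x <= 1 -> 
    (exists2 d : R, 0 < d & forall y : R, `|y - x| < d -> 0 <= y <= 1 -> G y) \/
    (exists2 d : R, 0 < d & forall y : R, `|y - x| < d -> 0 <= y <= 1 -> ~ E N y)) ->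
  exists L : seq (R * R), [/\ forall e, e \in L -> e.1 < e.2,
    \sum_(e <- L) (e.2 - e.1) <= eta &
    forall x : R, 0 <= x <= 1 -> G x \/ exists2 e, e \in L & e.1 <= x <= e.2].
Proof.
move=> eta0 cE mE uE.
pose I : set R := `[0, 1]%classic.
have II x : I x <-> 0 <= x <= 1 by rewrite /I/= in_itv.
pose U N := I `\` (E N `&` I).
have mEI N : measurable (E N `&` I).
  apply: measurable_realfun.closed_measurable; rewrite -[_ `&` _]setCK; apply: open_closedC.
  rewrite openE => x /= nx; apply/nbhs_ballP.
  have [xI|xI] := pselect (I x).
    have nE : ~ E N x by move=> Ex; apply: nx.
    have [d d0 hd] := cE N x (iffLR (II x) xI) nE; exists d => //= y xy [Ey /II Iy].
    by apply: (hd y) => //; rewrite distrC.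
  have : open (~` I) by apply: closed_openC; exact: interval_closed.
  rewrite openE => /(_ _ xI)/nbhs_ballP[d d0 hd]; exists d => // y /hd nI [_ Iy].
  exact: nI.
have mU N : measurable (U N) by apply: measurableD => //; exact: measurable_itv.
have cap0 : \bigcap_n U n = set0.
  apply/seteqP; split => // x Ux; have [Ix _] := Ux 0%N Logic.I.
  have [N EN] := uE _ (iffLR (II x) Ix); have [_] := Ux N Logic.I; exact.
have : mu \o U @ \oo --> mu (\bigcap_n U n).
  apply: nonincreasing_cvg_mu => //.
  - apply: (@le_lt_trans _ _ (mu I)).
      by apply: le_measure; rewrite ?inE; [exact: mU|exact: measurable_itv|move=> x []].
    by rewrite lebesgue_measure_itv/= lte_fin ltr01 -EFinB ltry.
  - by rewrite cap0.
  - move=> N M NM; apply/subsetPset => x [Ix nE]; split => // -[Ex _]; apply: nE.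
    by split => //; exact: mE NM _ Ex.
rewrite cap0 measure0 => /fine_cvgP[_ /cvgrPdist_lt/(_ _ eta0)[N0 _ hN0]].
exists N0 => N NN G loc.
have finU : mu (U N) \is a fin_num.
  rewrite ge0_fin_numE ?measure_ge0//; apply: (@le_lt_trans _ _ (mu I)).
    by apply: le_measure; rewrite ?inE; [exact: mU|exact: measurable_itv|move=> x []].
  by rewrite lebesgue_measure_itv/= lte_fin ltr01 -EFinB ltry.
have [x xI|L [h1 h2 h3]] := @interval_cover (U N) G (mU N).
  have [[d d0 hd]|[d d0 hd]] := loc x xI; [left|right]; exists d => // y xy yI.
  by split; [exact/II|move=> [Ey _]; exact: (hd _ xy yI Ey)].
exists L; split => //; rewrite -lee_fin (le_trans h2)// -(fineK finU) lee_fin.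
by have := hN0 _ NN; rewrite /= sub0r normrN => /ltW; apply: le_trans; exact: ler_norm.
Qed.

End SmallCovers.

(** * The multiplier for Hartogs' lemma *)

Section HartogsLemma.
Variable R : realType.
Local Notation C := R[i].
Implicit Types (z w l : C).

(** The closed square with corners [cor 0 tau k]; by periodicity only four of the half-planes are
    distinct. *)
Definition sqin (tau : R) : set C :=
  [set w | forall k : nat, Re ((- 'i%C) ^+ k.+1 * w) <= tau].

Lemma ReN z : Re (- z) = - Re z. Proof. by case: z. Qed.

Lemma sqin_dom tau : 0 < tau -> sqdom (sqin tau) 0 tau.
Proof.
move=> t0; split.
- have cH (k : nat) : cconv [set w : C | - tau <= Re (- ((- 'i%C) ^+ k.+1) * w)] by exact: cconv_half.
  have H w : sqin tau w <-> forall k, - tau <= Re (- ((- 'i%C) ^+ k.+1) * w).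
    by split => h k; have := h k; rewrite mulNr ReN lerN2.
  split; first by move=> p q /H hp /H hq; apply/H => k; have [m _] := cH k; exact: (m _ _ (hp k) (hq k)).
  by move=> u l h ul; apply/H => k; have [_ c] := cH k; apply: (c u) => // n; exact: (iffLR (H _) (h n)).
- move=> j k; rewrite /cor add0r mulrCA ReRM mulrCA.
  have iI n : (- 'i%C : C) ^+ n = 'i%C ^+ (3 * n)%N.
    by rewrite exprM; congr (_ ^+ _); rewrite exprS sqr_i mulrN mulr1.
  rewrite iI -exprD; move: (_ + _)%N => n.
  rewrite (divn_eq n 4) exprD mulnC exprM i4 expr1n mul1r.
  have : (n %% 4 < 4)%N by rewrite ltn_pmod.
  rewrite -[leRHS]mulr1 ler_pM2l//; case: (n %% 4)%N => [|[|[|[|//]]]] _.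
  - by rewrite expr0 /=; lra.
  - by rewrite expr1 /=; lra.
  - by rewrite sqr_i /=; lra.
  - by rewrite exprS sqr_i /=; lra.
- move=> w; rewrite subr0 => wt k; apply: le_trans wt; apply: (le_trans (ler_norm _)).
  by apply: (le_trans (nm_Re _)); rewrite nmM nmX nmN nm_i expr1n mul1r.
Qed.

Definition lam (tau : R) k (x : R) : C :=
  cor 0 tau k + x%:C%C * (cor 0 tau k.+1 - cor 0 tau k).

(* The affine coordinate for which the square lies in the upper half-plane and its side [k] is [0,
   1]. *)
Definition sidec (tau : R) k l : C :=
  2^-1 * (1 + 'i%C) - (2 * tau)^-1%:C%C * ((- 'i%C) ^+ k * l).

Lemma sidec_lam tau k x : 0 < tau -> sidec tau k (lam tau k x) = x%:C%C.
Proof.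
move=> t0; have t0' : tau%:C%C != 0 :> C.
  by rewrite -(rmorph0 (real_complex R)) (inj_eq (@complexI R)) gt_eqF.
rewrite /sidec; have -> : (2 * tau)^-1%:C%C = (2 * tau%:C%C)^-1 :> C.
  by rewrite -[LHS]/((real_complex R) (2 * tau)^-1) fmorphV rmorphM rmorph_nat.
rewrite /lam /cor !add0r exprS.
have -> : (- 'i%C) ^+ k * (tau%:C%C * ((1 + 'i%C) * 'i%C ^+ k) +
    x%:C%C * (tau%:C%C * ((1 + 'i%C) * ('i%C * 'i%C ^+ k)) - tau%:C%C * ((1 + 'i%C) * 'i%C ^+ k))) =
    ((- 'i%C) ^+ k * 'i%C ^+ k) * (tau%:C%C * ((1 + 'i%C) + x%:C%C * ('i%C ^+ 2 - 1))) :> C by ring.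
by rewrite iN_iX sqr_i; field; exact: t0'.
Qed.

Lemma Im_sidec tau k l : 0 < tau -> sqin tau l -> 0 <= Im (sidec tau k l).
Proof.
move=> t0 /(_ k); rewrite exprS -mulrA /sidec ImD.
set z := (- 'i%C) ^+ k * l; have -> : Re (- 'i%C * z) = Im z.
  by case: z => a b /=; lra.
have -> : Im (2^-1 * (1 + 'i%C) : C) = 2^-1.
  by rewrite -half_real ImRM /=; lra.
have -> : Im (- ((2 * tau)^-1%:C%C * z)) = - (Im z / (2 * tau)).
  by rewrite -mulNr -rmorphN ImRM mulNr mulrC.
move=> h; rewrite subr_ge0 ler_pdivrMr ?mulr_gt0//; lra.
Qed.

Lemma Im_sidec_in tau k l : 0 < tau -> nm l <= tau / 2 -> 4^-1 <= Im (sidec tau k l).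
Proof.
move=> t0 hl; rewrite /sidec ImD.
have -> : Im (2^-1 * (1 + 'i%C) : C) = 2^-1.
  by rewrite -half_real ImRM /=; lra.
rewrite -mulNr -rmorphN ImRM.
have h1 : `|Im ((- 'i%C) ^+ k * l)| <= tau / 2.
  by apply: (le_trans (nm_Im _)); rewrite nmM nmX nmN nm_i expr1n mul1r.
have : `|- (2 * tau)^-1 * Im ((- 'i%C) ^+ k * l)| <= 4^-1.
  rewrite normrM normrN [`|_^-1|]ger0_norm ?invr_ge0 ?mulr_ge0 ?(ltW t0)//.
  rewrite ler_pdivrMl ?mulr_gt0//; lra.
rewrite ler_norml; lra.
Qed.

Lemma cdiff_sidec tau k l : cdiff (sidec tau k) l.
Proof.
have := cdiff_affine (h := id) (a := - ((2 * tau)^-1%:C%C * (- 'i%C) ^+ k)) (b := 2^-1 * (1 + 'i%C)) (cdiff_id _).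
move=> /(_ l); apply: (@cdiff_near _ _ _ _ 1) => // w _; rewrite /sidec; ring.
Qed.

(* On the square this has nonnegative real part, at least 1/2 on the interval [e] of side [k];
   inside it is small with the length of [e]. *)
Definition ker (tau : R) k (e : R * R) l : C :=
  (e.2 - e.1)%:C%C * 'i%C / (sidec tau k l - e.1%:C%C + 'i%C * (e.2 - e.1)%:C%C).

Lemma ker_den tau k e l : e.1 < e.2 -> 0 <= Im (sidec tau k l) ->
  sidec tau k l - e.1%:C%C + 'i%C * (e.2 - e.1)%:C%C != 0.
Proof.
case: e => s t /= st; case: (sidec tau k l) => a b /= b0.
apply/eqP => /(congr1 Im) /=; lra.
Qed.

Lemma cdiff_ker tau k e l : e.1 < e.2 -> 0 <= Im (sidec tau k l) -> cdiff (ker tau k e) l.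
Proof.
move=> e12 b0; apply: cdiffM; first exact: cdiff_cst.
apply: cdiffV; first exact: ker_den.
apply: cdiffD; last exact: cdiff_cst.
by apply: cdiffB; [exact: cdiff_sidec|exact: cdiff_cst].
Qed.

Lemma Re_divi (r a b : R) : Re (r%:C%C * 'i%C / (a +i* b)%C) = r * b / (a ^+ 2 + b ^+ 2).
Proof. by rewrite /=; ring. Qed.

Lemma ker_Re_ge0 tau k e l : e.1 < e.2 -> 0 <= Im (sidec tau k l) -> 0 <= Re (ker tau k e l).
Proof.
case: e => s t /= st; rewrite /ker /=; case: (sidec tau k l) => a b b0.
have -> : (a +i* b)%C - s%:C%C + 'i%C * (t - s)%:C%C = ((a - s) +i* (b + (t - s)))%C.
  by apply/eqP; rewrite eq_complex /=; apply/andP; split; apply/eqP; ring.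
rewrite Re_divi divr_ge0 ?addr_ge0 ?sqr_ge0// mulr_ge0//; move: b0 => /=; lra.
Qed.

(** With [h = e.2 - e.1] and [y = x - e.1] the real part is [h ^ 2 / (y ^ 2 + h ^ 2)], and
    [0 <= y <= h]. *)
Lemma ker_Re_bad tau k e x : 0 < tau -> e.1 < e.2 -> e.1 <= x <= e.2 ->
  2^-1 <= Re (ker tau k e (lam tau k x)).
Proof.
case: e => s t /= t0 st sxt; rewrite /ker /= sidec_lam//.
have -> : x%:C%C - s%:C%C + 'i%C * (t - s)%:C%C = ((x - s) +i* (t - s))%C :> C.
  by apply/eqP; rewrite eq_complex /=; apply/andP; split; apply/eqP; ring.
have p : 0 < (t - s) ^+ 2 by rewrite exprn_gt0 ?subr_gt0.
have q : (x - s) ^+ 2 <= (t - s) ^+ 2.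
  by apply: lerXn2r; rewrite ?nnegrE ?subr_ge0; lra.
have q0 := sqr_ge0 (x - s).
by rewrite Re_divi ler_pdivlMr -?expr2; lra.
Qed.

(** In the half-size disc the coordinate [sidec] has imaginary part at least 1/4, which bounds the
    denominator from below; this is the factor 4. *)
Lemma ker_nm tau k e l : 0 < tau -> e.1 < e.2 -> nm l <= tau / 2 ->
  nm (ker tau k e l) <= 4 * (e.2 - e.1).
Proof.
case: e => s t /= t0 st /(Im_sidec_in k t0); rewrite /ker /=; case: (sidec tau k l) => a b b0.
have -> : (a +i* b)%C - s%:C%C + 'i%C * (t - s)%:C%C = ((a - s) +i* (b + (t - s)))%C.
  by apply/eqP; rewrite eq_complex /=; apply/andP; split; apply/eqP; ring.
move: b0 => /= b0; have h := nm_Im ((a - s) +i* (b + (t - s)))%C.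
have ge4 : 4^-1 <= nm ((a - s) +i* (b + (t - s)))%C.
  by apply: le_trans h; rewrite /=; apply: le_trans (ler_norm _); lra.
have n0 : 0 < nm ((a - s) +i* (b + (t - s)))%C by apply: lt_le_trans ge4; rewrite invr_gt0.
rewrite !nmM nm_i mulr1 nmV nmR ger0_norm ?subr_ge0 ?(ltW st)// mulrC ler_wpM2r ?subr_ge0 ?(ltW st)//.
by rewrite -[4]invrK lef_pV2 ?posrE ?invr_gt0.
Qed.

Section Multiplier.
Variables (tau : R) (L : seq (R * R)) (eta : R).
Hypotheses (t0 : 0 < tau) (L12 : forall e, e \in L -> e.1 < e.2)
  (Leta : \sum_(e <- L) (e.2 - e.1) <= eta).

Let H l : C := \sum_(k < 4) \sum_(e <- L) ker tau k e l.
(** A rational substitute for the exponential of minus a harmonic measure. A nonnegative real part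
    of [H] gives modulus at most 1, a real part at least 1/2 gives modulus at most 1/2, and a small
    [H] gives modulus close to 1. *)
Definition multiplier l : C := (1 + 2 * H l)^-1.

Lemma Re_sum (I : Type) (r : seq I) (P : pred I) (f : I -> C) :
  Re (\sum_(i <- r | P i) f i) = \sum_(i <- r | P i) Re (f i).
Proof. by elim/big_rec2: _ => // i x y _ <-; rewrite ReD. Qed.

Let H_ge0 l : sqin tau l -> 0 <= Re (H l).
Proof.
move=> sl; rewrite /H Re_sum; apply: sumr_ge0 => k _; rewrite Re_sum big_seq.
by apply: sumr_ge0 => e /L12 e12; apply: ker_Re_ge0 => //; exact: Im_sidec.
Qed.

Let den_Re l : Re (1 + 2 * H l) = 1 + 2 * Re (H l).
Proof. by rewrite ReD; congr (_ + _); rewrite -(rmorph_nat (real_complex R)) ReRM. Qed.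

Let den_ge1 l : sqin tau l -> 1 + 2 * Re (H l) <= nm (1 + 2 * H l).
Proof. by move=> _; rewrite -den_Re; apply: le_trans (ler_norm _) (nm_Re _). Qed.

Let den_gt0 l : sqin tau l -> 0 < nm (1 + 2 * H l).
Proof. by move=> sl; apply: lt_le_trans (den_ge1 sl); have := H_ge0 sl; lra. Qed.

Lemma multiplier_diff l : sqin tau l -> cdiff multiplier l.
Proof.
move=> sl; apply: cdiffV; first by rewrite -nm_gt0 den_gt0.
apply: cdiffD; first exact: cdiff_cst.
apply: cdiffM; first exact: cdiff_cst.
apply: cdiff_sum => k _.
have -> : (fun w => \sum_(e <- L) ker tau k e w) = (fun w => \sum_(e <- L | e \in L) ker tau k e w).
  by apply/funext => w; rewrite big_seq.
by apply: cdiff_sum => e /L12 e12; apply: cdiff_ker => //; exact: Im_sidec.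
Qed.

Lemma multiplier_le1 l : sqin tau l -> nm (multiplier l) <= 1.
Proof.
move=> sl; rewrite nmV invf_le1 ?den_gt0//; apply: le_trans (den_ge1 sl).
by have := H_ge0 sl; lra.
Qed.

Lemma sqin_lam k x : 0 <= x <= 1 -> sqin tau (lam tau k x).
Proof.
move=> x01; have [[mE cE] corE _] := sqin_dom t0.
rewrite /lam => n; rewrite mulrDr mulrCA ReD ReRM mulrBr ReB.
have := corE k n; have := corE k.+1 n; nra.
Qed.

Lemma multiplier_bad k x : (k < 4)%N -> 0 <= x <= 1 -> (exists2 e, e \in L & e.1 <= x <= e.2) ->
  nm (multiplier (lam tau k x)) <= 2^-1.
Proof.
move=> k4 x01 [e eL xe]; have sl := sqin_lam k x01.
rewrite nmV lef_pV2 ?posrE ?den_gt0//; apply: le_trans (den_ge1 sl).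
suff : 2^-1 <= Re (H (lam tau k x)) by lra.
rewrite /H Re_sum (bigD1 (Ordinal k4))//= Re_sum (big_rem _ eL)/=.
rewrite -[2^-1]addr0 lerD//.
  rewrite -[2^-1]addr0 lerD//; first by apply: ker_Re_bad => //; exact: L12.
  rewrite big_seq; apply: sumr_ge0 => e' /mem_rem/L12 e12; apply: ker_Re_ge0 => //.
  exact: Im_sidec.
apply: sumr_ge0 => j _; rewrite Re_sum big_seq; apply: sumr_ge0 => e' /L12 e12.
by apply: ker_Re_ge0 => //; exact: Im_sidec.
Qed.

(** The constant 32 is the factor 2 of the definition, times four sides, times the 4 of [ker_nm]. *)
Lemma multiplier_in l : nm l <= tau / 2 -> 1 <= (1 + 32 * eta) * nm (multiplier l).
Proof.
move=> hl.
have sl : sqin tau l.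
  have [_ _ +] := sqin_dom t0; apply; rewrite subr0; apply: (le_trans hl); have := t0; lra.
rewrite nmV ler_pdivlMr ?den_gt0// mul1r; apply: (le_trans (nmD _ _)).
rewrite nm1 lerD2l nmM nm_nat.
suff : nm (H l) <= 4 * (4 * eta) by move=> h; apply: (le_trans (ler_wpM2l _ h)) => //; lra.
apply: (le_trans (nm_sum _ _ _)).
have : \sum_(k < 4) nm (\sum_(e <- L) ker tau k e l) <= \sum_(k < 4) 4 * eta.
  apply: ler_sum => k _; apply: (le_trans (nm_sum _ _ _)).
  apply: (@le_trans _ _ (\sum_(e <- L) 4 * (e.2 - e.1))).
    by rewrite big_seq [leRHS]big_seq; apply: ler_sum => e /L12 e12; exact: ker_nm.
  by rewrite -mulr_sumr ler_wpM2l.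
by move=> /le_trans; apply; rewrite !big_ord_recr big_ord0 /=; lra.
Qed.

End Multiplier.

End HartogsLemma.

(** * Uniform growth of families of holomorphic functions *)

Section HartogsTheorem.
Variable R : realType.
Local Notation C := R[i].
Implicit Types (z w l : C).

Lemma sqin_nm (tau : R) w : sqin tau w -> nm w <= 2 * tau.
Proof.
move=> h; have := h 0%N; have := h 1%N; have := h 2%N; have := h 3%N.
have -> : (- 'i%C) ^+ 4 = 1 :> C by rewrite exprNn i4 -signr_odd /= mulr1.
have -> : (- 'i%C) ^+ 2 = -1 :> C by rewrite sqrrN sqr_i.
have -> : (- 'i%C) ^+ 3 = 'i%C :> C by rewrite exprS sqrrN sqr_i mulrN1 opprK.
rewrite expr1 => h1 h2 h3 h4; apply: (le_trans (nm_ReIm _)).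
have [h5 h6] : `|Re w| <= tau /\ `|Im w| <= tau.
  by rewrite !ler_norml; move: h1 h2 h3 h4; case: (w) => a b /=; lra.
lra.
Qed.

Lemma ex_natr_ge (x : R) : exists N : nat, x <= N%:R.
Proof. by exists (Num.truncn x).+1; exact/ltW/truncnS_gt. Qed.

(** By convexity the power lies below its chord over [[0, 1]]. *)
Lemma expr_1plus_le (d : R) p : 0 <= d <= 1 -> (1 + d) ^+ p <= 1 + (2 ^+ p - 1) * d.
Proof.
move=> d01; elim: p => [|p IH]; first by rewrite !expr0; lra.
rewrite !exprS; have p1 : 1 <= (2 : R) ^+ p by rewrite exprn_ege1// ler1n.
have q0 : 0 <= 1 + d by lra.
apply: (le_trans (ler_wpM2l q0 IH)); move: p1; set P := 2 ^+ p => p1.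
have : 0 <= (P - 1) * (d * (1 - d)) by rewrite !mulr_ge0 ?subr_ge0//; lra.
lra.
Qed.

Lemma lam_lip (tau : R) k (t t' : R) : 0 < tau ->
  nm (lam tau k t' - lam tau k t) = `|t' - t| * (2 * tau).
Proof.
move=> t0; have -> : lam tau k t' - lam tau k t =
    (t' - t)%:C%C * (cor 0 tau k.+1 - cor 0 tau k) by rewrite /lam rmorphB; ring.
rewrite nmM nmR.
by rewrite nm_cor_side// ltW.
Qed.

(* Where the bound [B y^n] is not yet uniform, a boundary set of small measure, the bound [A x^n]
   is beaten by a power of the multiplier, which is at most 1/2 there, at most 1 on the square and
   nearly 1 inside. *)
Lemma hartogs_coef (a : nat -> C -> C) (rho x y A : R) : 0 < rho -> 0 <= x -> 0 < y -> 0 <= A ->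
  (forall n l, nm l <= rho -> cdiff (a n) l) ->
  (forall n l, nm l <= rho -> nm (a n l) <= A * x ^+ n) ->
  (forall l, nm l <= rho -> exists B, forall n, nm (a n l) <= B * y ^+ n) ->
  exists2 B : R, 0 <= B & forall n l, nm l <= rho / 4 -> nm (a n l) <= B * (2 * y) ^+ n.
Proof.
move=> rho0 x0 y0 A0 da hA hB.
pose tau := rho / 2; have t0 : 0 < tau by rewrite divr_gt0.
have lamd k (t : R) : 0 <= t <= 1 -> nm (lam tau k t) <= rho.
  by move=> t01; have := sqin_nm (sqin_lam t0 k t01); rewrite /tau; lra.
(* Summing over the four sides yields one exceptional set of parameters that serves all of them. *)
pose phi n (t : R) := \sum_(k < 4) nm (a n (lam tau k t)).
have phi_ge n (t : R) k : (k < 4)%N -> nm (a n (lam tau k t)) <= phi n t.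
  move=> k4; rewrite /phi (bigD1 (Ordinal k4))//= lerDl.
  by apply: sumr_ge0 => j _; exact: nm_ge0.
have phi_cont n (t e : R) : 0 <= t <= 1 -> 0 < e -> exists2 d : R, 0 < d &
    forall t' : R, `|t' - t| < d -> 0 <= t' <= 1 -> `|phi n t' - phi n t| <= e.
  move=> t01 e0.
  have H k : exists d : R, 0 < d /\ forall t' : R, `|t' - t| < d ->
      nm (a n (lam tau k t') - a n (lam tau k t)) <= e / 4.
    have [d d0 hd] := cdiff_cont (da n _ (lamd k t t01)) (divr_gt0 e0 (ltr0n R 4)).
    exists (d / (2 * tau)); split; first by rewrite divr_gt0// mulr_gt0.
    by move=> t'; rewrite ltr_pdivlMr ?mulr_gt0// => tt'; apply: hd; rewrite lam_lip.
  have [f hf] := choice H.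
  pose d := \big[Num.min/1]_(k < 4) f k; exists d.
    by rewrite /d; apply: lt_bigmin => // k _; have [] := hf k.
  move=> t' tt' _; rewrite /phi -sumrB.
  apply: (le_trans (ler_norm_sum _ _ _)).
  have -> : e = \sum_(k < 4) e / 4 by rewrite !big_ord_recr big_ord0 /=; lra.
  apply: ler_sum => k _; have [_ hk] := hf k.
  have : `|t' - t| < f k by apply: (lt_le_trans tt'); exact: bigmin_le_cond.
  move=> /hk; apply: le_trans; rewrite ler_norml.
  have := nm_tri (a n (lam tau k t)) (a n (lam tau k t')) 0.
  have := nm_tri (a n (lam tau k t')) (a n (lam tau k t)) 0.
  rewrite !subr0 (nmBC (a n (lam tau k t))); lra.
(* The power [p * n] of the multiplier gains [2 ^ - (p * n)] on the exceptional set, enough to bring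
   [x ^ n] below [y ^ n]. *)
have [p hp] : exists p, x <= 2 ^+ p * y.
  have [p] := @geom_small R (x / y) 2^-1 1 ltac:(by rewrite invr_ge0) ltac:(by rewrite invf_lt1// ltr1n) ltr01.
  rewrite exprVn ltr_pdivrMr ?exprn_gt0// mul1r ltr_pdivrMr// => h; exists p.
  exact: ltW.
pose d : R := (2 ^+ p)^-1.
have p2 : 0 < (2 : R) ^+ p by rewrite exprn_gt0.
have d0 : 0 < d by rewrite invr_gt0.
have d1 : d <= 1 by rewrite invf_le1// exprn_ege1// ler1n.
(* Chosen so that inside the disc the same power costs at most [2 ^ n]: the chord bound gives
   [(1 + 2 ^ - p) ^ p <= 2]. *)
pose eta := d / 32; have eta0 : 0 < eta by rewrite divr_gt0.
have eta2 : (1 + 32 * eta) ^+ p <= 2.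
  have -> : 32 * eta = d by rewrite /eta; lra.
  have d01 : 0 <= d <= 1 by rewrite ltW.
  apply: (le_trans (expr_1plus_le p d01)).
  by rewrite mulrBl mul1r /d divff ?gt_eqF//; move: d0; rewrite /d; lra.
pose E (N : nat) : set R := [set t | forall n, phi n t <= N%:R * y ^+ n].
have [N0 hN0] : exists N0, forall N, (N0 <= N)%N -> forall G : R -> Prop,
  (forall x : R, 0 <= x <= 1 -> 
    (exists2 d : R, 0 < d & forall y : R, `|y - x| < d -> 0 <= y <= 1 -> G y) \/
    (exists2 d : R, 0 < d & forall y : R, `|y - x| < d -> 0 <= y <= 1 -> ~ E N y)) ->
  exists L : seq (R * R), [/\ forall e, e \in L -> e.1 < e.2,
    \sum_(e <- L) (e.2 - e.1) <= eta &
    forall x : R, 0 <= x <= 1 -> G x \/ exists2 e, e \in L & e.1 <= x <= e.2].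
  apply: exhaustion_cover => //.
  - move=> N t t01 /existsNP[n /negP]; rewrite -ltNge => hn.
    have e0 : 0 < (phi n t - N%:R * y ^+ n) / 2 by rewrite divr_gt0// subr_gt0.
    have [d' d'0 hd'] := phi_cont n t _ t01 e0; exists d' => // t' tt' t'01 /(_ n) ht'.
    by have := hd' _ tt' t'01; rewrite ler_norml; lra.
  - move=> N M NM t ht n; apply: (le_trans (ht n)).
    by rewrite ler_wpM2r ?exprn_ge0 ?ler_nat// ltW.
  - move=> t t01.
    have [f hf] := choice (fun k => hB _ (lamd k t t01)).
    have [N hN] := ex_natr_ge (\sum_(k < 4) f k); exists N => n.
    apply: (@le_trans _ _ (\sum_(k < 4) f k * y ^+ n)); first exact: ler_sum.
    by rewrite -mulr_suml ler_wpM2r// exprn_ge0// ltW.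
(* A positive [N] makes the tolerance [N * y ^ n / 4] below positive. *)
pose N := maxn N0 1; have {}hN0 := hN0 N (leq_maxl _ _).
have N1 : 1 <= N%:R :> R by rewrite ler1n leq_maxr.
exists (A + 2 * N%:R); first by lra.
move=> n l hl.
have yn : 0 < y ^+ n by rewrite exprn_gt0.
have Ny : 0 < N%:R * y ^+ n by rewrite mulr_gt0//; lra.
have [t t01|L [L1 L2 L3]] := hN0 (fun t => phi n t <= 2 * (N%:R * y ^+ n)).
  have e0 : 0 < N%:R * y ^+ n / 4 by rewrite divr_gt0.
  have [d' d'0 hd'] := phi_cont n t _ t01 e0.
  (* The threshold 3/2 leaves a margin on both sides, so by continuity [G] persists nearby in one
     case and the failure of [E N] in the other. *)
  have [ht|ht] := lerP (phi n t) (3 / 2 * (N%:R * y ^+ n)); [left|right]; exists d' => // t' tt' t'01.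
    by have := hd' _ tt' t'01; rewrite ler_norml; lra.
  by move=> /(_ n); have := hd' _ tt' t'01; rewrite ler_norml; lra.
pose g := multiplier tau L.
have key : nm (a n l * g l ^+ (p * n)) <= (A + 2 * N%:R) * y ^+ n.
  apply: (@max_square _ (fun w => a n w * g w ^+ (p * n)) (sqin tau) 0 tau).
  - exact: t0.
  - exact: sqin_dom.
  - by rewrite mulr_ge0 ?ltW//; lra.
  - move=> w sw; apply: cdiffM.
      by apply: da; have := sqin_nm sw; rewrite /tau; lra.
    by apply: cdiffX; exact: (multiplier_diff t0 L1).
  - move=> k w k4 [t t01 ->]; rewrite -/(lam tau k t).
    have sl := sqin_lam t0 k t01.
    have g1 := multiplier_le1 t0 L1 sl.
    rewrite nmM nmX; have [ht|bt] := L3 t t01.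
      apply: (@le_trans _ _ (2 * (N%:R * y ^+ n) * 1)).
        apply: ler_pM; rewrite ?nm_ge0 ?exprn_ge0 ?nm_ge0//.
          by apply: le_trans ht; exact: phi_ge.
        by rewrite exprn_ile1 ?nm_ge0.
      by have := mulr_ge0 A0 (ltW yn); lra.
    have g2 := multiplier_bad t0 L1 k4 t01 bt.
    apply: (@le_trans _ _ (A * x ^+ n * 2^-1 ^+ (p * n))).
      apply: ler_pM; rewrite ?nm_ge0 ?exprn_ge0 ?nm_ge0//; first exact/hA/lamd.
      by apply: lerXn2r; rewrite ?nnegrE ?nm_ge0// invr_ge0.
    have -> : A * x ^+ n * 2^-1 ^+ (p * n) = A * (x * 2^-1 ^+ p) ^+ n by rewrite exprM exprMn mulrA.
    rewrite mulrDl.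
    have : A * (x * 2^-1 ^+ p) ^+ n <= A * y ^+ n.
      rewrite ler_wpM2l//; apply: lerXn2r; rewrite ?nnegrE ?mulr_ge0 ?exprn_ge0 ?invr_ge0 ?(ltW y0)//.
      by rewrite exprVn ler_pdivrMr// mulrC.
    move: (A * _) (A * _) => u v uv; apply: (le_trans uv); rewrite lerDl -mulrA; lra.
  - by rewrite subr0 /tau; lra.
have hl' : nm l <= tau / 2 by rewrite /tau; lra.
have g1 := multiplier_in t0 L1 L2 hl'; rewrite -/(g l) in g1.
(* Removing the multiplier costs [2 ^ n], which is why the conclusion has [2 * y] in place of
   [y]. *)
have g2 : 1 <= 2 ^+ n * nm (g l) ^+ (p * n).
  apply: (@le_trans _ _ (((1 + 32 * eta) * nm (g l)) ^+ (p * n))); first exact: exprn_ege1.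
  rewrite exprMn ler_wpM2r ?exprn_ge0 ?nm_ge0// exprM.
  by apply: lerXn2r; rewrite ?nnegrE ?exprn_ge0//; lra.
rewrite exprMn; apply: (@le_trans _ _ (nm (a n l) * (2 ^+ n * nm (g l) ^+ (p * n)))).
  by rewrite ler_peMr// nm_ge0.
rewrite [leLHS]mulrCA [leRHS]mulrCA; apply: ler_wpM2l; [exact: exprn_ge0|by rewrite -nmX -nmM].
Qed.

End HartogsTheorem.

(** * Baire's theorem, Taylor coefficients and Hartogs' theorem *)

Section Hartogs.
Variable R : realType.
Local Notation C := R[i].
Implicit Types (z w l : C).

Lemma clim_cont (h : C -> C) u z : ccont h z -> clim u z -> clim (fun n => h (u n)) (h z).
Proof.
move=> hc uz e /hc[d d0 hd]; have [N hN] := uz _ (divr_gt0 d0 (ltr0n R 2)).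
by exists N => n /hN hn; apply: hd; apply: (le_lt_trans hn); rewrite ltr_pdivrMr//; lra.
Qed.

Lemma climclosed_away (E : set C) z : climclosed E -> ~ E z ->
  exists2 d : R, 0 < d & forall w, nm (w - z) <= d -> ~ E w.
Proof.
move=> cE nEz; apply: contrapT => H; apply: nEz.
have /choice[u hu] : forall n, exists w, nm (w - z) <= 2^-1 ^+ n /\ E w.
  move=> n; apply: contrapT => nw; apply: H; exists (2^-1 ^+ n).
    by rewrite exprn_gt0// invr_gt0.
  by move=> w wz Ew; apply: nw; exists w.
apply: (cE u) => [n|e e0]; first by have [] := hu n.
have [N] := @geom_small R 1 2^-1 e ltac:(by rewrite invr_ge0) ltac:(by rewrite invf_lt1// ltr1n) e0.
rewrite mul1r => hN; exists N => n Nn; have [h _] := hu n; apply: (le_trans h).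
by apply: le_trans (ltW hN); apply: ler_wiXn2l => //; rewrite ?invr_ge0 ?invf_le1 ?ler1n.
Qed.

(** If no [E n] contained a ball centred in the disc, balls avoiding [E 0], [E 1], ... in turn could
    be nested with radii at least halved each time; their centres converge to a point of the disc
    outside every [E n]. *)
Lemma baire_disc (E : nat -> set C) o (r : R) : 0 < r -> (forall n, climclosed (E n)) ->
  (forall z, nm (z - o) <= r -> exists n, E n z) ->
  exists n z (d : R), [/\ 0 < d, nm (z - o) <= r & forall w, nm (w - z) <= d -> E n w].
Proof.
move=> r0 cE uE; apply: contrapT => H.
have step (b : nat * (C * R)) : exists b' : C * R, 0 < b.2.2 -> nm (b.2.1 - o) <= r ->
   [/\ 0 < b'.2, b'.2 <= b.2.2 / 2, nm (b'.1 - o) <= r & forall w, nm (w - b'.1) <= b'.2 ->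
   nm (w - b.2.1) <= b.2.2 /\ ~ E b.1 w].
  case: b => n [z d] /=.
  have [d0|nd0] := pselect (0 < d); last by exists (z, d).
  have [hz|nhz] := pselect (nm (z - o) <= r); last by exists (z, d).
  (* move slightly towards the centre so that the new ball stays in the disc *)
  have [w [wz wo nEw]] : exists w, [/\ nm (w - z) <= d / 2, nm (w - o) <= r & ~ E n w].
    apply: contrapT => nw; apply: H.
    pose t := Num.min 1 (d / (4 * r)).
    have t0 : 0 < t by rewrite lt_min ltr01 divr_gt0// mulr_gt0.
    have t1 : t <= 1 by rewrite ge_min lexx.
    have tr : t * r <= d / 4.
      have : t <= d / (4 * r) by rewrite ge_min lexx orbT.
      by rewrite invfM mulrA ler_pdivlMr.
    have e0 : nm (z - t%:C%C * (z - o) - o) <= (1 - t) * r.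
      have -> : z - t%:C%C * (z - o) - o = (1 - t)%:C%C * (z - o) by rewrite rmorphB rmorph1; ring.
      by rewrite nmM nmR ger0_norm ?subr_ge0// ler_wpM2l ?subr_ge0.
    have e1 : nm (z - t%:C%C * (z - o) - z) <= d / 4.
      have -> : z - t%:C%C * (z - o) - z = - (t%:C%C * (z - o)) by ring.
      rewrite nmN nmM nmR ger0_norm; last exact: ltW.
      by apply: le_trans tr; apply: ler_wpM2l => //; exact: ltW.
    have tr0 : 0 < t * r by rewrite mulr_gt0.
    exists n, (z - t%:C%C * (z - o)), (t * r); split => //.
      by apply: (le_trans e0); nra.
    move=> w hw; apply: contrapT => nE; apply: nw; exists w; split => //.
      by have := nm_tri (z - t%:C%C * (z - o)) w z; lra.
    by have := nm_tri (z - t%:C%C * (z - o)) w o; lra.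
  have [d' d'0 hd'] := climclosed_away (cE n) nEw.
  exists (w, Num.min d' (d / 2)) => _ _; split => /=.
  - by rewrite lt_min d'0 divr_gt0.
  - by rewrite ge_min lexx orbT.
  - exact: wo.
  - move=> w'; rewrite le_min => /andP[w'1 w'2]; split; last exact: hd'.
    by have := nm_tri w w' z; lra.
have [f hf] := choice step.
pose s := fix s n := if n is m.+1 then f (m, s m) else (o, r).
have sP n : 0 < (s n).2 /\ nm ((s n).1 - o) <= r.
  elim: n => [|n [h1 h2]] /=; first by rewrite subrr nm0 ltW.
  by have [] := hf (n, s n) h1 h2.
have sS n := hf (n, s n) (sP n).1 (sP n).2.
have dS n : (s n).2 <= r * 2^-1 ^+ n.
  elim: n => [|n IH]; first by rewrite expr0 mulr1.
  have [_ h _ _] := sS n; apply: (le_trans h); rewrite /= exprSr mulrA; lra.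
have nest n m w : nm (w - (s (n + m)%N).1) <= (s (n + m)%N).2 -> nm (w - (s n).1) <= (s n).2.
  elim: m w => [|m IH] w; first by rewrite addn0.
  by rewrite addnS => hw; have [_ _ _ /(_ w hw)[/IH]] := sS (n + m)%N.
have [n|z zl hz] := @geometric_cauchy _ (fun n => (s n).1) r.
  have [d0 _ _ /(_ (s n.+1).1)[|h _]] := sS n; first by rewrite subrr nm0 ltW.
  exact: le_trans h (dS n).
have zin n : nm (z - (s n).1) <= (s n).2.
  apply: (@climclosed_nm _ (s n).2 (s n).1 (fun m => (s (n + m)%N).1)).
    by move=> m; apply: (@nest n m); rewrite subrr nm0 ltW//; have [] := sP (n + m)%N.
  by move=> e /zl[N hN]; exists N => m Nm; apply: hN; exact: leq_trans Nm (leq_addl _ _).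
have [n En] : exists n, E n z by apply: uE; have := zin 0%N.
by have [_ _ _ /(_ z (zin n.+1))[_]] := sS n.
Qed.

Lemma sqI_in h o (s : R) z (s1 M : R) : 0 < s -> 0 <= M -> s1 <= s - nm (z - o) ->
  (forall k w, (k < 4)%N -> side o s k w -> s1 <= nm (w - z) -> nm (h w) <= M) ->
  nm (sqI h o s) <= 8 * s * M.
Proof.
move=> s0 M0 zs hM; apply: (sqI_bound (E := fun k => side o s k `&` outer z s1 k)) => //.
  exact: ltW.
move=> k k4; have [a1 a2] := @outer_cor _ o z s s1 k zs.
have [mo _] := outer_cconv z s1 k; split.
- by move=> p q [? ?] [? ?]; split; [exact: sg_mid|exact: mo].
- by split => //; exact: sg_l.
- by split => //; exact: sg_r.
- by move=> w [sw /outer_nm ow]; exact: hM sw ow.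
Qed.

Lemma disc_outer_cconv o (r s : R) z k :
  cconv ([set w | nm (w - o) <= r] `&` outer z s k).
Proof. by apply: cconvI; [exact: cconv_disc|exact: outer_cconv]. Qed.

Lemma cor_disc_outer o (s s1 : R) z k : 0 < s -> s1 <= s - nm (z - o) ->
  ([set w | nm (w - o) <= 2 * s] `&` outer z s1 k) (cor o s k) /\
  ([set w | nm (w - o) <= 2 * s] `&` outer z s1 k) (cor o s k.+1).
Proof.
move=> s0 zs; have [a1 a2] := @outer_cor _ o z s s1 k zs.
by split; split => //; exact: (nm_cor _ _ (ltW s0)).
Qed.

Lemma invX_bound (s : R) w z n : 0 < s -> s <= nm (w - z) -> nm (((w - z)^-1) ^+ n) <= s^-1 ^+ n.
Proof.
move=> s0 sw; rewrite nmX nmV; apply: lerXn2r; rewrite ?nnegrE ?invr_ge0 ?nm_ge0 ?(ltW s0)//.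
by rewrite lef_pV2 ?posrE//; exact: lt_le_trans sw.
Qed.

Lemma cdiff_invX z n w : w != z -> cdiff (fun w => ((w - z)^-1) ^+ n) w.
Proof. by move=> wz; apply: cdiffX; exact: cdiff_subV. Qed.

Lemma neq_of_dist (s : R) w z : 0 < s -> s <= nm (w - z) -> w != z.
Proof. by move=> s0 sw; rewrite -subr_eq0 -nm_gt0; exact: lt_le_trans sw. Qed.

(** For holomorphic [G] this is [kappa] times the [n]-th Taylor coefficient at [z]. *)
Definition coef (G : C -> C) z (s : R) n : C := sqI (fun w => G w * ((w - z)^-1) ^+ n.+1) z s.

Lemma coef_bound G z (s M : R) n : 0 < s -> 0 <= M ->
  (forall k w, (k < 4)%N -> side z s k w -> nm (G w) <= M) ->
  nm (coef G z s n) <= 8 * M * s^-1 ^+ n.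
Proof.
move=> s0 M0 hM; have -> : 8 * M * s^-1 ^+ n = 8 * s * (M * s^-1 ^+ n.+1).
  by rewrite exprS; field; rewrite gt_eqF.
apply: (@sqI_in _ z s z s) => //.
- by rewrite mulr_ge0// exprn_ge0// invr_ge0 ltW.
- by rewrite subrr nm0 subr0.
- move=> k w k4 sw ow; rewrite nmM; apply: ler_pM; rewrite ?nm_ge0//; first exact: hM sw.
  exact: invX_bound.
Qed.

(** Allows two radii for the same coefficient: a small one, where the bound is uniform in [l], and a
    large one, where the decay in [n] is better but the bound depends on [l]. *)
Lemma coef_radius G z (s s' : R) n : 0 < s -> s <= s' ->
  (forall w, nm (w - z) <= 2 * s' -> cdiff G w) -> coef G z s n = coef G z s' n.
Proof.
move=> s0 ss' dG; symmetry.
apply: (annulus (E := fun k => [set w | nm (w - z) <= 2 * s'] `&` outer z s k)) => k _; split.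
- exact: disc_outer_cconv.
- move=> w [/dG dw /outer_nm ow]; apply: cdiffM => //; apply: cdiff_invX.
  exact: neq_of_dist ow.
- have s'0 : 0 < s' by exact: lt_le_trans ss'.
  have [a1 a2] := @cor_disc_outer z s' s z k s'0 ltac:(by rewrite subrr nm0 subr0).
  have [[a3 a4] [a5 a6]] := @cor_disc_outer z s s z k s0 ltac:(by rewrite subrr nm0 subr0).
  split => //; split => //=; [apply: (le_trans a3)|apply: (le_trans a5)]; lra.
Qed.

(** The Cauchy kernel is expanded [N] times. With [nm (x - z) <= s / 4] the terms are at most
    [B * 2 ^ - n], and the remainder tends to 0 because [(x - z) / (w - z)] has modulus at most 1/2
    on the square. *)
Lemma taylor_bound G z (s B : R) x : 0 < s -> 0 <= B ->
  (forall w, nm (w - z) <= 2 * s -> cdiff G w) -> nm (x - z) <= s / 4 ->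
  (forall n, nm (coef G z s n) <= B * (2 * s^-1) ^+ n) ->
  nm (kappa * G x) <= 2 * B.
Proof.
move=> s0 B0 dG xz hB.
have [M M0 hM] := sides_bounded (ltW s0) (lexx _) (fun w hw => cdiff_cont (dG w hw)).
pose T N : C := sqI (fun w => G w * ((x - z) * (w - z)^-1) ^+ N * (w - x)^-1) z s.
have xs : nm (x - z) < s by lra.
have T0 : T 0%N = kappa * G x.
  rewrite -(cauchy_formula s0 (sqdom_disc z s0 (lexx _)) dG xs) /T.
  by congr (sqI _ _ _); apply/funext => w; rewrite expr0 mulr1.
have cor2 k : let E := [set w | nm (w - z) <= 2 * s] `&` outer z (s / 2) k `&` outer x (s / 2) k in
    [/\ cconv E, E (cor z s k) & E (cor z s k.+1)].
  have [[a1 a2] [a3 a4]] := @cor_disc_outer z s (s/2) z k s0 ltac:(rewrite subrr nm0; lra).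
  have [[_ b2] [_ b4]] := @cor_disc_outer z s (s/2) x k s0 ltac:(lra).
  by split; [apply: cconvI; [exact: disc_outer_cconv|exact: outer_cconv]|by split..].
have s2 : 0 < s / 2 by rewrite divr_gt0.
(* One step of the expansion: [1 / (w - x) = 1 / (w - z) + (x - z) / ((w - z) * (w - x))]. *)
have TS N : T N = coef G z s N * (x - z) ^+ N + T N.+1.
  rewrite /T /coef /sqI mulr_suml -big_split /=; apply: eq_bigr => k _.
  have [cE e1 e2] := cor2 k; have [mE _] := cE.
  set E := (X in cconv X) in cE mE e1 e2.
  have ne w : E w -> w != z /\ w != x.
    by move=> [[_ /outer_nm h1] /outer_nm h2]; split; [exact: neq_of_dist h1|exact: neq_of_dist h2].
  have dE w : E w -> cdiff G w by move=> [[/dG]].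
  rewrite mulrC -JZ; last first.
    apply: (intg_diff cE) => // w Ew; have [n1 n2] := ne _ Ew.
    by apply: cdiffM; [exact: dE|exact: cdiff_invX].
  rewrite -JD; first last.
  - apply: (intg_diff cE) => // w Ew; have [n1 n2] := ne _ Ew.
    apply: cdiffM; last exact: cdiff_subV.
    apply: cdiffM; first exact: dE.
    by apply: cdiffX; apply: cdiffM; [exact: cdiff_cst|exact: cdiff_subV].
  - apply: intgZ; apply: (intg_diff cE) => // w Ew; have [n1 n2] := ne _ Ew.
    by apply: cdiffM; [exact: dE|exact: cdiff_invX].
  apply: (J_ext mE) => // w Ew; have [n1 n2] := ne _ Ew.
  rewrite !exprMn !exprS.
  set X := (x - z) ^+ N; set Y := (w - z)^-1 ^+ N.
  by field; rewrite !subr_eq0 n1 n2.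
have Tsum N : kappa * G x = \sum_(n < N) coef G z s n * (x - z) ^+ n + T N.
  elim: N => [|N IH]; first by rewrite big_ord0 add0r T0.
  by rewrite big_ord_recr /= IH TS addrA.
have Sb N : nm (\sum_(n < N) coef G z s n * (x - z) ^+ n) <= 2 * B.
  apply: (@le_trans _ _ (2 * B - 2 * B * 2^-1 ^+ N)); last first.
    by rewrite lerBlDr lerDl !mulr_ge0// exprn_ge0// invr_ge0.
  elim: N => [|N IH]; first by rewrite big_ord0 nm0 expr0 mulr1 subrr.
  rewrite big_ord_recr /=; apply: (le_trans (nmD _ _)).
  have : nm (coef G z s N * (x - z) ^+ N) <= B * 2^-1 ^+ N.
    rewrite nmM nmX; apply: (@le_trans _ _ (B * (2 * s^-1) ^+ N * (s / 4) ^+ N)).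
      apply: ler_pM; rewrite ?nm_ge0 ?exprn_ge0 ?nm_ge0//.
      by apply: lerXn2r; rewrite ?nnegrE ?nm_ge0 ?divr_ge0 ?(ltW s0).
    rewrite -mulrA -exprMn (_ : 2 * s^-1 * (s / 4) = 2^-1)//.
    by field; rewrite gt_eqF.
  by rewrite exprS; move: IH; set t := 2^-1 ^+ N; lra.
have Tb N : nm (T N) <= 16 * M * 2^-1 ^+ N.
  have -> : 16 * M * 2^-1 ^+ N = 8 * s * (M * 2^-1 ^+ N * (s / 2)^-1).
    by field; rewrite gt_eqF.
  apply: (@sqI_in _ z s x (s / 2)) => //.
  - by rewrite !mulr_ge0 ?exprn_ge0 ?invr_ge0 ?divr_ge0 ?(ltW s0).
  - lra.
  - move=> k w k4 sw ow; have wz : s / 2 <= nm (w - z).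
      have [a1 a2] := @outer_cor _ z z s s k ltac:(by rewrite subrr nm0 subr0).
      have [mo _] := outer_cconv z s k.
      have : outer z s k w.
        move: sw => [t t01 ->]; move: a1 a2; rewrite /outer/= => h1 h2.
        rewrite mulrDr mulrCA ReD ReRM mulrBr ReB; nra.
      by move=> /outer_nm; apply: le_trans; lra.
    rewrite !nmM nmX nmM; apply: ler_pM; rewrite ?mulr_ge0 ?exprn_ge0 ?mulr_ge0 ?nm_ge0//.
      apply: ler_pM; rewrite ?exprn_ge0 ?mulr_ge0 ?nm_ge0//; first exact: hM sw.
      apply: lerXn2r; rewrite ?nnegrE ?mulr_ge0 ?nm_ge0 ?invr_ge0//.
      rewrite nmV ler_pdivrMr; last exact: lt_le_trans wz.
      lra.
    by rewrite nmV lef_pV2 ?posrE//; exact: lt_le_trans ow.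
apply/ler_addgt0Pl => e e0.
have [N] := @geom_small R (16 * M) 2^-1 e ltac:(by rewrite invr_ge0) ltac:(by rewrite invf_lt1// ltr1n) e0.
move=> hN; rewrite (Tsum N); apply: (le_trans (nmD _ _)).
by rewrite addrC lerD//; apply: le_trans (Tb N) (ltW hN).
Qed.

Lemma side0_nm (s : R) k w : 0 < s -> side 0 s k w -> nm w <= 2 * s.
Proof. by move=> s0 [t t01 ->]; apply: sqin_nm; exact: sqin_lam. Qed.

(* Baire gives boundedness on a thin bidisc (Osgood); the Taylor coefficients there are controlled
   by [hartogs_coef]. *)
Theorem hartogs (F : C -> C -> C) (r : R) : 0 < r ->
  (forall l z, nm l <= r -> nm z <= r -> cdiff (F ^~ z) l /\ cdiff (F l) z) ->
  exists2 d : R, 0 < d & exists2 M : R, 0 <= M &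
    forall l z, nm l <= d -> nm z <= d -> nm (F l z) <= M.
Proof.
move=> r0 dF.
(* The bound is asked on the sides of a square only: this makes [E N] closed by continuity in [z]
   alone, and the maximum principle in [l] extends it to the interior in [FN]. *)
pose E N : set C := [set z | nm (z - 0) <= r /\
  forall k l, (k < 4)%N -> side 0 (r / 2) k l -> nm (F l z - 0) <= N%:R].
have r2 : 0 < r / 2 by rewrite divr_gt0.
have sr k l : side 0 (r / 2) k l -> nm l <= r by move=> /(side0_nm r2); lra.
have r32 : 0 < r / 32 by rewrite divr_gt0.
have cE N : climclosed (E N).
  move=> u z hu uz; have zr : nm (z - 0) <= r.
    by apply: (climclosed_nm _ uz) => n; have [] := hu n.
  split => // k l k4 sl; apply: (@climclosed_nm _ N%:R 0 (fun n => F l (u n))).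
    by move=> n; have [_ h] := hu n; exact: h sl.
  rewrite subr0 in zr; apply: clim_cont uz; apply: cdiff_cont.
  by have [] := dF l z (sr _ _ sl) zr.
have uE z : nm (z - 0) <= r / 32 -> exists N, E N z.
  move=> hz; have zr : nm z <= r by move: hz; rewrite subr0; lra.
  have Fc w : nm (w - 0) <= r -> ccont (F ^~ z) w.
    by rewrite subr0 => wr; apply: cdiff_cont; have [] := dF w z wr zr.
  have [M M0 hM] := @sides_bounded _ 0 (r / 2) r (F ^~ z) (ltW r2) ltac:(lra) Fc.
  have [N hN] := ex_natr_ge M; exists N; split; first by rewrite subr0.
  by move=> k l k4 sl; rewrite subr0; apply: le_trans hN; exact: hM sl.
(* Baire gives no control on where [z1] lies; searching in the disc of radius [r / 32] ensures that
   expansions about [z1] of radius proportional to [r] still reach a neighbourhood of 0. *)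
have [N [z1 [d [d0 hz1 hd]]]] := baire_disc r32 cE uE.
rewrite subr0 in hz1.
have FN l w : nm l <= r / 4 -> nm (w - z1) <= d -> nm (F l w) <= N%:R.
  move=> hl /hd[wr hw]; rewrite subr0 in wr.
  apply: (@max_square _ (F ^~ w) [set w | nm (w - 0) <= r] 0 (r / 2)) => //.
  - by apply: sqdom_disc => //; lra.
  - by move=> l'; rewrite /= subr0 => l'r; have [] := dF l' w l'r wr.
  - by move=> k l' k4 sl; have := hw k l' k4 sl; rewrite subr0.
  - by rewrite subr0; lra.
pose s := Num.min (d / 2) (r / 4).
have s0 : 0 < s by rewrite lt_min !divr_gt0.
have sd : s <= d / 2 by rewrite ge_min lexx.
have sr4 : s <= r / 4 by rewrite ge_min lexx orbT.
have dFl l w : nm l <= r -> nm (w - z1) <= 2 * (r / 4) -> cdiff (F l) w.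
  move=> lr hw; have [] // := dF l w lr; have := nm_tri z1 w 0; rewrite !subr0; lra.
have side_d k w : (k < 4)%N -> side z1 s k w -> nm (w - z1) <= d.
  move=> k4 [t t01 ->]; have [e1 e2] := (@nm_cor _ z1 s k (ltW s0), @nm_cor _ z1 s k.+1 (ltW s0)).
  set x := cor z1 s k in e1 *; set y := cor z1 s k.+1 in e2 *.
  have -> : x + t%:C%C * (y - x) - z1 = (1 - t)%:C%C * (x - z1) + t%:C%C * (y - z1) :> C.
    by rewrite rmorphB rmorph1; ring.
  apply: (le_trans (nmD _ _)); rewrite !nmM !nmR !ger0_norm; [|lra..].
  by have := nm_ge0 (x - z1); have := nm_ge0 (y - z1); nra.
have r4 : 0 < r / 4 by rewrite divr_gt0.
(* Here [x] is the inverse of the small radius [s], where [F] is uniformly bounded, and [y] the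
   inverse of [r / 4], valid for each single [l]. The resulting [2 * y] is the growth that
   [taylor_bound] admits at distance [r / 16] from [z1]. *)
have [||||n l hl|n l hl|l hl|B B0 hB] := @hartogs_coef _ (fun n l => coef (F l) z1 s n) (r / 32)
    s^-1 (r / 4)^-1 (8 * N%:R).
- exact: r32.
- by rewrite invr_ge0 ltW.
- by rewrite invr_gt0.
- by rewrite mulr_ge0.
- apply: cdiff_sum => k _.
  have [mo co] := outer_cconv z1 s k.
  have [[a1 a2] [a3 a4]] := @cor_disc_outer z1 s s z1 k s0 ltac:(by rewrite subrr nm0 subr0).
  apply: (@param_integral _ _ (side z1 s k `&` outer z1 s k) _ _ (r / 4) (N%:R * s^-1 ^+ n.+1)) => //.
  + by move=> p q [? ?] [? ?]; split; [exact: sg_mid|exact: mo].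
  + by split => //; exact: sg_l.
  + by split => //; exact: sg_r.
  + by rewrite mulr_ge0// exprn_ge0// invr_ge0 ltW.
  + move=> l' w hl' [sw /outer_nm ow]; have wd := side_d _ _ (ltn_ord k) sw.
    split.
      apply: cdiffM; last exact: cdiff_cst.
      have wr : nm w <= r by have [+ _] := hd _ wd; rewrite subr0.
      by have [] // := dF l' w _ wr; lra.
    rewrite nmM; apply: ler_pM; rewrite ?nm_ge0//; [exact: FN|exact: invX_bound].
  + move=> l' hl'; apply: (intg_diff (@disc_outer_cconv z1 (2 * s) s z1 k)) => // w [wz /outer_nm ow].
    apply: cdiffM; last by apply: cdiff_invX; exact: neq_of_dist ow.
    by apply: dFl; [lra|move: wz => /=; lra].
  + by lra.
- apply: coef_bound => // k w k4 sw; apply: FN; first by lra.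
  exact: side_d sw.
- have lr : nm l <= r by lra.
  have [M M0 hM] := @sides_bounded _ z1 (r / 4) (2 * (r / 4)) (F l) (ltW r4) (lexx _)
     (fun w hw => cdiff_cont (dFl l w lr hw)).
  exists (8 * M) => n; rewrite (@coef_radius _ _ _ (r / 4))//; last by move=> w; exact: dFl.
  exact: coef_bound.
exists (r / 128); first by rewrite divr_gt0.
exists (2 * B / nm (kappa : C)); first by rewrite divr_ge0 ?nm_ge0// mulr_ge0.
move=> l z hl hz; rewrite ler_pdivlMr ?nm_kappa_gt0// mulrC -nmM.
have lr : nm l <= r by lra.
apply: (@taylor_bound (F l) z1 (r / 4) B z) => //.
- by move=> w; exact: dFl.
- by have := nmB z z1; lra.
- move=> n; rewrite -(@coef_radius _ _ s)//; last by move=> w; exact: dFl.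
  by apply: hB; lra.
Qed.

End Hartogs.

(** * Grid cycles around compact sets *)

Section Grid.
Variable R : realType.
Local Notation C := R[i].
Implicit Types (z w : C) (j k : int) (q : int * int) (S : seq (int * int)).

Definition mesh n : R := 2^-1 ^+ n.
Lemma mesh_gt0 n : 0 < mesh n. Proof. by rewrite exprn_gt0// invr_gt0. Qed.
Lemma meshS n : mesh n = 2 * mesh n.+1.
Proof. by rewrite /mesh exprS mulrA divff ?mul1r// pnatr_eq0. Qed.

Definition vx n j k : C := ((mesh n * j%:~R) +i* (mesh n * k%:~R))%C.

Definition cell n q : set C := [set z |
  mesh n * q.1%:~R <= Re z <= mesh n * (q.1 + 1)%:~R /\
  mesh n * q.2%:~R <= Im z <= mesh n * (q.2 + 1)%:~R].

Lemma cell_cconv n q : cconv (cell n q).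
Proof.
pose B := [set z : C | mesh n * q.1%:~R <= Re (1 * z)] `&` [set z | - (mesh n * (q.1 + 1)%:~R) <= Re ((-1) * z)]
  `&` [set z : C | mesh n * q.2%:~R <= Re ((- 'i%C) * z)] `&` [set z | - (mesh n * (q.2 + 1)%:~R) <= Re ('i%C * z)].
suff -> : cell n q = B by apply: cconvI; [apply: cconvI; [apply: cconvI|]|]; exact: cconv_half.
have e1 z : Re (1 * z) = Re z by rewrite mul1r.
have e2 z : Re ((-1) * z) = - Re z by case: z => a b /=; ring.
have e3 z : Re ((- 'i%C) * z) = Im z by case: z => a b /=; ring.
have e4 z : Re ('i%C * z) = - Im z by case: z => a b /=; ring.
apply/seteqP; split => z; rewrite /B /cell/= e1 e2 e3 e4 !lerN2.
  by move=> [/andP[-> ->] /andP[-> ->]].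
by move=> [[[-> ->] ->] ->].
Qed.

Definition eH n (G : C -> C) j k : C := J G (vx n j k) (vx n (j + 1) k).
Definition eV n (G : C -> C) j k : C := J G (vx n j k) (vx n j (k + 1)).
(** The counterclockwise boundary sum of a cell: bottom, right, minus top, minus left. Arbitrary
    edge functions are allowed so that [dc_cancel] can change the values on inner edges. *)
Definition dc (H V : int -> int -> C) q : C :=
  H q.1 q.2 + V (q.1 + 1) q.2 - H q.1 (q.2 + 1) - V q.1 q.2.
Definition cycleI n S (G : C -> C) : C := \sum_(q <- S) dc (eH n G) (eV n G) q.

Lemma telescope (T : eqType) (S : seq T) (f g : T -> T) (D : T -> C) : uniq S ->
  cancel f g -> cancel g f -> (forall x, (x \in S) != (g x \in S) -> D x = 0) ->
  \sum_(x <- S) (D x - D (f x)) = 0.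
Proof.
move=> uS fg gf D0; rewrite sumrB; apply/eqP; rewrite subr_eq0; apply/eqP.
have -> : \sum_(x <- S) D x = \sum_(x <- [seq x <- S | g x \in S]) D x.
  rewrite big_filter [RHS]big_mkcond /= big_seq [RHS]big_seq; apply: eq_bigr => x xS.
  by case: ifPn => // nx; apply: D0; rewrite xS (negbTE nx).
have -> : \sum_(x <- S) D (f x) = \sum_(x <- map f [seq x <- S | f x \in S]) D x.
  rewrite big_map big_filter [RHS]big_mkcond /= big_seq [RHS]big_seq; apply: eq_bigr => x xS.
  by case: ifPn => // nx; apply: D0; rewrite fg xS (negbTE nx).
apply: perm_big; apply: uniq_perm; rewrite ?filter_uniq//.
  by rewrite map_inj_uniq ?filter_uniq//; exact: can_inj fg.
move=> x; rewrite mem_filter; apply/andP/mapP.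
  by move=> [gS xS]; exists (g x); rewrite ?mem_filter gf ?xS.
by move=> [y]; rewrite mem_filter => /andP[fS xS] ->; rewrite fg.
Qed.

(* Each inner edge of a union of cells is used twice, with opposite orientations. *)
Lemma dc_cancel S (H1 V1 H2 V2 : int -> int -> C) : uniq S ->
  (forall j k, ((j, k) \in S) != ((j, k - 1) \in S) -> H1 j k = H2 j k) ->
  (forall j k, ((j, k) \in S) != ((j - 1, k) \in S) -> V1 j k = V2 j k) ->
  \sum_(q <- S) dc H1 V1 q = \sum_(q <- S) dc H2 V2 q.
Proof.
move=> uS hH hV; apply/eqP; rewrite -subr_eq0 -sumrB.
have h1 := @telescope _ S (fun q => (q.1, q.2 + 1)) (fun q => (q.1, q.2 - 1))
  (fun q => H1 q.1 q.2 - H2 q.1 q.2) uS.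
have h2 := @telescope _ S (fun q => (q.1 + 1, q.2)) (fun q => (q.1 - 1, q.2))
  (fun q => V1 q.1 q.2 - V2 q.1 q.2) uS.
rewrite (eq_bigr (fun q => (H1 q.1 q.2 - H2 q.1 q.2 - (H1 q.1 (q.2 + 1) - H2 q.1 (q.2 + 1))) -
   (V1 q.1 q.2 - V2 q.1 q.2 - (V1 (q.1 + 1) q.2 - V2 (q.1 + 1) q.2)))); last first.
  by move=> q _; rewrite /dc; ring.
rewrite sumrB h1 ?h2 ?subrr//.
- by move=> [a b] /=; rewrite addrK.
- by move=> [a b] /=; rewrite subrK.
- by move=> [a b] /= /hV ->; rewrite subrr.
- by move=> [a b] /=; rewrite addrK.
- by move=> [a b] /=; rewrite subrK.
- by move=> [a b] /= /hH ->; rewrite subrr.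
Qed.

Definition adm n S (U K : set C) := [/\ uniq S, forall q, q \in S -> cell n q `<=` U &
  forall q z, cell n q z -> K z -> q \in S].

Lemma vx_cell n j k : [/\ cell n (j, k) (vx n j k), cell n (j, k) (vx n (j + 1) k),
  cell n (j, k) (vx n j (k + 1)) & cell n (j, k) (vx n (j + 1) (k + 1))].
Proof.
have h0 := mesh_gt0 n.
by split; split; rewrite /= !ler_pM2l ?ler_int//; lia.
Qed.

Definition edgeH n j k := cell n (j, k) `&` cell n (j, k - 1).
Definition edgeV n j k := cell n (j, k) `&` cell n (j - 1, k).

Lemma edgeH_cconv n j k : cconv (edgeH n j k).
Proof. by apply: cconvI; exact: cell_cconv. Qed.
Lemma edgeV_cconv n j k : cconv (edgeV n j k).
Proof. by apply: cconvI; exact: cell_cconv. Qed.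
Lemma edgeH_vx n j k : edgeH n j k (vx n j k) /\ edgeH n j k (vx n (j + 1) k).
Proof.
have [a1 a2 _ _] := vx_cell n j k; have [_ _ a3 a4] := vx_cell n j (k - 1).
by rewrite subrK in a3 a4.
Qed.
Lemma edgeV_vx n j k : edgeV n j k (vx n j k) /\ edgeV n j k (vx n j (k + 1)).
Proof.
have [a1 _ a2 _] := vx_cell n j k; have [_ a3 _ a4] := vx_cell n (j - 1) k.
by rewrite subrK in a3 a4.
Qed.

(** Cells are closed, so a point of [K] on a common edge would put both cells into [S]. The cell
    that does belong to [S] keeps the edge in [U]. *)
Lemma adm_edge n S U K q q' : adm n S U K -> (q \in S) != (q' \in S) ->
  forall z, (cell n q `&` cell n q') z -> U z /\ ~ K z.
Proof.
move=> [_ SU SK] neq z [z1 z2]; split; last first.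
  by move=> Kz; move: neq; rewrite (SK _ _ z1 Kz) (SK _ _ z2 Kz).
have [qS|nq] := boolP (q \in S); first exact: SU z1.
by apply: (SU q'); move: neq; rewrite (negbTE nq) ?negbK; case: (q' \in S).
Qed.

Lemma vx_double n j k : vx n j k = vx n.+1 (2 * j) (2 * k).
Proof. by rewrite /vx meshS !rmorphM /=; congr (_ +i* _)%C; ring. Qed.

Lemma mid_complex (a b c d : R) : mid (a +i* b)%C (c +i* d)%C = (((a + c) / 2) +i* ((b + d) / 2))%C.
Proof.
rewrite /mid -half_real; apply/eqP; rewrite eq_complex /=.
by apply/andP; split; apply/eqP; field.
Qed.

Lemma vx_midH n j k : mid (vx n j k) (vx n (j + 1) k) = vx n.+1 (2 * j + 1) (2 * k).
Proof.
rewrite mid_complex /vx meshS !rmorphD !rmorphM /=.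
by congr (_ +i* _)%C; field.
Qed.
Lemma vx_midV n j k : mid (vx n j k) (vx n j (k + 1)) = vx n.+1 (2 * j) (2 * k + 1).
Proof.
rewrite mid_complex /vx meshS !rmorphD !rmorphM /=.
by congr (_ +i* _)%C; field.
Qed.

Definition offs : seq (int * int) := [:: (0, 0); (1, 0); (0, 1); (1, 1)].
Definition child q (b : int * int) : int * int := (2 * q.1 + b.1, 2 * q.2 + b.2).
Definition refine S := [seq child q b | q <- S, b <- offs].

Lemma child_cell n q b : b \in offs -> cell n.+1 (child q b) `<=` cell n q.
Proof.
have h0 := mesh_gt0 n.+1; case: q => j k.
have H (x : R) (l : int) (c : int) : (c == 0) || (c == 1) ->
   mesh n.+1 * (2 * l + c)%:~R <= x <= mesh n.+1 * (2 * l + c + 1)%:~R ->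
   mesh n * l%:~R <= x <= mesh n * (l + 1)%:~R.
  by rewrite (meshS n) => /orP[]/eqP ->; rewrite !(rmorphD, rmorphM, rmorph1, rmorph0) /=; move: h0 => ?; lra.
move=> bo z; rewrite /cell/= => -[/H h1 /H h2]; move: bo; rewrite !inE.
by move=> /or4P[]/eqP e; move: h1 h2; rewrite e /= => h1 h2; split; [exact: h1|exact: h2|exact: h1|exact: h2|exact: h1|exact: h2|exact: h1|exact: h2].
Qed.

Lemma parent q : exists2 p, exists2 b, b \in offs & q = child p b & True.
Proof.
case: q => a b; exists ((a %/ 2)%Z, (b %/ 2)%Z) => //.
exists ((a %% 2)%Z, (b %% 2)%Z).
  rewrite !inE; have : (a %% 2)%Z = 0 \/ (a %% 2)%Z = 1 by lia.
  have : (b %% 2)%Z = 0 \/ (b %% 2)%Z = 1 by lia.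
  by move=> [->|->] [->|->].
by rewrite /child /= ![2 * _]mulrC -!divz_eq.
Qed.

Lemma adm_refine n S U K : adm n S U K -> adm n.+1 (refine S) U K.
Proof.
move=> [uS SU SK]; split.
- apply: allpairs_uniq => // x y hx hy.
  have /allpairsP[[q1 b1] [_ hb1 ->]] : x \in [seq (a, b) | a <- S, b <- offs] := hx.
  have /allpairsP[[q2 b2] [_ hb2 ->]] : y \in [seq (a, b) | a <- S, b <- offs] := hy.
  rewrite /child /= => -[].
  move: hb1 hb2; rewrite !inE; case: q1 q2 => [j k] [j' k'] /=.
  by move=> /or4P[]/eqP-> /or4P[]/eqP->; rewrite /= => h1 h2; congr (_, _, (_, _)); lia.
- by move=> q /allpairsP[[p b] /= [pS /child_cell h ->]] z /h; exact: SU.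
- move=> q z qz Kz; have [p [b bo e] _] := parent q.
  rewrite e; apply/allpairsP; exists (p, b); split => //=.
  by apply: SK Kz; apply: (child_cell bo); rewrite -e.
Qed.

(** Inner edges may cross [K], where nothing ensures that the integral is additive. By [dc_cancel]
    only the boundary edges have to be split, and these avoid [K]. *)
Lemma cycleI_refine n S U K G : adm n S U K -> (forall z, U z -> ~ K z -> cdiff G z) ->
  cycleI n S G = cycleI n.+1 (refine S) G.
Proof.
move=> aS dG; have [uS _ _] := aS.
rewrite /cycleI (@dc_cancel S _ _ (fun j k => eH n.+1 G (2 * j) (2 * k) + eH n.+1 G (2 * j + 1) (2 * k))
  (fun j k => eV n.+1 G (2 * j) (2 * k) + eV n.+1 G (2 * j) (2 * k + 1)))//.
- rewrite /refine big_flatten big_map; apply: eq_bigr => -[j k] _; rewrite /=.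
  rewrite !big_cons big_nil /dc /child /= !addr0 !mulrDr !mulr1.
  have -> : 2 * j + 2 = 2 * j + 1 + 1 by lia.
  have -> : 2 * k + 2 = 2 * k + 1 + 1 by lia.
  ring.
- move=> j k /(adm_edge aS) hE; rewrite /eH.
  have cE := edgeH_cconv n j k; have [e1 e2] := edgeH_vx n j k; have [mE _] := cE.
  have em := mE _ _ e1 e2.
  have dE z : edgeH n j k z -> cdiff G z by move=> /hE[]; exact: dG.
  rewrite J_split; [|exact: (intg_diff cE)..].
  by rewrite vx_midH !(vx_double n) mulrDr -addrA.
- move=> j k /(adm_edge aS) hE; rewrite /eV.
  have cE := edgeV_cconv n j k; have [e1 e2] := edgeV_vx n j k; have [mE _] := cE.
  have em := mE _ _ e1 e2.
  have dE z : edgeV n j k z -> cdiff G z by move=> /hE[]; exact: dG.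
  rewrite J_split; [|exact: (intg_diff cE)..].
  by rewrite vx_midV !(vx_double n) mulrDr -addrA.
Qed.

Lemma dc_cauchy n q G : (forall z, cell n q z -> cdiff G z) -> dc (eH n G) (eV n G) q = 0.
Proof.
case: q => j k dG; have [a1 a2 a3 a4] := vx_cell n j k.
have := quad (cell_cconv n (j, k)) dG a1 a2 a4 a3.
rewrite (J_rev G (vx n j (k + 1)) (vx n (j + 1) (k + 1))) (J_rev G (vx n j k) (vx n j (k + 1))).
by rewrite /dc /eH /eV /=.
Qed.

(** A cell of one set outside the other cannot meet [K], so Cauchy's theorem removes its
    contribution and both sums reduce to the common cells. *)
Lemma cycleI_same n S S' U K G : adm n S U K -> adm n S' U K ->
  (forall z, U z -> ~ K z -> cdiff G z) -> cycleI n S G = cycleI n S' G.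
Proof.
move=> aS aS' dG.
have H T T' : adm n T U K -> adm n T' U K ->
    cycleI n T G = \sum_(q <- [seq q <- T | q \in T']) dc (eH n G) (eV n G) q.
  move=> [uT TU TK] [_ _ TK']; rewrite /cycleI big_filter [RHS]big_mkcond [LHS]big_seq [RHS]big_seq.
  apply: eq_bigr => q qT; case: ifPn => // nq; apply: dc_cauchy => z qz.
  by apply: dG; [exact: TU qz|move=> Kz; move: nq; rewrite (TK' _ _ qz Kz)].
rewrite (H S S')// (H S' S)//; apply: perm_big.
have [uS _ _] := aS; have [uS' _ _] := aS'.
by apply: uniq_perm; rewrite ?filter_uniq// => q; rewrite !mem_filter andbC.
Qed.

(** Refining the first set [m] times and the second [n] times brings both to the level [n + m]. *)
Lemma cycleI_indep n m S S' U K G : adm n S U K -> adm m S' U K ->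
  (forall z, U z -> ~ K z -> cdiff G z) -> cycleI n S G = cycleI m S' G.
Proof.
have H i l T : adm l T U K -> (forall z, U z -> ~ K z -> cdiff G z) ->
   adm (l + i)%N (iter i refine T) U K /\ cycleI l T G = cycleI (l + i)%N (iter i refine T) G.
  move=> aT dG; elim: i => [|i [a e]]; first by rewrite addn0.
  rewrite addnS /=; split; first exact: adm_refine.
  by rewrite e; exact: cycleI_refine a dG.
move=> aS aS' dG; have [a1 ->] := H m n S aS dG; have [a2 ->] := H n m S' aS' dG.
by rewrite addnC in a1 *; exact: cycleI_same a1 a2 dG.
Qed.

(** The boundary edges with their signs. Unlike the sum over all cells, this list contains only
    segments in [U] and off [K], which is what estimates need; [cycleE] identifies the two. *)
Definition cyc n S : seq (C * (C * C)) := flatten [seq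
  [seq e.2 | e <- [:: (((q.1, q.2) \in S) != ((q.1, q.2 - 1) \in S), (1, (vx n q.1 q.2, vx n (q.1 + 1) q.2)));
    (((q.1 + 1, q.2) \in S) != ((q.1 + 1 - 1, q.2) \in S), (1, (vx n (q.1 + 1) q.2, vx n (q.1 + 1) (q.2 + 1))));
    (((q.1, q.2 + 1) \in S) != ((q.1, q.2 + 1 - 1) \in S), (-1, (vx n q.1 (q.2 + 1), vx n (q.1 + 1) (q.2 + 1))));
    (((q.1, q.2) \in S) != ((q.1 - 1, q.2) \in S), (-1, (vx n q.1 q.2, vx n q.1 (q.2 + 1))))] & e.1]
  | q <- S].

Lemma cycleE n S G : uniq S -> cycleI n S G = \sum_(e <- cyc n S) e.1 * J G e.2.1 e.2.2.
Proof.
move=> uS; rewrite /cycleI (@dc_cancel S _ _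
  (fun j k => if ((j, k) \in S) != ((j, k - 1) \in S) then eH n G j k else 0)
  (fun j k => if ((j, k) \in S) != ((j - 1, k) \in S) then eV n G j k else 0))//; first last.
- by move=> j k ->.
- by move=> j k ->.
rewrite /cyc big_flatten big_map; apply: eq_bigr => q _.
rewrite big_map big_filter !big_cons big_nil /dc /= /eH /eV.
by do 4 case: ifP => _; rewrite ?mul1r ?mulN1r; ring.
Qed.

Lemma cyc_edge n S U K e : adm n S U K -> e \in cyc n S ->
  exists E : set C, [/\ cconv E, E e.2.1, E e.2.2 & forall z, E z -> U z /\ ~ K z].
Proof.
move=> aS /flatten_mapP[[j k] _ /mapP[[b e']]]; rewrite mem_filter /= => /andP[hb].
rewrite !inE => he ->; move: he hb => /or4P[]/eqP[-> ->] /= hE.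
- exists (edgeH n j k); have [? ?] := edgeH_vx n j k.
  by split => //; [exact: edgeH_cconv|exact: adm_edge aS hE].
- exists (edgeV n (j + 1) k); have [? ?] := edgeV_vx n (j + 1) k.
  by split => //; [exact: edgeV_cconv|exact: adm_edge aS hE].
- exists (edgeH n j (k + 1)); have [? ?] := edgeH_vx n j (k + 1).
  by split => //; [exact: edgeH_cconv|exact: adm_edge aS hE].
- exists (edgeV n j k); have [? ?] := edgeV_vx n j k.
  by split => //; [exact: edgeV_cconv|exact: adm_edge aS hE].
Qed.

End Grid.

(** * Existence of grid cycles and Cauchy's formula for them *)

Section GridExistence.
Variable R : realType.
Local Notation C := R[i].
Implicit Types (z w : C) (j k : int) (q : int * int) (S : seq (int * int)).

Lemma mesh_local (h x : R) : 0 < h -> exists2 d : R, 0 < d &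
  forall y : R, `|y - x| < d -> forall j, h * j%:~R <= y <= h * (j + 1)%:~R ->
    h * j%:~R <= x <= h * (j + 1)%:~R.
Proof.
move=> h0; set m := Num.floor (x / h); set c := Num.ceil (x / h).
have m1 : x < h * (m + 1)%:~R by rewrite mulrC -ltr_pdivrMr// floorD1_gt.
have m2 : h * m%:~R <= x by rewrite mulrC -ler_pdivlMr// floor_le.
have c1 : h * (c - 1)%:~R < x by rewrite mulrC -ltr_pdivlMr// ceilB1_lt.
have c2 : x <= h * c%:~R by rewrite mulrC -ler_pdivrMr// ceil_ge.
exists (Num.min (h * (m + 1)%:~R - x) (x - h * (c - 1)%:~R)).
  by rewrite lt_min !subr_gt0 m1.
move=> y; rewrite lt_min ltr_norml ltr_norml => /andP[/andP[y1 y2] /andP[y3 y4]] j /andP[j1 j2].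
apply/andP; split.
  have [jm|mj] := lerP j m; first by apply: le_trans m2; rewrite ler_pM2l// ler_int.
  have : h * (m + 1)%:~R <= h * j%:~R by rewrite ler_pM2l// ler_int; lia.
  lra.
have [cj|jc] := lerP c (j + 1); first by apply: (le_trans c2); rewrite ler_pM2l// ler_int.
have : h * (j + 1)%:~R <= h * (c - 1)%:~R by rewrite ler_pM2l// ler_int; lia.
lra.
Qed.

(** The grid is locally finite with closed cells. Consequently the points all of whose cells belong
    to a given [S] form an open set. *)
Lemma cell_local n z : exists2 d : R, 0 < d & forall w q, nm (w - z) < d -> cell n q w -> cell n q z.
Proof.
have [d d0 hd] := @mesh_local (mesh R n) (Re z) (mesh_gt0 R n).
have [d' d'0 hd'] := @mesh_local (mesh R n) (Im z) (mesh_gt0 R n).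
exists (Num.min d d'); first by rewrite lt_min d0.
move=> w q; rewrite lt_min => /andP[wd wd'] [w1 w2]; split.
  by apply: hd w1; apply: le_lt_trans wd; rewrite -ReB nm_Re.
apply: hd' w2; apply: le_lt_trans wd'; have := nm_Im (w - z).
by case: (w) (z) => a b [a' b'].
Qed.

Lemma mesh_small (e : R) : 0 < e -> exists n0 : nat, forall n, (n0 <= n)%N -> mesh R n < e.
Proof.
move=> e0; have [n0] := @geom_small R 1 2^-1 e ltac:(by rewrite invr_ge0) ltac:(by rewrite invf_lt1// ltr1n) e0.
rewrite mul1r => h; exists n0 => n nn; apply: le_lt_trans h.
by apply: ler_wiXn2l => //; rewrite ?invr_ge0 ?invf_le1 ?ler1n.
Qed.

Lemma cell_diam n q z w : cell n q z -> cell n q w -> nm (w - z) <= 2 * mesh R n.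
Proof.
case: q => j k [/= h1 h2] [/= h3 h4]; apply: (le_trans (nm_ReIm _)).
have h0 := mesh_gt0 R n; move: h1 h2 h3 h4; rewrite !rmorphD /= rmorph1 => h1 h2 h3 h4.
have -> : Re (w - z) = Re w - Re z by rewrite ReB.
have -> : Im (w - z) = Im w - Im z by case: (w) (z) => a b [].
have : `|Re w - Re z| <= mesh R n by rewrite ler_norml; lra.
have : `|Im w - Im z| <= mesh R n by rewrite ler_norml; lra.
lra.
Qed.

(** Take all cells that meet [K]: finitely many since [K] is bounded, and inside [U] since their
    diameter is at most [2 * mesh R n < h0]. *)
Lemma exists_adm (U K : set C) (h0 M : R) : 0 < h0 ->
  (forall z w, K z -> nm (w - z) < h0 -> U w) -> (forall z, K z -> nm z <= M) ->
  exists n S, adm n S U K.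
Proof.
move=> h00 KU KM; have [n /(_ n (leqnn _)) hn] := mesh_small (divr_gt0 h00 (ltr0n R 2)).
have m0 := mesh_gt0 R n.
have [N hN] := ex_natr_ge (M / mesh R n).
pose rg : seq int := [seq (i%:Z - N.+1%:Z) | i <- iota 0 (N.+2).*2].
have rgP j : (- (N.+1)%:Z <= j <= N.+1%:Z) -> j \in rg.
  move=> hj; apply/mapP; exists (absz (j + N.+1%:Z)); last by lia.
  by rewrite mem_iota; lia.
have urg : uniq rg by rewrite map_inj_uniq ?iota_uniq// => x y /addIr[].
pose S := [seq q <- [seq (j, k) | j <- rg, k <- rg] | `[< exists2 z, cell n q z & K z >]].
exists n, S; split.
- by apply: filter_uniq; apply: allpairs_uniq => // -[? ?] [? ?].
- move=> q; rewrite mem_filter => /andP[/asboolP[z qz Kz] _] w qw.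
  by apply: (KU z) => //; have := cell_diam qz qw; lra.
- move=> [j k] z qz Kz; rewrite mem_filter; apply/andP; split; first by apply/asboolP; exists z.
  have H (x : R) (l : int) : `|x| <= M -> mesh R n * l%:~R <= x <= mesh R n * (l + 1)%:~R -> l \in rg.
    rewrite ler_norml => hx hl; apply: rgP.
    have hM : M <= mesh R n * N%:~R by rewrite mulrC -ler_pdivrMr.
    have h1 : mesh R n * l%:~R <= mesh R n * N%:~R by lra.
    have h2 : mesh R n * (- (l + 1))%:~R <= mesh R n * N%:~R by rewrite rmorphN mulrN; lra.
    by move: h1 h2; rewrite !ler_pM2l// !ler_int; lia.
  case: qz => z1 z2; apply/allpairsP; exists (j, k); split => //=.
    by apply: (H (Re z)) => //; exact: le_trans (nm_Re _) (KM _ Kz).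
  by apply: (H (Im z)) => //; exact: le_trans (nm_Im _) (KM _ Kz).
Qed.

(** The four cells with vertex 0. They form a square centred at 0, the link between grid cycles and
    [sqI]. *)
Definition central : seq (int * int) := [:: (-1, -1); (0, -1); (-1, 0); (0, 0)].

Lemma central_disc n q z : q \in central -> cell n q z -> nm z <= 2 * mesh R n.
Proof.
have h0 := mesh_gt0 R n.
move=> qc [z1 z2]; apply: (le_trans (nm_ReIm _)).
have [H1 H2] : - mesh R n <= Re z <= mesh R n /\ - mesh R n <= Im z <= mesh R n.
  move: qc z1 z2; rewrite !inE => /or4P[]/eqP -> /=; rewrite ?addNr ?add0r ?mulr0 ?mulr1 ?mulrN1 => h1 h2; lra.
have : `|Re z| <= mesh R n by rewrite ler_norml.
have : `|Im z| <= mesh R n by rewrite ler_norml.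
lra.
Qed.

Lemma central_adm n (U : set C) (r : R) : 2 * mesh R n <= r -> (forall w, nm w <= r -> U w) ->
  adm n central U [set 0].
Proof.
move=> nr hU; split => //.
  by move=> q qc z qz; apply: hU; apply: le_trans nr; exact: central_disc qc qz.
move=> [j k] z + z0; rewrite z0 /cell/= => -[].
have h0 := mesh_gt0 R n.
have H l : mesh R n * l%:~R <= 0 <= mesh R n * (l + 1)%:~R -> l = -1 \/ l = 0.
  rewrite pmulr_rle0// pmulr_rge0// (_ : 0 = 0%:~R)// !ler_int; lia.
by move=> /H[]-> /H[]->.
Qed.

Lemma cycleI_central n (G : C -> C) (r : R) : 2 * mesh R n <= r ->
  (forall w, w != 0 -> nm w <= r -> cdiff G w) ->
  cycleI n central G = sqI G 0 (mesh R n).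
Proof.
move=> nr dG; have h0 := mesh_gt0 R n.
have vE j k a b : mesh R n * j%:~R = a -> mesh R n * k%:~R = b -> vx R n j k = (a +i* b)%C.
  by move=> <- <-.
pose h := mesh R n.
have cE (k : nat) : cor 0 h k = (h +i* h)%C * 'i%C ^+ k :> C.
  rewrite /cor add0r mulrA; congr (_ * _).
  by apply/eqP; rewrite eq_complex /=; apply/andP; split; apply/eqP; ring.
have c0 : cor 0 h 0 = vx R n 1 1 by rewrite cE expr0 mulr1 (vE _ _ h h)// mulr1.
have c1 : cor 0 h 1 = vx R n (-1) 1.
  rewrite cE expr1 (vE _ _ (- h) h) ?mulr1 ?mulrN1//.
  by apply/eqP; rewrite eq_complex /=; apply/andP; split; apply/eqP; ring.
have c2 : cor 0 h 2 = vx R n (-1) (-1).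
  by rewrite cE sqr_i (vE _ _ (- h) (- h)) ?mulrN1.
have c3 : cor 0 h 3 = vx R n 1 (-1).
  rewrite cE exprS sqr_i mulrN1 (vE _ _ h (- h)) ?mulr1 ?mulrN1//.
  by apply/eqP; rewrite eq_complex /=; apply/andP; split; apply/eqP; ring.
have S (k : nat) : J G (cor 0 h k) (cor 0 h k.+1) = J G (cor 0 h k) (mid (cor 0 h k) (cor 0 h k.+1)) +
    J G (mid (cor 0 h k) (cor 0 h k.+1)) (cor 0 h k.+1).
  have [e1 e2] := @cor_disc_outer _ 0 h h 0 k h0 ltac:(by rewrite subrr nm0 subr0).
  have cc := @disc_outer_cconv _ 0 (2 * h) h 0 k; have [mE _] := cc.
  have em := mE _ _ e1 e2.
  have dE w : ([set w | nm (w - 0) <= 2 * h] `&` outer 0 h k) w -> cdiff G w.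
    move=> [/= wr ow]; apply: dG; first exact: outer0 ow.
    by rewrite subr0 in wr; exact: le_trans nr.
  by rewrite J_split//; exact: (intg_diff cc).
have midE j k j' k' a b : mesh R n * (j + j')%:~R = 2 * mesh R n * a%:~R ->
    mesh R n * (k + k')%:~R = 2 * mesh R n * b%:~R -> mid (vx R n j k) (vx R n j' k') = vx R n a b.
  rewrite !rmorphD /= => ha hb; rewrite mid_complex /vx; congr (_ +i* _)%C; lra.
rewrite /sqI !big_ord_recr big_ord0 /= !S c0 c1 c2 c3 cor4 c0.
rewrite (midE 1 1 (-1) 1 0 1) ?(midE (-1) 1 (-1) (-1) (-1) 0) ?(midE (-1) (-1) 1 (-1) 0 (-1)) ?(midE 1 (-1) 1 1 1 0).
rewrite /cycleI /central !big_cons big_nil /dc /eH /eV /= !addNr !add0r.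
rewrite (J_rev G (vx R n 0 1) (vx R n 1 1)) (J_rev G (vx R n (-1) 1) (vx R n 0 1)).
rewrite (J_rev G (vx R n (-1) 0) (vx R n (-1) 1)) (J_rev G (vx R n (-1) (-1)) (vx R n (-1) 0)).
ring.
all: rewrite /= ?addrN ?addNr ?mulr0 ?mulr1 ?mulrN1//; ring.
Qed.

(** When [F] is differentiable on all of [U], the only singularity of [F w / w] is 0, so the set to
    be surrounded can be reduced to the point 0 and the cycle exchanged for the central square. *)
Lemma cycleI_center n S (U K : set C) F : adm n S U K -> K 0 ->
  (exists2 r : R, 0 < r & forall w, nm w <= r -> U w) -> (forall w, U w -> cdiff F w) ->
  cycleI n S (fun w => F w * w^-1) = kappa * F 0.
Proof.
move=> [uS SU SK] K0 [r r0 rU] dF.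
have aS : adm n S U [set 0] by split => // q z qz z0; apply: (SK q z) => //; rewrite z0.
have [m /(_ m (leqnn _)) hm] := mesh_small (divr_gt0 r0 (ltr0n R 2)).
have mr : 2 * mesh R m <= r by lra.
have dG w : U w -> ~ [set (0 : C)] w -> cdiff (fun w => F w * w^-1) w.
  by move=> Uw /eqP w0; apply: cdiffM; [exact: dF|exact: cdiff_inv].
rewrite (cycleI_indep aS (central_adm mr rU) dG) (cycleI_central mr); last first.
  by move=> w /eqP w0 wr; apply: dG => //; exact: rU.
have D w : nm (w - 0) <= 2 * mesh R m -> cdiff F w.
  by rewrite subr0 => wr; apply: dF; apply: rU; exact: le_trans mr.
rewrite -(cauchy_formula (mesh_gt0 R m) (sqdom_disc 0 (mesh_gt0 R m) (lexx _)) D).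
  by congr (sqI _ _ _); apply/funext => w; rewrite subr0.
by rewrite subrr nm0 mesh_gt0.
Qed.

End GridExistence.

(** * Gateaux holomorphic functions on slices *)

Section EuclideanTopology.
Variable R : realType.
Local Notation C := R[i].
Implicit Types (z w : C).

Lemma gt0_complex (e : C) : 0 < e -> 0 < Re e /\ e = (Re e)%:C%C.
Proof. by case: e => a b; rewrite ltcE /= => /andP[/eqP -> a0]. Qed.

Lemma nbhs_nmP (z : Cx R) (A : set (Cx R)) :
  nbhs z A <-> exists2 r : R, 0 < r & forall w : C, nm (w - z) < r -> A w.
Proof.
split.
  move=> /nbhs_ballP[e /= /gt0_complex[e0 ee]] h; exists (Re e) => // w wz.
  by apply: h; rewrite -ball_normE /ball_ /= nmE nmBC ee ltcR.
move=> [r r0 h]; apply/nbhs_ballP; exists r%:C%C => /=; first by rewrite ltcR.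
by move=> w; rewrite -ball_normE /ball_ /= nmE nmBC ltcR; exact: h.
Qed.

Lemma openCP (A : set (Cx R)) :
  open A <-> forall z, A z -> exists2 r : R, 0 < r & forall w : C, nm (w - z) < r -> A w.
Proof.
by rewrite openE; split=> h z /h; [move/nbhs_nmP|move=> ?; exact/nbhs_nmP].
Qed.

Lemma nbhs_nm2P (p : Cx R * Cx R) (A : set (Cx R * Cx R)) :
  nbhs p A <-> exists2 r : R, 0 < r & forall q : C * C, nm (q.1 - p.1) < r -> nm (q.2 - p.2) < r -> A q.
Proof.
split.
  move=> [[A1 A2] /= [/nbhs_nmP[r r0 h1] /nbhs_nmP[r' r'0 h2]] h]; exists (Num.min r r').
    by rewrite lt_min r0.
  by move=> q; rewrite !lt_min => /andP[q1 _] /andP[_ q2]; apply: h; split; [exact: h1|exact: h2].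
move=> [r r0 h]; exists ([set w : Cx R | nm (w - p.1) < r], [set w : Cx R | nm (w - p.2) < r]).
  by split; apply/nbhs_nmP; exists r.
by move=> q [/= q1 q2]; exact: h.
Qed.

Lemma openC2P (A : set (Cx R * Cx R)) :
  open A -> forall p, A p -> exists2 r : R, 0 < r & forall q : C * C,
    nm (q.1 - p.1) < r -> nm (q.2 - p.2) < r -> A q.
Proof. by rewrite openE => h p /h /nbhs_nm2P. Qed.

Lemma derivable_cdiff (g : Cx R -> Cx R) (z : Cx R) : derivable g z 1 <-> cdiff g z.
Proof.
split.
  move=> /cvg_ex[l /= gl].
  pose f (w : C) : C := if w == z then l else (g w - g z) * (w - z)^-1.
  exists f.
    move=> e e0; rewrite {2}/f eqxx.
    have /(_ [set x : Cx R | nm (x - l) <= e])[|d d0 hd] := gl.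
      by apply/nbhs_nmP; exists e => // w /ltW.
    move: d0 => /= /gt0_complex[d0 ee]; exists (Re d) => // w wd.
    rewrite /f; case: eqVneq => [_|wz]; first by rewrite subrr nm0 ltW.
    have := hd (w - z); rewrite /= sub0r normrN nmE ee ltcR => /(_ wd).
    rewrite subr_eq0 => /(_ wz).
    by rewrite /= -[_%:A]/((w - z) * 1) mulr1 subrK -[_ *: _]/(_ * _) mulrC.
  exists 1 => // w _; rewrite /f; case: eqVneq => [->|wz]; first by rewrite subrr mulr0 addr0.
  by rewrite divfK ?subr_eq0// addrC subrK.
move=> [f fc [d d0 fd]]; apply/cvg_ex; exists (f z : Cx R) => A /nbhs_nmP[e e0 hA].
have [d' d'0 hd'] := fc _ (divr_gt0 e0 (ltr0n R 2)).
exists (Num.min d d')%:C%C => /=; first by rewrite ltcR lt_min d0.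
move=> h /=; rewrite sub0r normrN nmE ltcR lt_min => /andP[hd hd2] h0.
apply: hA; rewrite -[_%:A]/(h * 1) mulr1 -[_ *: _]/(_ * _) fd; last by rewrite addrK.
rewrite addrK [_ + _ - _]addrC addKr mulrCA mulVf// mulr1.
have := hd' (h + z); rewrite addrK => /(_ hd2); lra.
Qed.

(* Compactness in the form of a Lebesgue number: a property that holds locally at some scale holds
   at a uniform scale. *)
Definition ccompact (A : set C) := forall P : R -> C -> Prop,
  (forall (r r' : R) z, 0 < r' -> r' <= r -> P r z -> P r' z) ->
  (forall z, A z -> exists2 r : R, 0 < r & forall w, nm (w - z) < r -> P r w) ->
  exists2 r : R, 0 < r & forall w, A w -> P r w.

Lemma compact_ccompact (A : set (Cx R)) : compact A -> ccompact A.
Proof.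
move=> /compact_near_coveringP cA P Pmono Ploc.
have := cA R (0 : R)^'+ (fun r z => P r z) _.
case.
  move=> z /Ploc[r r0 h].
  exists ([set w : Cx R | nm (w - z) < r], [set r' | 0 < r' /\ r' <= r]) => /=.
    split; first by apply/nbhs_nmP; exists r.
    near=> r'; split; near: r'; [exact: nbhs_right_gt|exact: nbhs_right_le].
  by move=> [w r'] [/= /h hw [r'0 r'r]]; exact: Pmono hw.
move=> d /= d0 h; exists (d / 2); first by rewrite divr_gt0.
move=> w; apply: h => /=; last by rewrite divr_gt0.
by rewrite sub0r normrN ger0_norm ?ltr_pdivrMr ?ltr_pMr ?ltr1n// divr_ge0// ltW.
Unshelve. all: by end_near. Qed.

Lemma compact_ccompact2 (A : set (Cx R * Cx R)) : compact A -> forall P : R -> C * C -> Prop,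
  (forall (r r' : R) p, 0 < r' -> r' <= r -> P r p -> P r' p) ->
  (forall p, A p -> exists2 r : R, 0 < r & forall q : C * C,
     nm (q.1 - p.1) < r -> nm (q.2 - p.2) < r -> P r q) ->
  exists2 r : R, 0 < r & forall p, A p -> P r p.
Proof.
move=> /compact_near_coveringP cA P Pmono Ploc.
have := cA R (0 : R)^'+ P _.
case.
  move=> p0 /Ploc[r r0 h].
  exists ([set q : Cx R * Cx R | nm (q.1 - p0.1) < r /\ nm (q.2 - p0.2) < r], [set r' | 0 < r' /\ r' <= r]) => /=.
    split; first by apply/nbhs_nm2P; exists r => // q q1 q2.
    near=> r'; split; near: r'; [exact: nbhs_right_gt|exact: nbhs_right_le].
  by move=> [q r'] [/= [q1 q2] [r'0 r'r]]; exact: Pmono (h _ q1 q2).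
move=> d /= d0 h; exists (d / 2); first by rewrite divr_gt0.
move=> q; apply: h => /=; last by rewrite divr_gt0.
by rewrite sub0r normrN ger0_norm ?ltr_pdivrMr ?ltr_pMr ?ltr1n// divr_ge0// ltW.
Unshelve. all: by end_near. Qed.

(* Unlike in [two_open], the directions need not be independent. *)
Definition plane_open (X : lmodType (Cx R)) (A : set X) :=
  forall (a v w : X), A a -> exists2 r : R, 0 < r &
    forall l m : C, nm l < r -> nm m < r -> A (a + l *: v + m *: w).

Lemma dependent_line (X : lmodType (Cx R)) (v w : X) : ~ indep2 v w ->
  exists t : X, exists c c' : Cx R, v = c *: t /\ w = c' *: t.
Proof.
move=> nd; have [->|v0] := eqVneq v 0.
  by exists w, 0, 1; rewrite scale0r scale1r.
exists v; exists 1; apply: contrapT => H; apply: nd => al be e.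
have b0 : be = 0.
  apply: contrapT => /eqP b0; apply: H; exists (- (be^-1 * al)); split; first by rewrite scale1r.
  move/eqP: e; rewrite addrC addr_eq0 => /eqP /(congr1 (fun x => be^-1 *: x)).
  by rewrite scalerA mulVf// scale1r => ->; rewrite scalerN scaleNr scalerA.
split => //; move/eqP: e; rewrite b0 scale0r addr0 scaler_eq0 (negbTE v0) orbF.
by move=> /eqP.
Qed.

Lemma two_open_plane (X : lmodType (Cx R)) (A : set X) : two_open A -> plane_open A.
Proof.
move=> [opL opP] a v w Aa; have [ind|/dependent_line[t [c [c' [-> ->]]]]] := pselect (indep2 v w).
  have [|r r0 h] := openC2P (opP a v w ind) (p := (0, 0)).
    by rewrite /= !scale0r !addr0.
  by exists r => // l m lr mr; apply: (h (l, m)); rewrite /= subr0.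
have [->|t0] := eqVneq t 0.
  by exists 1 => // l m _ _; rewrite !scaler0 !addr0.
have [|r r0 h] := (openCP _).1 (opL a t t0) 0.
  by rewrite /= scale0r addr0.
have n0 : 0 < nm c + nm c' + 1 by rewrite ltr_pwDr// addr_ge0// nm_ge0.
exists (r / (nm c + nm c' + 1)); first by rewrite divr_gt0.
move=> l m; rewrite !ltr_pdivlMr// => lr mr.
rewrite !scalerA -addrA -scalerDl; apply: h; rewrite subr0.
have c0 := nm_ge0 c; have c'0 := nm_ge0 c'; have l0 := nm_ge0 l; have m0 := nm_ge0 m.
apply: (le_lt_trans (nmD _ _)); rewrite !nmM.
have [lm|ml] := lerP (nm l) (nm m); first by apply: le_lt_trans mr; nra.
by apply: le_lt_trans lr; nra.
Qed.

Lemma sg_cconv (p q : C) : cconv (sg p q).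
Proof.
have [<-|pq] := eqVneq p q.
  suff -> : sg p p = [set z | nm (z - p) <= 0] by exact: cconv_disc.
  apply/seteqP; split => z /=; first by move=> [t _ ->]; rewrite subrr mulr0 addr0 subrr nm0.
  move=> h; have : nm (z - p) == 0 by apply/eqP/le_anti; rewrite h nm_ge0.
  by rewrite nm_eq0 subr_eq0 => /eqP ->; exact: sg_l.
have qp0 : q - p != 0 by rewrite subr_eq0 eq_sym.
pose a := (q - p)^-1.
pose B := ([set z | Re (a * p) <= Re (a * z)] `&` [set z | Re (- a * p) - 1 <= Re (- a * z)])
 `&` ([set z | Re ('i%C * a * p) <= Re ('i%C * a * z)] `&` [set z | Re (- ('i%C * a) * p) <= Re (- ('i%C * a) * z)]).
suff -> : sg p q = B by apply: cconvI; apply: cconvI; exact: cconv_half.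
have E z : B z <-> (0 <= Re (a * (z - p)) /\ Re (a * (z - p)) <= 1) /\ Im (a * (z - p)) = 0.
  have ReIm (x : C) : Re ('i%C * x) = - Im x by case: x => x y /=; ring.
  have RN (x : C) : Re (- x) = - Re x by case: x.
  have e1 : Re (a * (z - p)) = Re (a * z) - Re (a * p) by rewrite mulrBr ReB.
  have e2 : Im (a * (z - p)) = - (Re ('i%C * a * z) - Re ('i%C * a * p)).
    by rewrite -ReB -!mulrA -mulrBr -mulrBr ReIm opprK.
  rewrite /B/= e1 e2 !mulNr !RN; split; first by move=> [[? ?] [? ?]]; split; lra.
  by move=> [[? ?] ?]; split; split; lra.
apply/seteqP; split => z; rewrite E.
  move=> [t t01 ->]; rewrite [_ + _ - p]addrC addKr mulrCA mulVf// mulr1 /=; lra.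
move=> [[h1 h2] h3]; exists (Re (a * (z - p))); first by rewrite h1.
have -> : (Re (a * (z - p)))%:C%C = a * (z - p) by move: h3; case: (a * (z - p)) => x y /= ->.
by rewrite mulrAC mulVf// mul1r addrC subrK.
Qed.

Definition hull (p q r : C) : set C := [set z | exists al be ga : R,
  [/\ 0 <= al, 0 <= be, 0 <= ga, al + be + ga = 1 &
   z = al%:C%C * p + be%:C%C * q + ga%:C%C * r]].

(** A barycentric coordinate at least 1/2 places the point in the corner triangle at that vertex;
    otherwise the point is in the middle triangle. *)
Lemma hull_split p q r z : hull p q r z -> [\/ hull p (mid p q) (mid p r) z,
  hull (mid p q) q (mid q r) z, hull (mid p r) (mid q r) r z | hull (mid q r) (mid p r) (mid p q) z].
Proof.
move=> [al [be [ga [a0 b0 c0 s ->]]]].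
have s' : ga = 1 - al - be by lra.
rewrite s' /mid; have [h1|h1] := lerP 2^-1 al.
  apply: Or41; exists (2 * al - 1), (2 * be), (2 * (1 - al - be)); split; [lra..|].
  by rewrite !(rmorphB, rmorphM, rmorph_nat, rmorph1) /=; field.
have [h2|h2] := lerP 2^-1 be.
  apply: Or42; exists (2 * al), (2 * be - 1), (2 * (1 - al - be)); split; [lra..|].
  by rewrite !(rmorphB, rmorphM, rmorph_nat, rmorph1) /=; field.
have [h3|h3] := lerP 2^-1 (1 - al - be).
  apply: Or43; exists (2 * al), (2 * be), (2 * (1 - al - be) - 1); split; [lra..|].
  by rewrite !(rmorphB, rmorphM, rmorph_nat, rmorph1) /=; field.
apply: Or44; exists (1 - 2 * al), (1 - 2 * be), (1 - 2 * (1 - al - be)); split; [lra..|].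
by rewrite !(rmorphB, rmorphM, rmorph_nat, rmorph1) /=; field.
Qed.

Lemma hull_ccompact (E : set C) p q r : cconv E -> E p -> E q -> E r ->
  (forall P : R -> C -> Prop,
  (forall (r r' : R) z, 0 < r' -> r' <= r -> P r z -> P r' z) ->
  (forall z, E z -> exists2 r : R, 0 < r & forall w, nm (w - z) < r -> P r w) ->
  exists2 s : R, 0 < s & forall w, hull p q r w -> P s w).
Proof.
move=> cE Ep Eq Er P Pmono Ploc; move: p q r Ep Eq Er.
apply: (@cousin_tri _ E (fun p q r => exists2 s : R, 0 < s & forall w, hull p q r w -> P s w)) => //.
  move=> p q r _ _ _ [s1 s10 h1] [s2 s20 h2] [s3 s30 h3] [s4 s40 h4].
  exists (Num.min (Num.min s1 s2) (Num.min s3 s4)); first by rewrite !lt_min s10 s20 s30 s40.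
  have m0 : 0 < Num.min (Num.min s1 s2) (Num.min s3 s4) by rewrite !lt_min s10 s20 s30 s40.
  move=> w /hull_split[/h1|/h2|/h3|/h4]; apply: Pmono => //; rewrite !ge_min lexx ?orbT//.
move=> z /Ploc[s s0 h]; exists (s / 3); first by rewrite divr_gt0.
move=> p q r _ _ _ hper hp; exists s => // w [al [be [ga [a0 b0 c0 sm ->]]]]; apply: h.
have N1 := nm_ge0 (q - p); have N2 := nm_ge0 (r - q); have N3 := nm_ge0 (p - r).
have -> : al%:C%C * p + be%:C%C * q + ga%:C%C * r - z = (p - z) + (be%:C%C * (q - p) - ga%:C%C * (p - r)).
  have -> : al = 1 - be - ga by lra.
  by rewrite !(rmorphB, rmorph1) /=; ring.
apply: (le_lt_trans (nmD _ _)).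
have h1 : nm (be%:C%C * (q - p) - ga%:C%C * (p - r)) <= nm (q - p) + nm (p - r).
  apply: (le_trans (nmB _ _)); rewrite !nmM !nmR !ger0_norm//.
  by apply: lerD; rewrite -[leRHS]mul1r ler_wpM2r ?nm_ge0//; lra.
rewrite /per in hper hp; lra.
Qed.

(** The cell is cut along its diagonal into two triangles, whose compactness comes from
    bisection. *)
Lemma cell_ccompact n q : ccompact (@cell R n q).
Proof.
move=> P Pmono Ploc; case: q Ploc => j k Ploc.
have [a1 a2 a3 a4] := vx_cell R n j k; have cE := cell_cconv R n (j, k).
have [s s0 h] := hull_ccompact cE a1 a2 a4 Pmono Ploc.
have [s' s'0 h'] := hull_ccompact cE a1 a3 a4 Pmono Ploc.
have m0 := mesh_gt0 R n.
exists (Num.min s s'); first by rewrite lt_min s0.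
move=> z [/= z1 z2].
pose x := (Re z - mesh R n * j%:~R) / mesh R n; pose y := (Im z - mesh R n * k%:~R) / mesh R n.
have zE : z = ((mesh R n * (j%:~R + x)) +i* (mesh R n * (k%:~R + y)))%C.
  rewrite /x /y !mulrDr !(mulrCA (mesh R n)) divff ?gt_eqF// !mulr1 ![_ * _%:~R]mulrC.
  by case: (z) => u v /=; congr (_ +i* _)%C; ring.
move: z1 z2; rewrite rmorphD /= rmorph1 => z1 z2.
have x01 : 0 <= x <= 1.
  by rewrite /x ler_pdivlMr// ler_pdivrMr//; lra.
have y01 : 0 <= y <= 1.
  by rewrite /y ler_pdivlMr// ler_pdivrMr//; move: z2; rewrite rmorphD /= rmorph1; lra.
have [xy|xy] := lerP y x.
  apply: (Pmono s); [by rewrite lt_min s0|by rewrite ge_min lexx|apply: h].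
  exists (1 - x), (x - y), y; split; [lra..|].
  rewrite zE /vx !rmorphD /= rmorph1; apply/eqP; rewrite eq_complex /=.
  by apply/andP; split; apply/eqP; ring.
apply: (Pmono s'); [by rewrite lt_min s0|by rewrite ge_min lexx orbT|apply: h'].
exists (1 - y), (y - x), x; split; [lra..|].
rewrite zE /vx !rmorphD /= rmorph1; apply/eqP; rewrite eq_complex /=.
by apply/andP; split; apply/eqP; ring.
Qed.

End EuclideanTopology.

(** * Identity and uniqueness for Gateaux holomorphic functions *)

Section Gateaux.
Variable R : realType.
Local Notation C := R[i].
Variable X : lmodType (Cx R).
Implicit Types (A : set X) (f g : X -> C) (a v w : X) (l z : C).

Definition GH A f := forall a v, A a -> cdiff (fun l : C => f (a + l *: v)) 0.

Lemma GH_at A f a v z : GH A f -> A (a + z *: v) -> cdiff (fun l : C => f (a + l *: v)) z.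
Proof.
move=> hf Az; have := hf _ v Az => h0.
have := cdiff_affine (h := fun l : C => f (a + z *: v + l *: v)) (a := 1) (b := - z) (z := z).
rewrite mul1r subrr => /(_ h0); apply: (@cdiff_near _ _ _ _ 1) => // l _.
by rewrite mul1r -addrA -scalerDl addrC [z + _]addrC subrK addrC.
Qed.

Lemma GH_sub A B f : A `<=` B -> GH B f -> GH A f.
Proof. by move=> AB hf a v /AB; exact: hf. Qed.

Lemma GH_sb A f g : GH A f -> GH A g -> GH A (fun x => f x - g x).
Proof. by move=> hf hg a v Aa; apply: cdiffB; [exact: hf|exact: hg]. Qed.

Lemma plane_line A a v : plane_open A -> A a -> exists2 r : R, 0 < r & forall l, nm l < r -> A (a + l *: v).
Proof.
move=> pA /(pA a v 0)[r r0 h]; exists r => // l lr.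
by have := h l 0 lr; rewrite nm0 scaler0 addr0; exact.
Qed.

Lemma slice_open A a v z : plane_open A -> A (a + z *: v) ->
  exists2 r : R, 0 < r & forall w : C, nm (w - z) < r -> A (a + w *: v).
Proof.
move=> pA /(plane_line v pA)[r r0 h]; exists r => // w wz.
by have := h _ wz; rewrite -addrA -scalerDl [z + _]addrC subrK.
Qed.

Lemma slice_holo A f a v z : plane_open A -> GH A f -> A (a + z *: v) ->
  holo (fun l : C => f (a + l *: v)) z.
Proof.
move=> pA hf Az; have [r r0 h] := slice_open pA Az; exists (r / 2); first by rewrite divr_gt0.
by move=> w wz; apply: (GH_at hf); apply: h; lra.
Qed.

(** Vanishing near [a] on each complex line separately, with a radius depending on the line: the
    form of local vanishing that fits sets controlled only on planes. *)
Definition germ0 f a := forall w, exists2 r : R, 0 < r & forall l : C, nm l < r -> f (a + l *: w) = 0.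

Lemma germ0_at f a : germ0 f a -> f a = 0.
Proof. by move=> /(_ 0)[r r0 /(_ 0)]; rewrite nm0 scaler0 addr0; exact. Qed.

Lemma segment_tube A a v w (p q : C) : plane_open A -> (forall z, sg p q z -> A (a + z *: v)) ->
  exists2 r : R, 0 < r & forall l z, nm l < r -> sg p q z -> A (a + l *: w + z *: v).
Proof.
move=> pA hA.
have cE := sg_cconv p q; have [mE _] := cE.
pose Q (p' q' : C) := exists2 r : R, 0 < r & forall l z, nm l < r -> sg p' q' z -> A (a + l *: w + z *: v).
apply: (@cousin_seg _ (sg p q) Q) => //; [..|exact: sg_l|exact: sg_r].
  move=> x y _ _ [r r0 h] [r' r'0 h']; exists (Num.min r r'); first by rewrite lt_min r0.
  move=> l z; rewrite lt_min => /andP[lr lr'] [t /andP[t0 t1] ->]; have [t2|t2] := leP t 2^-1.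
    apply: h => //; exists (2 * t); first lra.
    by rewrite /mid rmorphM rmorph_nat; field.
  apply: h' => //; exists (2 * t - 1); first lra.
  by rewrite /mid rmorphB rmorph1 rmorphM rmorph_nat; field.
move=> z /hA/(pA _ w v)[r r0 h]; exists r => // x y _ _ xz yz; exists r => // l m lr sm.
have mz : nm (m - z) < r.
  move: sm => [t /andP[t0 t1] ->].
  have -> : x + t%:C%C * (y - x) - z = (1 - t)%:C%C * (x - z) + t%:C%C * (y - z).
    by rewrite rmorphB rmorph1; ring.
  apply: (le_lt_trans (nmD _ _)); rewrite !nmM !nmR !ger0_norm ?subr_ge0//.
  set x' := nm (x - z) in xz *; set y' := nm (y - z) in yz *.
  have xm : x' <= Num.max x' y' by rewrite le_max lexx.
  have ym : y' <= Num.max x' y' by rewrite le_max lexx orbT.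
  apply: (@le_lt_trans _ _ (Num.max x' y')); last by rewrite gt_max xz.
  by nra.
have -> : a + l *: w + m *: v = a + z *: v + l *: w + (m - z) *: v.
  by rewrite [RHS]addrAC -(addrA a (z *: v)) -scalerDl (addrC z) subrK addrAC.
exact: h.
Qed.

(** For a fixed direction [w] everything happens in the plane spanned by the segment and [w], where
    zeros spread first around [x] and then along lines parallel to the segment. *)
Lemma germ0_segment A d x y : plane_open A -> GH A d -> segment x y `<=` A ->
  germ0 d x -> germ0 d y.
Proof.
move=> pA hd sA dx w.
pose v := y - x.
have sgA z : sg 0 1 z -> A (x + z *: v).
  move=> [t t01 ->]; rewrite add0r subr0 mulr1; apply: sA; exists t; split => //.
  by rewrite rmorphB rmorph1 scalerBl scale1r /v scalerBr -!addrA; congr (_ + _); rewrite addrC.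
have Ax : A x by have := sgA 0 (sg_l _ _); rewrite scale0r addr0.
have [r r0 hr] := pA x v w Ax.
(* first on a bidisc around x, by the identity theorem on the lines through x *)
have loc (l m : C) : nm l < r -> nm m < r -> d (x + l *: v + m *: w) = 0.
  move=> lr mr.
  have [r' r'0 h0] := dx (l *: v + m *: w).
  have lin z : z *: (l *: v + m *: w) = (z * l) *: v + (z * m) *: w by rewrite scalerDr !scalerA.
  have sub z : sg 0 1 z -> A (x + z *: (l *: v + m *: w)).
    move=> [t /andP[t0 t1] ->]; rewrite add0r subr0 mulr1 lin addrA; apply: hr.
      by rewrite nmM nmR ger0_norm//; apply: le_lt_trans lr; rewrite ler_piMl ?nm_ge0.
    by rewrite nmM nmR ger0_norm//; apply: le_lt_trans mr; rewrite ler_piMl ?nm_ge0.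
  have [|e e0 he] := @identity_thm _ (sg 0 1) (fun z : C => d (x + z *: (l *: v + m *: w))) 0 1
    (sg_cconv 0 1) (fun z hz => slice_holo pA hd (sub z hz)) (sg_l _ _) (sg_r _ _).
    by exists r' => // z; rewrite subr0; exact: h0.
  by have := he 1; rewrite subrr nm0 scale1r addrA => /(_ e0).
(* Then along the segment displaced by [m *: w], which the tube keeps in [A] and whose starting part
   lies in the bidisc. *)
have [r' r'0 hr'] := @segment_tube A x v w 0 1 pA sgA.
exists (Num.min r r'); first by rewrite lt_min r0.
move=> m; rewrite lt_min => /andP[mr mr'].
have [|e e0 he] := @identity_thm _ (sg 0 1) (fun z : C => d (x + m *: w + z *: v)) 0 1
    (sg_cconv 0 1) (fun z hz => slice_holo pA hd (hr' m z mr' hz)) (sg_l _ _) (sg_r _ _).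
  by exists r => // z; rewrite subr0 => zr; rewrite addrAC; exact: loc.
have := he 1; rewrite subrr nm0 scale1r => /(_ e0).
by rewrite /v addrAC addrCA subrr addr0 addrC.
Qed.

Lemma germ0_polygon A d x y : plane_open A -> GH A d -> polygonally_connected A ->
  A x -> A y -> germ0 d x -> germ0 d y.
Proof.
move=> pA hd cA Ax Ay dx; have [n [xs [x0 [xn hs]]]] := cA x y Ax Ay.
rewrite -xn; have : (n <= n)%N by [].
elim: {1 3}n => [|i IH] ni; first by rewrite x0.
by apply: (germ0_segment pA hd (hs i ni)); exact/IH/ltnW.
Qed.

(** On a slice the difference vanishes off the compact slice of [K], so extended by 0 it is entire.
    It is 0 far out, hence 0 at the origin by the identity theorem. *)
Lemma GH_unique Omega K u g h : plane_open Omega ->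
  (forall a, Omega a -> ccompact [set z | K (a + z *: u)]) ->
  K `<=` Omega ->
  GH Omega g -> GH Omega h -> (forall x, (Omega `\` K) x -> g x = h x) ->
  forall x, Omega x -> g x = h x.
Proof.
move=> pO cK KO hg hh e a Oa.
pose D (z : C) := g (a + z *: u) - h (a + z *: u).
pose E (z : C) := if pselect (Omega (a + z *: u)) then D z else 0.
have E0 z : ~ K (a + z *: u) -> E z = 0.
  move=> nK; rewrite /E; case: pselect => // O; rewrite /D e ?subrr//.
have cS := cK a Oa.
have dE z : cdiff E z.
  have [Oz|nOz] := pselect (Omega (a + z *: u)).
    have [r r0 hr] := slice_open pO Oz.
    apply: (@cdiff_near _ D _ _ r r0); last by apply: (GH_at (GH_sb hg hh)).
    by move=> w /hr Ow; rewrite /E; case: pselect.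
  have [r r0 hr] : exists2 r : R, 0 < r & forall w : C, K (a + w *: u) -> r <= nm (w - z).
    apply: (cS (fun r (w : C) => r <= nm (w - z))).
      by move=> r r' w _ rr'; exact: le_trans.
    move=> w Kw; have wz : 0 < nm (w - z).
      rewrite nm_gt0 subr_eq0; apply/eqP => wz; apply: nOz; rewrite -wz; exact: KO.
    exists (nm (w - z) / 2); first by rewrite divr_gt0.
    by move=> w' w'w; have := nm_tri w' w z; rewrite (nmBC w w'); lra.
  apply: (@cdiff_near _ (fun=> 0) _ _ r r0); last exact: cdiff_cst.
  by move=> w wr; rewrite E0// => /hr; rewrite leNgt wr.
(* Boundedness follows from [ccompact] by reading the scale [r] as the inverse of a bound. *)
have [M hM] : exists M : R, forall w : C, K (a + w *: u) -> nm w < M.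
  have [||r r0 hr] := cS (fun r (w : C) => nm w * r <= 1).
  - by move=> r r' w r'0 rr'; apply: le_trans; rewrite ler_wpM2l ?nm_ge0.
  - move=> w _; exists (nm w + 2)^-1; first by rewrite invr_gt0; have := nm_ge0 w; lra.
    move=> w' ww'; have w2 : 0 < nm w + 2 by have := nm_ge0 w; lra.
    rewrite ler_pdivrMr// mul1r; have := nm_tri w w' 0; rewrite !subr0.
    have : (nm w + 2)^-1 <= 1 by rewrite invf_le1//; have := nm_ge0 w; lra.
    lra.
  exists (r^-1 + 1) => w /hr; rewrite -ler_pdivlMr// mul1r; lra.
have M0 : 0 <= `|M| by [].
pose p : C := (`|M| + 1)%:C%C.
have [||d d0 hd] := @identity_thm _ (sg p 0) E p 0 (sg_cconv p 0) _ (sg_l _ _) (sg_r _ _).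
- by move=> z _; exists 1.
- exists 1 => // w wp; apply: E0 => /hM; have := nm_tri w p 0; rewrite !subr0 (nmBC p w).
  have -> : nm p = `|M| + 1 by rewrite nmR ger0_norm// addr_ge0.
  by have := ler_norm M; lra.
have := hd 0; rewrite subrr nm0 => /(_ d0).
rewrite /E /D scale0r addr0; case: pselect => // _ /eqP.
by rewrite subr_eq0 => /eqP.
Qed.

End Gateaux.

(** * The extension of scalar functions *)

Section ScalarExtension.
Variable R : realType.
Local Notation C := R[i].
Variable X : lmodType (Cx R).
Variables (Omega K : set X) (u : X).

(* The slices of [K] through [a + l *: v] depend upper semicontinuously on [l] at [0]: the form in
   which condition (i) is used. *)
Definition slice_stable (a v : X) := forall O : set C,
  (forall z, O z -> exists2 r : R, 0 < r & forall w, nm (w - z) < r -> O w) ->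
  (forall z : C, K (a + z *: u) -> O z) ->
  exists2 d : R, 0 < d & forall l z : C, nm l < d -> K (a + l *: v + z *: u) -> O z.

Hypotheses (KO : K `<=` Omega) (pO : plane_open Omega) (pA : plane_open (Omega `\` K)).
Hypothesis cK : forall a, Omega a -> ccompact [set z : C | K (a + z *: u)].
Hypothesis sK : forall a v, Omega a -> slice_stable a v.

Definition sl (A : set X) a : set C := [set z : C | A (a + z *: u)].
(** The cycle has to surround 0, the pole of the integrand, even when [a] is not in [K]. *)
Definition good a n S := adm n S (sl Omega a) (sl K a `|` [set 0]).

Lemma good_off a z : sl Omega a z -> ~ (sl K a `|` [set 0]) z -> (Omega `\` K) (a + z *: u) /\ z != 0.
Proof. by move=> Oz nz; split; [split => // Kz; apply: nz; left|apply/eqP => z0; apply: nz; right]. Qed.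

Lemma good_exists a : Omega a -> exists n S, good a n S.
Proof.
move=> Oa.
(* One use of compactness provides both the distance to the complement of the slice of [Omega] and,
   as an inverse, a bound for the slice of [K]. *)
have [||r r0 hr] := cK Oa (P := fun r z => (forall w, nm (w - z) < r -> sl Omega a w) /\ nm z * r <= 1).
- move=> r r' z r'0 rr' [h1 h2]; split; first by move=> w /lt_le_trans/(_ rr'); exact: h1.
  by apply: le_trans h2; rewrite ler_wpM2l ?nm_ge0.
- move=> z Kz; have [r r0 hr] := slice_open pO (KO Kz).
  have z2 : 0 < nm z + 2 by have := nm_ge0 z; lra.
  exists (Num.min (r / 2) (nm z + 2)^-1); first by rewrite lt_min divr_gt0// invr_gt0.
  move=> w; rewrite lt_min => /andP[w1 w2]; split.
    by move=> w'; rewrite lt_min => /andP[w'1 _]; apply: hr; have := nm_tri w w' z; lra.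
  apply: (@le_trans _ _ (nm w * (nm z + 2)^-1)).
    by rewrite ler_wpM2l ?nm_ge0// ge_min lexx orbT.
  rewrite ler_pdivrMr// mul1r; have := nm_tri z w 0; rewrite !subr0.
  have : (nm z + 2)^-1 <= 1 by rewrite invf_le1//; have := nm_ge0 z; lra.
  lra.
have Oa0 : Omega (a + 0 *: u) by rewrite scale0r addr0.
have [r' r'0 hr'] := slice_open pO Oa0.
apply: (@exists_adm _ _ _ (Num.min r r') r^-1).
- by rewrite lt_min r0.
- by move=> z w [/hr[h _]|->]; rewrite lt_min => /andP[w1 w2]; [exact: h|exact: hr'].
- move=> z [/hr[_]|->]; first by rewrite -ler_pdivlMr// mul1r.
  by rewrite nm0 invr_ge0 ltW.
Qed.

(** The cells stay in [Omega] because they are compact and [Omega] is open in planes. The moved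
    slices of [K] stay among the cells of [S] by [sK], applied to the open set of points all of
    whose cells are in [S]. *)
Lemma good_stable a v n S : Omega a -> good a n S ->
  exists2 d : R, 0 < d & forall l : C, nm l < d -> good (a + l *: v) n S.
Proof.
move=> Oa [uS SU SK].
have [d d0 hd] : exists2 d : R, 0 < d & forall l : C, nm l < d ->
    forall q, q \in S -> cell n q `<=` sl Omega (a + l *: v).
  elim: S uS SU {SK} => [|q S IH] /=; first by exists 1.
  move=> /andP[_ uS] SU; have [|d d0 hd] := IH uS.
    by move=> q' q'S; apply: SU; rewrite inE q'S orbT.
  have [||r r0 hr] := @cell_ccompact R n q (fun r z => forall l : C, nm l < r -> Omega (a + l *: v + z *: u)).
  - by move=> r r' z r'0 rr' h l /lt_le_trans/(_ rr'); exact: h.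
  - move=> z /(SU q (mem_head _ _)) Oz; have [r r0 hr] := pO v u Oz; exists r => // w wz l lr.
    have -> : a + l *: v + w *: u = a + z *: u + l *: v + (w - z) *: u.
      by rewrite [RHS]addrAC -(addrA a (z *: u)) -scalerDl (addrC z) subrK addrAC.
    exact: hr.
  exists (Num.min d r); first by rewrite lt_min d0.
  move=> l; rewrite lt_min => /andP[ld lr] q'; rewrite inE => /orP[/eqP -> z /hr|]; first exact.
  exact: hd.
have [||d' d'0 hd'] := @sK a v Oa [set z | forall q, cell n q z -> q \in S].
- move=> z hz; have [r r0 hr] := cell_local n z; exists r => // w wz q qw.
  by apply: hz; exact: hr qw.
- by move=> z Kz q qz; apply: (SK q z) => //; left.
exists (Num.min d d'); first by rewrite lt_min d0.
move=> l; rewrite lt_min => /andP[ld ld']; split => //; first exact: hd.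
move=> q z qz [Kz|z0]; first exact: (hd' l z).
by apply: (SK q z) => //; right.
Qed.

Definition integrand (f : X -> C) a z : C := f (a + z *: u) * z^-1.

Lemma integrand_diff f a z : GH (Omega `\` K) f -> sl Omega a z -> ~ (sl K a `|` [set 0]) z ->
  cdiff (integrand f a) z.
Proof.
move=> hf Oz nz; have [Az z0] := good_off Oz nz.
by apply: cdiffM; [exact: (GH_at hf)|exact: cdiff_inv].
Qed.

Lemma choice_good : exists c : X -> nat * seq (int * int), forall a, Omega a -> good a (c a).1 (c a).2.
Proof.
have H a : exists c : nat * seq (int * int), Omega a -> good a c.1 c.2.
  have [/good_exists[n [S h]]|nO] := pselect (Omega a); first by exists (n, S).
  by exists (0%N, [::]).
by have [f hf] := choice H; exists f.
Qed.

Definition contour a := (sval (cid choice_good) a).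
Lemma contourP a : Omega a -> good a (contour a).1 (contour a).2.
Proof. by rewrite /contour; case: cid => c /= h; exact: h. Qed.

(** Contours are chosen point by point without any regularity in [a]; [ext_good] shows that the
    value is independent of the choice. *)
Definition ext (f : X -> C) a : C := kappa^-1 * cycleI (contour a).1 (contour a).2 (integrand f a).

Lemma ext_good f a n S : GH (Omega `\` K) f -> Omega a -> good a n S ->
  ext f a = kappa^-1 * cycleI n S (integrand f a).
Proof.
move=> hf Oa gS; congr (_ * _).
apply: (cycleI_indep (contourP Oa) gS) => z; exact: integrand_diff.
Qed.

(** The place where Hartogs' theorem enters: near each point of the edge the integrand is separately
    holomorphic in [l] and [z], hence locally bounded, and bisection of the edge gives one bound for
    all of it. *)
Lemma integrand_bounded f a v (E : set C) p q : GH (Omega `\` K) f -> cconv E -> E p -> E q ->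
  (forall z, E z -> (Omega `\` K) (a + z *: u) /\ z != 0) ->
  exists2 r : R, 0 < r & exists2 M : R, 0 <= M & forall l z : C, nm l <= r -> sg p q z ->
    [/\ (Omega `\` K) (a + l *: v + z *: u), z != 0 & nm (integrand f (a + l *: v) z) <= M].
Proof.
move=> hf cE Ep Eq hA; have [mE _] := cE; move: p q Ep Eq.
pose Q (p' q' : C) := exists2 r : R, 0 < r & exists2 M : R, 0 <= M & forall l z : C, nm l <= r -> sg p' q' z ->
    [/\ (Omega `\` K) (a + l *: v + z *: u), z != 0 & nm (integrand f (a + l *: v) z) <= M].
apply: (@cousin_seg _ E Q) => //.
  move=> x y _ _ [r r0 [M M0 h]] [r' r'0 [M' M'0 h']]; exists (Num.min r r'); first by rewrite lt_min r0.
  exists (M + M'); first exact: addr_ge0.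
  move=> l z; rewrite le_min => /andP[lr lr'] [t /andP[t0 t1] ->]; have [t2|t2] := leP t 2^-1.
    have [//||h1 h2 h3] := h l (x + t%:C%C * (y - x)); last by split => //; lra.
    exists (2 * t); first lra.
    by rewrite /mid rmorphM rmorph_nat; field.
  have [//||h1 h2 h3] := h' l (x + t%:C%C * (y - x)); last by split => //; lra.
  exists (2 * t - 1); first lra.
  by rewrite /mid rmorphB rmorph1 rmorphM rmorph_nat; field.
move=> z /hA[Az z0]; have [r r0 hr] := pA v u Az.
have nz : 0 < nm z by rewrite nm_gt0.
pose r1 := Num.min (r / 2) (nm z / 2).
have r10 : 0 < r1 by rewrite lt_min !divr_gt0.
have r1r : r1 <= r / 2 by rewrite ge_min lexx.
have r1z : r1 <= nm z / 2 by rewrite ge_min lexx orbT.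
have eE (l m : C) : a + l *: v + (z + m) *: u = a + z *: u + l *: v + m *: u.
  by rewrite [RHS]addrAC -(addrA a (z *: u)) -scalerDl addrAC.
have inA (l m : C) : nm l <= r1 -> nm m <= r1 -> (Omega `\` K) (a + l *: v + (z + m) *: u).
  by move=> lr mr; rewrite eE; apply: hr; lra.
have ne (m : C) : nm m <= r1 -> z + m != 0.
  move=> mr; rewrite -nm_gt0; have := nm_ge z m; lra.
pose F (l m : C) := integrand f (a + l *: v) (z + m).
have [l m lr mr|d d0 [M M0 hM]] := @hartogs _ F r1 r10.
  split; rewrite /F /integrand.
    apply: cdiffM; last exact: cdiff_cst.
    have := @GH_at _ _ _ _ (a + (z + m) *: u) v l hf.
    rewrite addrAC => /(_ (inA _ _ lr mr)).
    by apply: (@cdiff_near _ _ _ _ 1) => // w _; rewrite addrAC.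
  apply: cdiffM.
    have := cdiff_affine (h := fun w : C => f (a + l *: v + w *: u)) (a := 1) (b := z) (z := m).
    rewrite mul1r (addrC m z) => /(_ (GH_at hf (inA _ _ lr mr))).
    by apply: (@cdiff_near _ _ _ _ 1) => // w _; rewrite mul1r (addrC w).
  have := cdiff_affine (h := fun w : C => w^-1) (a := 1) (b := z) (z := m).
  rewrite mul1r (addrC m z) => /(_ (cdiff_inv (ne _ mr))).
  by apply: (@cdiff_near _ _ _ _ 1) => // w _; rewrite mul1r (addrC w).
exists (Num.min d r1); first by rewrite lt_min d0.
move=> x y _ _; rewrite lt_min => /andP[xd xr]; rewrite lt_min => /andP[yd yr]; exists (Num.min d r1).
  by rewrite lt_min d0.
exists M => // l m; rewrite le_min => /andP[ld lr] [t /andP[t0 t1] ->].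
set w := x + _.
have [wd wr] : nm (w - z) <= d /\ nm (w - z) <= r1.
  have -> : w - z = (1 - t)%:C%C * (x - z) + t%:C%C * (y - z).
    by rewrite /w rmorphB rmorph1; ring.
  by split; apply: (le_trans (nmD _ _)); rewrite !nmM !nmR !ger0_norm ?subr_ge0//; nra.
have -> : w = z + (w - z) by rewrite addrC subrK.
by split; [exact: inA|exact: ne|exact: hM].
Qed.

Theorem ext_GH f : GH (Omega `\` K) f -> GH Omega (ext f).
Proof.
move=> hf a v Oa; have gS := contourP Oa; move: (contour a).1 (contour a).2 gS => n S gS.
have [d d0 hd] := good_stable v Oa gS.
have [d1 d10 hd1] := plane_line v pO Oa.
have m0 : 0 < Num.min d d1 by rewrite lt_min d0.
(* For small [l] the contour of [a] also serves [a + l *: v], so there [ext] is a finite sum of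
   parameter integrals over fixed edges. *)
apply: (@cdiff_near _ (fun l : C => kappa^-1 * \sum_(e <- cyc R n S) e.1 *
  J (integrand f (a + l *: v)) e.2.1 e.2.2) _ _ _ m0).
  move=> l; rewrite subr0 lt_min => /andP[ld ld1].
  rewrite (ext_good hf (hd1 _ ld1) (hd _ ld)) cycleE//.
  by have [] := gS.
apply: cdiffM; first exact: cdiff_cst.
have -> : (fun l : C => \sum_(e <- cyc R n S) e.1 * J (integrand f (a + l *: v)) e.2.1 e.2.2) =
   (fun l : C => \sum_(e <- cyc R n S | e \in cyc R n S) e.1 * J (integrand f (a + l *: v)) e.2.1 e.2.2).
  by apply/funext => l; rewrite big_seq.
apply: cdiff_sum => e eS; apply: cdiffM; first exact: cdiff_cst.
have [E [cE E1 E2 hE]] := cyc_edge gS eS.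
have hE' z : E z -> (Omega `\` K) (a + z *: u) /\ z != 0.
  by move=> /hE[Oz nz]; exact: good_off.
have [r r0 [M M0 hM]] := integrand_bounded v hf cE E1 E2 hE'.
apply: (@param_integral _ (fun l : C => integrand f (a + l *: v)) (sg e.2.1 e.2.2) _ _ r M) => //.
- exact: sg_mid.
- exact: sg_l.
- exact: sg_r.
- move=> l z lr sz; have [Az z0 bM] := hM l z lr sz; split => //.
  apply: cdiffM; last exact: cdiff_cst.
  have := @GH_at _ _ _ _ (a + z *: u) v l hf.
  rewrite addrAC => /(_ Az); apply: (@cdiff_near _ _ _ _ 1) => // w _.
  by rewrite addrAC.
- move=> l lr; apply: (intg_diff (sg_cconv e.2.1 e.2.2)); [|exact: sg_l|exact: sg_r].
  move=> z sz; have [Az z0 _] := hM l z lr sz.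
  by apply: cdiffM; [exact: (GH_at hf)|exact: cdiff_inv].
- by rewrite nm0 divr_ge0// ltW.
Qed.

Lemma ext_free f a : GH (Omega `\` K) f -> Omega a -> (forall z : C, ~ K (a + z *: u)) ->
  ext f a = f a.
Proof.
move=> hf Oa nK; have gS := contourP Oa.
have Oa0 : Omega (a + 0 *: u) by rewrite scale0r addr0.
have [r r0 hr] := slice_open pO Oa0.
rewrite /ext /integrand (cycleI_center (F := fun z : C => f (a + z *: u)) gS).
- by rewrite scale0r addr0 mulrA mulVf ?kappa_neq0// mul1r.
- by right.
- by exists (r / 2); [rewrite divr_gt0|move=> w wr; apply: hr; rewrite subr0; lra].
- by move=> w Ow; apply: (GH_at hf); split => //; exact: nK.
Qed.

Hypothesis polyA : polygonally_connected (Omega `\` K).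
Variable c : X.
Hypotheses (Oc : Omega c) (cfree : forall z : C, ~ K (c + z *: u)).

Theorem ext_agree f x : GH (Omega `\` K) f -> (Omega `\` K) x -> ext f x = f x.
Proof.
move=> hf Ax; apply/eqP; rewrite -subr_eq0; apply/eqP.
pose d x := ext f x - f x.
have hd : GH (Omega `\` K) d.
  by apply: GH_sb => //; apply: GH_sub (ext_GH hf) => y [].
have Ac : (Omega `\` K) c by split => //; have := @cfree 0; rewrite scale0r addr0.
apply: (germ0_at (f := d)); apply: (germ0_polygon pA hd polyA Ac Ax) => w.
(* Stability with the empty open set: lines close to the one through [c] miss [K] as well, so
   [ext_free] applies to them. *)
have [||r r0 hr] := sK w Oc (O := set0); [by move=> z []|by move=> z /cfree|].
have [r' r'0 hr'] := plane_line w pO Oc.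
exists (Num.min r r'); first by rewrite lt_min r0.
move=> l; rewrite lt_min => /andP[lr lr']; rewrite /d ext_free ?subrr//; first exact: hr'.
by move=> z Kz; exact: (hr l z lr Kz).
Qed.

Lemma sg_near (x y z w : C) (r : R) : nm (x - z) < r -> nm (y - z) < r -> sg x y w -> nm (w - z) < r.
Proof.
move=> xz yz [t /andP[t0 t1] ->].
have -> : x + t%:C%C * (y - x) - z = (1 - t)%:C%C * (x - z) + t%:C%C * (y - z).
  by rewrite rmorphB rmorph1; ring.
apply: (le_lt_trans (nmD _ _)); rewrite !nmM !nmR !ger0_norm ?subr_ge0//.
set x' := nm (x - z) in xz *; set y' := nm (y - z) in yz *.
have xm : x' <= Num.max x' y' by rewrite le_max lexx.
have ym : y' <= Num.max x' y' by rewrite le_max lexx orbT.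
apply: (@le_lt_trans _ _ (Num.max x' y')); last by rewrite gt_max xz.
by nra.
Qed.

(** If [z] were on the segment but not in [E], bisection would refute it: a subsegment close to a
    point [w] of [E] stays closer to [w] than [z] is. *)
Lemma sg_sub (E : set C) (p q : C) : cconv E -> E p -> E q -> sg p q `<=` E.
Proof.
move=> cE Ep Eq z zpq; apply: contrapT => nEz; move: zpq; move: p q Ep Eq.
apply: (@cousin_seg _ E (fun x y => sg x y z -> False)) => //.
  move=> x y _ _ h h' [t t01 e]; have [t2|t2] := leP t 2^-1.
    apply: h; exists (2 * t); first lra.
    by rewrite e /mid rmorphM rmorph_nat; field.
  apply: h'; exists (2 * t - 1); first lra.
  by rewrite e /mid rmorphB rmorph1 rmorphM rmorph_nat; field.
move=> w Ew; have wz : 0 < nm (z - w).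
  by rewrite nm_gt0 subr_eq0; apply/eqP => e; apply: nEz; rewrite e.
exists (nm (z - w)) => // x y _ _ xw yw /(sg_near xw yw); by rewrite ltxx.
Qed.

Lemma cyc_bounded (h : C -> C) (G : seq (C * (C * C))) :
  (forall e, e \in G -> exists E : set C, [/\ cconv E, E e.2.1, E e.2.2 & forall z, E z -> ccont h z]) ->
  exists2 D : R, 0 <= D & forall e z, e \in G -> sg e.2.1 e.2.2 z -> nm (h z) <= D.
Proof.
elim: G => [|e G IH] hG; first by exists 0.
have [|D D0 hD] := IH; first by move=> e' e'G; apply: hG; rewrite inE e'G orbT.
have [E [cE E1 E2 hc]] := hG e (mem_head _ _).
have [M M0 hM] := seg_bounded cE hc E1 E2.
exists (D + M); first exact: addr_ge0.
move=> e' z; rewrite inE => /orP[/eqP ->|e'G] sz.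
  by apply: (le_trans (hM _ sz)); rewrite lerDr.
by apply: (le_trans (hD _ _ e'G sz)); rewrite lerDl.
Qed.

Definition gamma a := cyc R (contour a).1 (contour a).2.

Lemma gamma_edge a e : Omega a -> e \in gamma a -> exists E : set C,
  [/\ cconv E, E e.2.1, E e.2.2 & forall z, E z -> (Omega `\` K) (a + z *: u) /\ z != 0].
Proof.
move=> Oa eG; have [E [cE E1 E2 hE]] := cyc_edge (contourP Oa) eG.
by exists E; split => // z /hE[Oz nz]; exact: good_off.
Qed.

Lemma gamma_sg a e z : Omega a -> e \in gamma a -> sg e.2.1 e.2.2 z ->
  (Omega `\` K) (a + z *: u) /\ z != 0.
Proof. by move=> Oa /(gamma_edge Oa)[E [cE E1 E2 hE]] /(sg_sub cE E1 E2)/hE. Qed.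

Lemma extE f a : Omega a ->
  ext f a = kappa^-1 * \sum_(e <- gamma a) e.1 * J (integrand f a) e.2.1 e.2.2.
Proof. by move=> Oa; rewrite /ext cycleE//; have [] := contourP Oa. Qed.

Lemma gamma_center g a : GH Omega g -> Omega a ->
  g a = kappa^-1 * \sum_(e <- gamma a) e.1 * J (integrand g a) e.2.1 e.2.2.
Proof.
move=> hg Oa; rewrite -extE//; have gS := contourP Oa.
have Oa0 : Omega (a + 0 *: u) by rewrite scale0r addr0.
have [r r0 hr] := slice_open pO Oa0.
rewrite /ext /integrand (cycleI_center (F := fun z : C => g (a + z *: u)) gS).
- by rewrite scale0r addr0 mulrA mulVf ?kappa_neq0// mul1r.
- by right.
- by exists (r / 2); [rewrite divr_gt0|move=> w wr; apply: hr; rewrite subr0; lra].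
- by move=> w Ow; exact: (GH_at hg).
Qed.

(** Cauchy's formula over the contour gives this bound up to a constant depending on [a]; applied to
    the powers of [g] the constant disappears by [landau_trick]. *)
Lemma contour_max g a B : GH Omega g -> Omega a -> 0 <= B ->
  (forall e z, e \in gamma a -> sg e.2.1 e.2.2 z -> nm (g (a + z *: u)) <= B) -> nm (g a) <= B.
Proof.
move=> hg Oa B0 hB.
have [|D D0 hD] := @cyc_bounded (fun z => z^-1) (gamma a).
  move=> e /(gamma_edge Oa)[E [cE E1 E2 hE]]; exists E; split => // z /hE[_ z0].
  by apply: cdiff_cont; exact: cdiff_inv.
pose cc := nm (kappa^-1 : C) * \sum_(e <- gamma a) nm e.1 * (nm (e.2.2 - e.2.1) * D).
apply: (@landau_trick _ _ _ cc (nm_ge0 _) B0) => m.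
have hgm : GH Omega (fun x => g x ^+ m) by move=> x v Ox; apply: cdiffX; exact: hg.
rewrite -nmX (gamma_center hgm Oa) nmM /cc -mulrA ler_wpM2l ?nm_ge0//.
apply: (le_trans (nm_sum _ _ _)); rewrite mulr_suml big_seq [leRHS]big_seq.
apply: ler_sum => e eG; rewrite nmM -!mulrA ler_wpM2l ?nm_ge0//.
apply: (@J_bound _ (sg e.2.1 e.2.2)).
- by rewrite mulr_ge0// exprn_ge0.
- exact: sg_mid.
- move=> z sz; rewrite nmM nmX mulrC; apply: ler_pM; rewrite ?nm_ge0 ?exprn_ge0 ?nm_ge0//.
    exact: hD sz.
  by apply: lerXn2r; rewrite ?nnegrE ?nm_ge0//; exact: hB sz.
- exact: sg_l.
- exact: sg_r.
Qed.

End ScalarExtension.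

(** * Duality in locally convex spaces *)

Section HahnBanach.
Variable R : realType.
Local Notation C := R[i].
Variable Y : lmodType (Cx R).
Local Notation "r %:S" := (r%:C%C : Cx R) (at level 2, format "r %:S").
Implicit Types (x y : Y) (r s t : R).

Definition sublinear (q : Y -> R) :=
  (forall x y, q (x + y) <= q x + q y) /\
  (forall t x, 0 < t -> q (t%:S *: x) = t * q x).

Lemma scaleS1 x : 1%:S *: x = x.
Proof. by rewrite rmorph1 scale1r. Qed.

Lemma scaleSS r s x : r%:S *: (s%:S *: x) = (r * s)%:S *: x.
Proof. by rewrite scalerA rmorphM. Qed.

Lemma scaleSD r s x : (r + s)%:S *: x = r%:S *: x + s%:S *: x.
Proof. by rewrite rmorphD scalerDl. Qed.

Lemma scaleSN r x : (- r)%:S *: x = - (r%:S *: x).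
Proof. by rewrite rmorphN scaleNr. Qed.

Lemma scaleS0 x : 0%:S *: x = 0.
Proof. by rewrite rmorph0 scale0r. Qed.

Variable q : Y -> R.
Hypothesis qs : sublinear q.

Lemma sublinear0 : q 0 = 0.
Proof.
have := qs.2 2 0 ltac:(by []); rewrite scaler0; lra.
Qed.

Lemma sublinearN x : - q (- x) <= q x.
Proof. by have := qs.1 x (- x); rewrite subrr sublinear0; lra. Qed.

(** Partial real-linear functionals as graphs. Being single-valued need not be required, since two
    values over one point differ by at most [q 0 = 0]. *)
Let dominated (G : set (Y * R)) :=
  (forall p, G p -> p.2 <= q p.1) /\
  (forall p p' r, G p -> G p' -> G (p.1 + r%:S *: p'.1, p.2 + r * p'.2)).

Let dominated0 G p : dominated G -> G p -> G (0, 0).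
Proof.
move=> [_ /(_ p p (-1))] h Gp; have := h Gp Gp.
by rewrite scaleSN scaleS1 subrr mulN1r subrr.
Qed.

(** The value at [x1] must lie above all numbers in [S] and below all [q (p.1 + x1) - p.2];
    sublinearity makes these bounds compatible, and [c] is the least admissible value. *)
Let extend G x1 : dominated G -> G !=set0 -> (forall a, ~ G (x1, a)) ->
  exists2 G', G `<` G' & dominated G'.
Proof.
move=> dG [p0 Gp0] x1G; have G0 := dominated0 dG Gp0; have [Gq Gl] := dG.
have GD p p' : G p -> G p' -> G (p.1 + p'.1, p.2 + p'.2).
  by move=> Gp Gp'; have := Gl p p' 1 Gp Gp'; rewrite scaleS1 mul1r.
have GZ t p : G p -> G (t%:S *: p.1, t * p.2).
  by move=> Gp; have := Gl (0, 0) p t G0 Gp; rewrite /= !add0r.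
pose S := [set s : R | exists2 p, G p & s = p.2 - q (p.1 - x1)].
have ub p' : G p' -> ubound S (q (p'.1 + x1) - p'.2).
  move=> Gp' _ [p Gp ->]; have := Gq _ (GD _ _ Gp Gp') => /=.
  have := qs.1 (p.1 - x1) (p'.1 + x1).
  by rewrite addrACA addNr addr0; lra.
pose c := sup S.
have S0 : S !=set0 by exists (0 - q (0 - x1)), (0, 0).
have cl p : G p -> p.2 - q (p.1 - x1) <= c.
  by move=> Gp; apply: sup_upper_bound; [split=> //; eexists; exact: ub G0|exists p].
have cu p : G p -> c <= q (p.1 + x1) - p.2 by move=> Gp; apply: ge_sup (ub _ Gp).
exists [set p | exists2 p', G p' & exists r, p = (p'.1 + r%:S *: x1, p'.2 + r * c)].
  split.
    by move=> [x a] Gp; exists (x, a) => //; exists 0; rewrite scaleS0 mul0r !addr0.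
  by move=> H; apply: (x1G c); apply: H => /=; exists (0, 0) => //; exists 1;
      rewrite scaleS1 mul1r !add0r.
split.
  move=> _ [p Gp [r ->]] /=; have [r0|r0|->] := ltgtP r 0; last first.
  - by rewrite scaleS0 mul0r !addr0; exact: Gq.
  - have := cu _ (GZ r^-1 _ Gp) => /=.
    have -> : q (p.1 + r%:S *: x1) = r * q (r^-1%:S *: p.1 + x1).
      by rewrite -qs.2// scalerDr scaleSS divff ?gt_eqF// scaleS1.
    rewrite -(ler_pM2l r0) mulrBr (mulrA r) divff ?gt_eqF// mul1r; lra.
  - have n0 : 0 < - r by rewrite oppr_gt0.
    have := cl _ (GZ (- r)^-1 _ Gp) => /=.
    have -> : q (p.1 + r%:S *: x1) = (- r) * q ((- r)^-1%:S *: p.1 - x1).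
      by rewrite -qs.2// scalerBr scaleSS divff ?gt_eqF// scaleS1 scaleSN opprK.
    rewrite -(ler_pM2l n0) mulrBr (mulrA (- r)) divff ?gt_eqF// mul1r; lra.
move=> _ _ r [p Gp [s ->]] [p' Gp' [s' ->]] /=.
exists (p.1 + r%:S *: p'.1, p.2 + r * p'.2); first exact: Gl.
exists (s + r * s') => /=; congr (_, _); last by ring.
by rewrite scalerDr scaleSS scaleSD addrACA.
Qed.

Lemma hahn_banach y0 : exists psi : Y -> R,
  [/\ forall r x y, psi (r%:S *: x + y) = r * psi x + psi y,
      forall x, psi x <= q x & psi y0 = q y0].
Proof.
(* The condition at [y0] is imposed on nonempty graphs only, since the union of an empty chain is
   empty. *)
have [F|A [[dA A1] Amax]] := @Zorn_bigcup (Y * R)%type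
    (fun G => dominated G /\ (G !=set0 -> G (y0, q y0))).
  move=> FP Fc; split; [split|].
  - by move=> p [G /FP[[Gq _] _]]; exact: Gq.
  - move=> p p' r [G FG Gp] [G' FG' Gp'].
    have [GG|GG] := Fc _ _ FG FG'.
      by exists G' => //; apply: ((FP _ FG').1).2 => //; exact: GG.
    by exists G => //; apply: ((FP _ FG).1).2 => //; exact: GG.
  - by move=> [p [G FG Gp]]; exists G => //; apply: (FP _ FG).2; exists p.
have A0 : A !=set0.
  apply: contrapT => nA.
  pose L := [set p : Y * R | exists r, p = (r%:S *: y0, r * q y0)].
  have Ly : L (y0, q y0) by exists 1; rewrite scaleS1 mul1r.
  apply: (Amax L).
    by split; [move=> p Ap; case: nA; exists p|move=> H; apply: nA; exists (y0, q y0); exact: H].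
  split => //; split.
    move=> _ [r ->] /=; have [r0|r0|->] := ltgtP r 0; last first.
    - by rewrite scaleS0 mul0r sublinear0.
    - by rewrite qs.2.
    - have n0 : 0 < - r by rewrite oppr_gt0.
      have := sublinearN (r%:S *: y0); rewrite -scaleSN qs.2//; lra.
  move=> _ _ r [s ->] [s' ->]; exists (s + r * s') => /=; congr (_, _); last by ring.
  by rewrite scaleSS scaleSD.
have tot x : exists a, A (x, a).
  apply: contrapT => nx.
  have [G' AG' dG'] := extend dA A0 (fun a Aa => nx (ex_intro _ a Aa)).
  apply: (Amax _ AG'); split => // _; apply: AG'.1; exact: A1.
have [psi hpsi] := choice tot.
have Al := dA.2; have G0 : A (0, 0) by case: A0 => p /(dominated0 dA).
have le x a b : A (x, a) -> A (x, b) -> a <= b.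
  move=> Aa Ab; have := dA.1 _ (Al _ _ (-1) Aa Ab).
  by rewrite /= scaleSN scaleS1 subrr sublinear0; lra.
have uniq x a b : A (x, a) -> A (x, b) -> a = b.
  by move=> Aa Ab; apply/le_anti/andP; split; [exact: le Ab|exact: le Aa].
exists psi; split.
- move=> r x y; apply: uniq (hpsi _) _.
  by rewrite addrC [_ + psi y]addrC; exact: (Al (y, psi y) (x, psi x)).
- by move=> x; exact: (dA.1 (x, psi x)).
- by apply: uniq (hpsi _) (A1 A0).
Qed.

End HahnBanach.

(** * Gauges and continuous functionals *)

Section Gauge.
Variable R : realType.
Local Notation C := R[i].
Variable Y : tvsType (Cx R).
Local Notation "r %:S" := (r%:C%C : Cx R) (at level 2, format "r %:S").
Implicit Types (x y : Y) (r s t : R) (N W : set Y).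

Lemma nbhs0_scale c N : nbhs (0 : Y) N -> nbhs (0 : Y) [set y | N (c *: y)].
Proof.
move=> N0; have /= := @scale_continuous _ Y (c, 0) N.
rewrite scaler0 => /(_ N0)[[A B] /= [A0 B0] h]; apply: filterS B0 => y By.
by apply: (h (c, y)); split => //; exact: nbhs_singleton A0.
Qed.

Lemma nbhs0_absorb N y : nbhs (0 : Y) N ->
  exists2 d : R, 0 < d & forall c : C, nm c < d -> N (c *: y).
Proof.
move=> N0; have /= := @scale_continuous _ Y (0, y) N.
rewrite scale0r => /(_ N0)[[A B] /= [/nbhs_nmP[d d0 hA] B0] h]; exists d => // c cd.
apply: (h (c, y)); split; last exact: nbhs_singleton B0.
by apply: hA; rewrite subr0.
Qed.

Lemma nbhs_shift0 x N : nbhs x N -> nbhs (0 : Y) [set y | N (x + y)].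
Proof.
move=> Nx; have /= := @add_continuous Y (x, 0) N.
rewrite addr0 => /(_ Nx)[[A B] /= [A0 B0] h]; apply: filterS B0 => y By.
by apply: (h (x, y)); split => //; exact: nbhs_singleton A0.
Qed.

Lemma nbhs_0shift x N : nbhs (0 : Y) N -> nbhs x [set y | N (y - x)].
Proof.
move=> N0; have /= := @add_continuous Y (x, - x) N.
rewrite subrr => /(_ N0)[[A B] /= [A0 B0] h]; apply: filterS A0 => y Ay.
by apply: (h (y, - x)); split => //; exact: nbhs_singleton B0.
Qed.

Definition cvx W := forall x y t, 0 <= t -> t <= 1 -> W x -> W y ->
  W ((1 - t)%:S *: x + t%:S *: y).

Lemma convex_set_cvx W : convex_set (W : set (convex_lmodType Y)) -> cvx W.
Proof.
move=> cW x y t t0 t1 Wx Wy.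
have t0' : 0 <= 1 - t by lra.
have t1' : 1 - t <= 1 by lra.
have s0 : (0 : C) <= (1 - t)%:C%C by rewrite -(rmorph0 (real_complex R)) lecR.
have s1 : (1 - t)%:C%C <= (1 : C) by rewrite -(rmorph1 (real_complex R)) lecR.
have := cW x y (Itv01 s0 s1) (mem_set Wx) (mem_set Wy) => /set_mem.
rewrite /conv /= /unstable.onem.
by have -> : 1 - (1 - t)%:C%C = t%:C%C :> C by rewrite rmorphB rmorph1 opprB addrC subrK.
Qed.

Lemma cvxI (I : Type) (F : I -> set Y) : (forall i, cvx (F i)) -> cvx [set y | forall i, F i y].
Proof. by move=> h x y t t0 t1 hx hy i; exact: h. Qed.

Lemma cvx_scale c W : cvx W -> cvx [set y | W (c *: y)].
Proof.
move=> h x y t t0 t1 hx hy /=.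
by rewrite scalerDr !scalerA ![c * _]mulrC -!scalerA; exact: h.
Qed.

(** Invariance under ['i] replaces balancedness: it gives [- W] inside [W] and makes the gauge
    invariant under ['i], so that complex moduli are controlled up to a factor 2. *)
Definition tame W := [/\ nbhs (0 : Y) W, cvx W & forall y, W y -> W (('i%C : Cx R) *: y)].

Lemma tame_nbhs N : nbhs (0 : Y) N -> exists2 W, tame W & W `<=` N.
Proof.
move=> N0; have [B Bc [Bo Bb]] := @locally_convex _ Y.
have [W0 [/= BW W00] WN] := Bb 0 N N0.
have cW := convex_set_cvx (Bc _ (mem_set BW)).
have nW : nbhs (0 : Y) W0 by apply: open_nbhs_nbhs; split => //; exact: Bo.
exists [set y | forall k : 'I_4, W0 ((('i%C : Cx R) ^+ k) *: y)].
  split.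
  - apply: filter_forall => k; exact: nbhs0_scale.
  - by apply: cvxI => k; exact: cvx_scale.
  - move=> y h k /=; rewrite scalerA -exprSr.
    case: k => -[|[|[|[|//]]]] /= _.
    + exact: (h (Ordinal (isT : (1 < 4)%N))).
    + exact: (h (Ordinal (isT : (2 < 4)%N))).
    + exact: (h (Ordinal (isT : (3 < 4)%N))).
    + have := h ord0 => /=; suff -> : ('i%C : Cx R) ^+ 4 = 1 by rewrite expr0.
      by rewrite (exprM _ 2 2) sqr_i sqrrN expr1n.
by move=> y /(_ ord0); rewrite expr0 scale1r; exact: WN.
Qed.
End Gauge.

Section Dual.
Variable R : realType.
Local Notation C := R[i].
Variable Y : tvsType (Cx R).
Local Notation "r %:S" := (r%:C%C : Cx R) (at level 2, format "r %:S").
Implicit Types (x y : Y) (r s t : R) (N W : set Y) (phi : Y -> Cx R).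

Definition gauge W y : R := inf [set t : R | 0 < t /\ W (t^-1%:S *: y)].

Section GaugeTheory.
Variable W : set Y.
Hypotheses (cW : cvx W) (nW : nbhs (0 : Y) W).

Let W_lb y : has_lbound [set t : R | 0 < t /\ W (t^-1%:S *: y)].
Proof. by exists 0 => t [/ltW]. Qed.

Let W_ex y : [set t : R | 0 < t /\ W (t^-1%:S *: y)] !=set0.
Proof.
have [d d0 h] := nbhs0_absorb y nW; exists (d / 2)^-1; split; first by rewrite invr_gt0 divr_gt0.
by rewrite invrK; apply: h; rewrite nmR ger0_norm; lra.
Qed.

Lemma gauge_le y t : 0 < t -> W (t^-1%:S *: y) -> gauge W y <= t.
Proof. by move=> t0 h; apply: ge_inf. Qed.

Lemma gauge_ge0 y : 0 <= gauge W y.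
Proof. by apply: lb_le_inf => // t [/ltW]. Qed.

Lemma gauge_lt y t : gauge W y < t -> W (t^-1%:S *: y).
Proof.
move=> /(inf_lt (W_ex y))[s [s0 Ws] st].
have t0 : 0 < t by lra.
have p0 : 0 <= s / t by rewrite divr_ge0// ltW.
have p1 : s / t <= 1 by rewrite ler_pdivrMr// mul1r ltW.
have := cW p0 p1 (nbhs_singleton nW) Ws.
by rewrite scaler0 add0r scaleSS mulrAC divff ?gt_eqF// mul1r.
Qed.

Lemma gauge_le1 y : W y -> gauge W y <= 1.
Proof. by move=> Wy; apply: gauge_le => //; rewrite invr1 scaleS1. Qed.

Lemma gauge_sublinear : sublinear (gauge W).
Proof.
split.
  move=> x y; apply/ler_addgt0Pl => e e0.
  have e2 : 0 < e / 2 by rewrite divr_gt0.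
  have := @gauge_lt x (gauge W x + e / 2) ltac:(lra).
  have := @gauge_lt y (gauge W y + e / 2) ltac:(lra).
  have gx := gauge_ge0 x; have gy := gauge_ge0 y.
  set s := gauge W x + _; set t := gauge W y + _ => Wy Wx.
  have s0 : 0 < s by rewrite /s; lra.
  have t0 : 0 < t by rewrite /t; lra.
  have st0 : 0 < s + t by lra.
  have -> : e + (gauge W x + gauge W y) = s + t by rewrite /s /t; lra.
  apply: gauge_le => //.
  have p0 : 0 <= t / (s + t) by rewrite divr_ge0// ltW.
  have p1 : t / (s + t) <= 1 by rewrite ler_pdivrMr// mul1r; lra.
  have := cW p0 p1 Wx Wy; rewrite !scaleSS scalerDr; congr (W (_ *: _ + _ *: _)); congr (_ %:S).
    by field; rewrite !gt_eqF.
  by field; rewrite !gt_eqF.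
have aux t x : 0 < t -> gauge W (t%:S *: x) <= t * gauge W x.
  move=> t0; rewrite mulrC -ler_pdivrMr//; apply: lb_le_inf => // s [s0 Ws].
  rewrite ler_pdivrMr//; apply: gauge_le; first by rewrite mulr_gt0.
  by rewrite invfM scaleSS mulfVK ?gt_eqF.
move=> t x t0; apply/le_anti; rewrite aux//= mulrC -ler_pdivlMr// mulrC.
by have := aux t^-1 (t%:S *: x); rewrite invr_gt0 scaleSS mulVf ?gt_eqF// scaleS1; exact.
Qed.

End GaugeTheory.

Lemma dual_bounded phi N B :
  (forall c x y, phi (c *: x + y) = c * phi x + phi y) ->
  nbhs (0 : Y) N -> (forall y, N y -> nm (phi y) <= B) -> dual_elt phi.
Proof.
move=> lin N0 NB; split => // x A /nbhs_nmP[r r0 hA].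
have B0 : 0 <= B by apply: le_trans (NB _ (nbhs_singleton N0)); exact: nm_ge0.
have c0 : 0 < (B + 1) / r by rewrite divr_gt0// ltr_wpDl.
apply: filterS (nbhs_0shift x (nbhs0_scale ((B + 1) / r)%:S N0)) => y /= /NB h.
apply: hA; have lin0 : phi 0 = 0.
  have := lin 1 0 0; rewrite scaler0 add0r mul1r => /(congr1 (fun z => z - phi 0)).
  by rewrite subrr addrK => <-.
have -> : phi y - phi x = phi (y - x).
  by rewrite addrC -mulN1r -lin scaleN1r addrC.
move: h; rewrite -[_ *: _]addr0 lin lin0 addr0 nmM nmR gtr0_norm// => h.
rewrite -(ltr_pM2l c0); apply: (le_lt_trans h).
by rewrite divfK ?gt_eqF//; lra.
Qed.

Lemma dual_dominated (q : Y -> R) N y0 : sublinear q -> nbhs (0 : Y) N ->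
  (forall y, N y -> q y <= 1) ->
  exists phi, [/\ dual_elt phi, forall x, Re (phi x) <= q x,
    forall x, Im (phi x) = - Re (phi (('i%C : Cx R) *: x)) & Re (phi y0) = q y0].
Proof.
move=> qs N0 Nq; have [psi [plin pq py]] := hahn_banach qs y0.
(* The complex-linear functional whose real part is the real-linear [psi]. *)
pose phi y : C := (psi y +i* - psi (('i%C : Cx R) *: y))%C.
have pD x y : psi (x + y) = psi x + psi y by rewrite -[x in LHS]scaleS1 plin mul1r.
have p0 : psi 0 = 0 by have := pD 0 0; rewrite addr0; lra.
have pZ r x : psi (r%:S *: x) = r * psi x by rewrite -[_ *: _]addr0 plin p0 addr0.
have pN x : psi (- x) = - psi x by rewrite -scaleN1r -(rmorphN1 (real_complex R)) pZ mulN1r.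
have [W [W0 cW iW] WN] := tame_nbhs N0.
have Wb y : W y -> `|psi y| <= 1.
  move=> Wy; rewrite ler_norml; have := pq (- y); rewrite pN.
  have : q (- y) <= 1.
    apply: Nq; apply: WN; have := iW _ (iW _ Wy).
    by rewrite scalerA -expr2 sqr_i scaleN1r.
  by have := pq y; have := Nq _ (WN _ Wy); lra.
exists phi; split => //.
apply: (@dual_bounded _ W 2) => //; last first.
  move=> y Wy; apply: (le_trans (nm_ReIm _)) => /=; rewrite normrN.
  by have := Wb _ Wy; have := Wb _ (iW _ Wy); lra.
move=> [a b] x y; rewrite /phi.
have -> : (a +i* b)%C *: x = a%:S *: x + b%:S *: (('i%C : Cx R) *: x).
  rewrite scalerA -scalerDl; congr (_ *: _); by simpc.
have ii z : ('i%C : Cx R) *: (('i%C : Cx R) *: z) = - z by rewrite scalerA -expr2 sqr_i scaleN1r.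
have sC (c c' : Cx R) z : c *: (c' *: z) = c' *: (c *: z) by rewrite !scalerA mulrC.
rewrite !scalerDr ![('i%C : Cx R) *: (_%:S *: _)]sC ii.
rewrite !pD !pZ pN.
by apply/eqP; rewrite eq_complex /=; apply/andP; split; apply/eqP; ring.
Qed.

End Dual.

Section Separation.
Variable R : realType.
Local Notation C := R[i].
Variable Y : tvsType (Cx R).
Local Notation "r %:S" := (r%:C%C : Cx R) (at level 2, format "r %:S").
Implicit Types (x y : Y) (r s t : R) (N W : set Y) (phi : Y -> Cx R).

Lemma dual_separates y : hausdorff_space Y -> y != 0 ->
  exists2 phi, dual_elt phi & phi y != 0.
Proof.
move=> hY y0.
have [N N0 Ny] : exists2 N, nbhs (0 : Y) N & ~ N y.
  apply: contrapT => H; case/eqP: y0; apply: hY => A B Ay B0.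
  exists y; split; first exact: nbhs_singleton.
  by apply: contrapT => By; apply: H; exists B.
have [W [W0 cW _] WN] := tame_nbhs N0.
have [phi [dphi _ _ phiy]] := dual_dominated y (gauge_sublinear cW W0) W0 (@gauge_le1 _ _ _).
exists phi => //; apply/eqP => py; move: phiy; rewrite py /= => g0.
apply: Ny; apply: WN; have := @gauge_lt _ _ _ cW W0 y 1; rewrite -g0 invr1 scaleS1; exact.
Qed.

Lemma dual_separates_convex (B : set Y) b0 y : cvx B -> closed B -> B b0 -> ~ B y ->
  exists2 phi, dual_elt phi & exists2 s, s < Re (phi y) & forall b, B b -> Re (phi b) <= s.
Proof.
move=> cB clB Bb0 nBy.
have : nbhs y (~` B) by apply: open_nbhs_nbhs; split => //; exact: closed_openC.
move=> /nbhs_shift0/tame_nbhs[W [W0 cW iW] WB].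
(* [B] is translated to contain 0 and thickened by [W], which makes its gauge finite while [y - b0]
   stays outside. *)
pose D := [set z : Y | exists b v, [/\ B b, W v & z = b - b0 + v]].
have WD v : W v -> D v by move=> Wv; exists b0, v; rewrite subrr add0r.
have nD : nbhs (0 : Y) D by exact: filterS W0.
have cD : cvx D.
  move=> _ _ t t0 t1 [b [v [Bb Wv ->]]] [b' [v' [Bb' Wv' ->]]].
  exists ((1 - t)%:S *: b + t%:S *: b'), ((1 - t)%:S *: v + t%:S *: v'); split.
  - exact: cB.
  - exact: cW.
  rewrite !scalerDr !scalerN addrACA; congr (_ + _).
  by rewrite addrACA -opprD -scalerDl -rmorphD subrK rmorph1 scale1r.
have [phi [dphi le im phiy]] := dual_dominated (y - b0) (gauge_sublinear cD nD) nD (@gauge_le1 _ _ _).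
have g1 : 1 <= gauge D (y - b0).
  rewrite leNgt; apply/negP => /(gauge_lt cD nD); rewrite invr1 scaleS1.
  move=> [b [v [Bb Wv e]]]; apply: (WB (- v)).
    by have := iW _ (iW _ Wv); rewrite scalerA -expr2 sqr_i scaleN1r.
  suff -> : y - v = b by [].
  by rewrite -(subrK b0 y) e addrAC addrK subrK.
have pD x x' : phi (x + x') = phi x + phi x'.
  by have := dphi.1 1 x x'; rewrite scale1r mul1r.
have pB x x' : phi (x - x') = phi x - phi x'.
  by have := dphi.1 (-1) x' x; rewrite scaleN1r mulN1r addrC => ->; rewrite addrC.
(* The strict gap: [b - b0] plus a small multiple of [y - b0] is still in [D], so [phi] on [B] stays
   below its value at [y] by at least [d / 2] on the scale of that value. *)
have [d d0 hd] := nbhs0_absorb (y - b0) W0.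
exists phi => //; exists (1 - d / 2 + Re (phi b0)).
  by move: phiy; rewrite pB ReB; lra.
move=> b Bb; have Wd : W ((d / 2)%:S *: (y - b0)).
  by apply: hd; rewrite nmR ger0_norm; lra.
have := le (b - b0 + (d / 2)%:S *: (y - b0)).
have p0 : phi 0 = 0 by have := pB 0 0; rewrite !subrr.
have pZ r x : Re (phi (r%:S *: x)) = r * Re (phi x).
  by rewrite -[_ *: x]addr0 dphi.1 p0 addr0; exact: ReRM.
rewrite pD pB ReD ReB pZ phiy.
have : gauge D (b - b0 + (d / 2)%:S *: (y - b0)) <= 1.
  by apply: gauge_le1; exists b, ((d / 2)%:S *: (y - b0)).
have : d / 2 <= d / 2 * gauge D (y - b0) by rewrite ler_peMr//; lra.
by lra.
Qed.

Lemma gauge_mul_i W x : tame W -> gauge W (('i%C : Cx R) *: x) <= gauge W x.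
Proof.
move=> [W0 cW iW]; apply/ler_addgt0Pl => e e0; have {}e0 : (0 : R) < e by [].

have g0 := gauge_ge0 W0 x.
apply: gauge_le; first by lra.
rewrite scalerA mulrC -scalerA; apply: iW; apply: gauge_lt => //; lra.
Qed.

(** The factor 2 comes from bounding real and imaginary parts separately. *)
Lemma dual_norming W y : tame W -> exists phi, [/\ dual_elt phi,
  forall x, nm (phi x) <= 2 * gauge W x & gauge W y <= nm (phi y)].
Proof.
move=> tW; have [W0 cW iW] := tW.
have [phi [dphi le im phiy]] := dual_dominated y (gauge_sublinear cW W0) W0 (@gauge_le1 _ _ _).
exists phi; split => //; last first.
  by rewrite -phiy; apply: le_trans (nm_Re _); exact: ler_norm.
have re x : `|Re (phi x)| <= gauge W x.
  rewrite ler_norml le andbT.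
  have := le (('i%C : Cx R) *: (('i%C : Cx R) *: x)).
  have := gauge_mul_i (('i%C : Cx R) *: x) tW; have := gauge_mul_i x tW.
  rewrite scalerA -expr2 sqr_i -[X in phi X]addr0 dphi.1 mulN1r.
  have := dphi.1 (-1) 0 0; rewrite !(scaler0, add0r) mulN1r addNr => ->.
  by rewrite addr0 -[- phi x]sub0r ReB /=; lra.
move=> x; apply: (le_trans (nm_ReIm _)).
have := re x; have := re (('i%C : Cx R) *: x).
have := gauge_mul_i x tW; rewrite im normrN; lra.
Qed.

End Separation.

(** * Weakly bounded sequences are bounded *)

Section Mackey.
Variable R : realType.
Local Notation C := R[i].
Variable Y : tvsType (Cx R).
Local Notation "r %:S" := (r%:C%C : Cx R) (at level 2, format "r %:S").
Implicit Types (x y : Y) (r s t : R) (N W : set Y) (phi : Y -> Cx R).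

Section GlidingHump.
Variables (W : set Y) (z : nat -> Y) (phi : nat -> Y -> Cx R).
Hypothesis tW : tame W.
Hypothesis dphi : forall k, dual_elt (phi k).
Hypothesis phi_le : forall k x, nm (phi k x) <= 2 * gauge W x.
Hypothesis phi_ge : forall k, gauge W (z k) <= nm (phi k (z k)).

(** With ratio 1/8 the tail after term [k], evaluated at [z k], is at most half of the lower bound
    [8 ^ - k * gauge W (z k)] for that term, in spite of the factor 2 in [phi_le]. *)
Let a k : C := (8^-1 ^+ k : R)%:C%C.

(* The sign for which the new term does not cancel against the partial sum. *)
Let sgn (w v : C) : C := if nm v <= nm (w + v) then 1 else - 1.

Let sgn1 w v : nm (sgn w v) = 1.
Proof. by rewrite /sgn; case: ifP; rewrite ?nmN nm1. Qed.

Let sgnP w v : nm v <= nm (w + sgn w v * v).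
Proof.
rewrite /sgn; case: (leP (nm v) (nm (w + v))) => [|h]; first by rewrite mul1r.
have := nm_tri w (w + v) (w - v); rewrite mulN1r.
have -> : w + v - w = v by rewrite addrC addKr.
have -> : w - (w - v) = v by rewrite opprB addrC subrK.
have -> : w + v - (w - v) = 2 * v by ring.
have := nmB (w + v) (w - v).
have -> : w + v - (w - v) = 2 * v by ring.
rewrite nmM nm_nat; lra.
Qed.

Let hump := fix hump k : Y -> C := if k is k'.+1 then
  fun y => hump k' y + sgn (hump k' (z k')) (a k' * phi k' (z k')) * (a k' * phi k' y)
  else fun=> 0.

Let na k : nm (a k) = 8^-1 ^+ k.
Proof. by rewrite nmR ger0_norm// exprn_ge0// invr_ge0. Qed.

Let hump_lin k c x y : hump k (c *: x + y) = c * hump k x + hump k y.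
Proof. by elim: k => [|k IH] /=; [ring|rewrite IH (dphi k).1; ring]. Qed.

Let g0 y : 0 <= gauge W y.
Proof. by have [W0 _ _] := tW; exact: gauge_ge0. Qed.

Let hump_step k y : nm (hump k.+1 y - hump k y) <= 8^-1 ^+ k * (2 * gauge W y).
Proof.
by rewrite /= [_ + _ - _]addrC addKr nmM sgn1 mul1r nmM na ler_wpM2l//.
Qed.

Let hump_tail k y : exists2 l, clim (fun n => hump (k + n) y) l &
  nm (hump k y - l) <= 8^-1 ^+ k * (4 * gauge W y).
Proof.
have [n|l ll] := @geometric_cauchy _ (fun n => hump (k + n) y) (8^-1 ^+ k * (2 * gauge W y)).
  rewrite addnS; apply: (le_trans (hump_step _ _)).
  have p0 : (0 : R) <= 8^-1 ^+ k by rewrite exprn_ge0// invr_ge0.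
  rewrite exprD -!mulrA; apply: (ler_wpM2l p0).
  rewrite [leRHS]mulrA [leRHS]mulrC; apply: ler_wpM2r; first by rewrite mulr_ge0.
  by apply: lerXn2r; rewrite ?nnegrE ?invr_ge0// lef_pV2 ?posrE// ler_nat.
move=> /(_ 0%N); rewrite addn0 expr0 mulr1 => h; exists l => //.
by apply: (le_trans h); lra.
Qed.

(** The partial sums converge pointwise, uniformly in terms of the gauge, so the limit is
    continuous. At [z k] the sign choice keeps the partial sum at least as large as its last term,
    and the tail takes away at most half. *)
Lemma gliding_hump : exists2 S : Y -> Cx R, dual_elt S &
  forall k, 8^-1 ^+ k * gauge W (z k) <= 2 * nm (S (z k)).
Proof.
have [S hS] := choice (fun y => let: ex_intro2 l h _ := hump_tail 0 y in ex_intro _ l h).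
have tail k y : nm (hump k y - S y) <= 8^-1 ^+ k * (4 * gauge W y).
  have [l ll h] := hump_tail k y; suff -> : S y = l by [].
  apply: clim_uniq (hS y) _ => e e0; have [M hM] := ll _ e0; exists (k + M)%N => n kn.
  by rewrite add0n -(subnKC (leq_trans (leq_addr _ _) kn)); apply: hM; rewrite leq_subRL ?(leq_trans (leq_addr _ _) kn).
have [W0 cW iW] := tW.
exists S; first apply: (@dual_bounded _ _ _ W 4) => //.
- move=> c x y; apply: clim_uniq (hS _) _.
  apply: clim_ext (climD (climZ c (hS x)) (hS y)) => n; by rewrite hump_lin.
- move=> y Wy; have := tail 0%N y; rewrite /= sub0r nmN expr0 mul1r.
  by have := gauge_le1 Wy; lra.
move=> k; have := tail k.+1 (z k); rewrite exprS /=.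
set w := hump k (z k); set v := a k * _.
have := sgnP w v; have := nmD (S (z k)) (w + sgn w v * v - S (z k)).
rewrite addrC subrK.
have : 8^-1 ^+ k * gauge W (z k) <= nm v.
  by rewrite nmM na ler_wpM2l// exprn_ge0// invr_ge0.
have : 8^-1 * 8^-1 ^+ k * (4 * gauge W (z k)) = 8^-1 ^+ k * gauge W (z k) / 2 by field.
lra.
Qed.

End GlidingHump.

(** Were the gauges unbounded, one could pick terms with gauge above [16 ^ k]; the functional of
    [gliding_hump] would exceed [16 ^ k * 8 ^ - k / 2 = 2 ^ k / 2] on them. *)
Lemma mackey W (y : nat -> Y) : tame W ->
  (forall phi, dual_elt phi -> exists B : R, forall n, nm (phi (y n)) <= B) ->
  exists B : R, forall n, gauge W (y n) <= B.
Proof.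
move=> tW hb; apply: contrapT => H.
have ex k : exists n, 16 ^+ k < gauge W (y n).
  apply: contrapT => nk; apply: H; exists (16 ^+ k) => n; rewrite leNgt; apply/negP => h.
  by apply: nk; exists n.
have [m hm] := choice ex.
have [phi hphi] := choice (fun k => @dual_norming _ _ _ (y (m k)) tW).
have [|||S dS hS] := @gliding_hump W (y \o m) phi tW; [by move=> k; case: (hphi k)..|].
have [B hB] := hb S dS.
have /archi_boundP : 0 <= `|2 * B| by [].
set k := Num.bound _ => kB.
have := hS k; have := hB (m k); have := hm k; have := ler_norm (2 * B) => /=.
have : 8^-1 ^+ k * 16 ^+ k = (2 ^ k)%:R :> R.
  by rewrite -exprMn natrX; congr (_ ^+ _); field.
have : (k%:R : R) < (2 ^ k)%:R by rewrite ltr_nat ltn_expl.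
have p0 : (0 : R) < 8^-1 ^+ k by rewrite exprn_gt0// invr_gt0.
move=> h1 h2 h3; rewrite -(ltr_pM2l p0); lra.
Qed.

End Mackey.

(** * The extension of vector-valued functions *)

Section VectorIntegral.
Variable R : realType.
Local Notation C := R[i].
Local Notation "r %:S" := (r%:C%C : Cx R) (at level 2, format "r %:S").

Lemma holo_lipschitz (F : C -> C) o (r : R) : 0 < r ->
  (forall w, nm (w - o) < r -> cdiff F w) ->
  exists2 s : R, 0 < s & exists2 L : R, 0 <= L &
    forall z z', nm (z - o) < s -> nm (z' - o) < s -> nm (F z' - F z) <= L * nm (z' - z).
Proof.
move=> r0 dF; have r4 : 0 < r / 4 by rewrite divr_gt0.
have sq : sqdom [set w | nm (w - o) <= r / 2] o (r / 4) by apply: sqdom_disc => //; lra.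
have dF' w : nm (w - o) <= r / 2 -> cdiff F w by move=> h; apply: dF; lra.
have s2 : 2 * (r / 4) <= r / 2 by lra.
have [M M0 hM] := sides_bounded (ltW r4) s2 (fun w h => cdiff_cont (dF' w h)).
exists (r / 4 / 2); first by rewrite divr_gt0.
exists (K0 R * M * (2 / (r / 4))).
  apply: mulr_ge0; first by apply: mulr_ge0 => //; rewrite ltW// K0_gt0.
  by apply: divr_ge0 => //; exact: ltW.
by move=> z z' /ltW hz /ltW hz'; exact: (cauchy_lip r4 sq M0 dF' hM).
Qed.

Lemma av_stepS n (F : C -> C) p q : @av _ C^o n.+2 F p q - @av _ C^o n.+1 F p q =
  2^-1 * ((@av _ C^o n.+1 F p (mid p q) - @av _ C^o n F p (mid p q)) +
          (@av _ C^o n.+1 F (mid p q) q - @av _ C^o n F (mid p q) q)).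
Proof.
rewrite -[LHS]/(2^-1 * (@av _ C^o n.+1 F p (mid p q) + @av _ C^o n.+1 F (mid p q) q) -
  2^-1 * (@av _ C^o n F p (mid p q) + @av _ C^o n F (mid p q) q)); ring.
Qed.

(** Locally the integrand is Lipschitz, and the increment shrinks with the length of the pieces. The
    rate survives concatenation because an increment over the whole is the mean of the preceding
    increments over the halves. *)
Lemma av_step_bound (E : set C) (F : C -> C) p q : cconv E -> E p -> E q ->
  (forall z, E z -> exists2 r : R, 0 < r & forall w, nm (w - z) < r -> cdiff F w) ->
  exists L : R, forall n, nm (@av _ C^o n.+1 F p q - @av _ C^o n F p q) <= L * 2^-1 ^+ n.
Proof.
move=> cE Ep Eq hF; move: p q Ep Eq.
apply: (@cousin_seg _ E (fun p q => exists L : R, forall n,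
  nm (@av _ C^o n.+1 F p q - @av _ C^o n F p q) <= L * 2^-1 ^+ n)) => //.
  move=> p q _ _ [L hL] [L' hL'].
  (* The first increment over the whole is not controlled by the halves and is added to the
     constant. *)
  exists (L + L' + nm (@av _ C^o 1 F p q - @av _ C^o 0 F p q)) => -[|n].
    rewrite expr0 mulr1; have := hL 0%N; have := hL' 0%N; rewrite expr0 !mulr1.
    set x := nm (av 1 F p (mid p q) - _); set y := nm (av 1 F (mid p q) q - _).
    by have x0 : 0 <= x := nm_ge0 _; have y0 : 0 <= y := nm_ge0 _; lra.
  rewrite av_stepS nmM nm_half exprS mulrCA ler_pM2l ?invr_gt0//; apply: (le_trans (nmD _ _)).
  have := hL n; have := hL' n => h1 h2.
  rewrite mulrDl -[leLHS]addr0 lerD ?mulr_ge0 ?nm_ge0 ?exprn_ge0 ?invr_ge0//.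
  by rewrite mulrDl lerD.
move=> z /hF[r r0 /(holo_lipschitz r0)[s s0 [L L0 hL]]]; exists s => // p q _ _ ps qs.
have mD : midclosed [set w | nm (w - z) < s].
  move=> x y /= hx hy; have := sg_near hx hy; apply; exists 2^-1; first lra.
  by rewrite half_real /mid; field.
exists (L * nm (q - p)) => n.
elim: n p q ps qs => [|n IH] p q ps qs.
- have mpq := mD _ _ ps qs; have ml := mD _ _ ps mpq; have mr := mD _ _ mpq qs.
  rewrite expr0 mulr1 /=.
  have -> : 2^-1 *: (F (mid p (mid p q)) + F (mid (mid p q) q)) - F (mid p q) =
     2^-1 * ((F (mid p (mid p q)) - F (mid p q)) + (F (mid (mid p q) q) - F (mid p q))) :> C.
    by rewrite -[_ *: _]/(2^-1 * _); field.
  rewrite nmM nm_half; have := nmD (F (mid p (mid p q)) - F (mid p q)) (F (mid (mid p q) q) - F (mid p q)).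
  have := hL _ _ mpq ml; have := hL _ _ mpq mr.
  have -> : mid p (mid p q) - mid p q = - (4^-1 * (q - p)) by rewrite /mid; field.
  have -> : mid (mid p q) q - mid p q = 4^-1 * (q - p) by rewrite /mid; field.
  rewrite nmN nmM nmV nm_nat; have : 0 <= L * nm (q - p) by rewrite mulr_ge0 ?nm_ge0.
  lra.
- have mpq := mD _ _ ps qs.
  rewrite av_stepS nmM nm_half exprS mulrCA ler_pM2l ?invr_gt0//; apply: (le_trans (nmD _ _)).
  have := IH _ _ ps mpq; have := IH _ _ mpq qs.
  have -> : mid p q - p = 2^-1 * (q - p) by rewrite /mid; field.
  have -> : q - mid p q = 2^-1 * (q - p) by rewrite /mid; field.
  rewrite nmM nm_half; lra.
Qed.

Variable Y : tvsType (Cx R).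
Implicit Types (W : set Y) (phi : Y -> Cx R).

Lemma tvs_geometric (v : nat -> Y) : seq_complete Y ->
  (forall phi, dual_elt phi -> exists L : R, forall n, nm (phi (v n.+1 - v n)) <= L * 2^-1 ^+ n) ->
  exists y : Y, v @ \oo --> y.
Proof.
move=> sc hv; apply: sc => N /tame_nbhs[W tW WN].
have [W0 cW _] := tW; have [gD gZ] := gauge_sublinear cW W0.
have p0 n : (0 : R) < 2^-1 ^+ n by rewrite exprn_gt0// invr_gt0.
have [|B hB] := @mackey _ _ W (fun n => (2 ^+ n)%:S *: (v n.+1 - v n)) tW.
  move=> phi dphi; have [L hL] := hv phi dphi; exists L => n.
  have p00 : phi 0 = 0.
    have := dphi.1 1 0 0; rewrite scaler0 add0r mul1r => /(congr1 (fun z => z - phi 0)).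
    by rewrite subrr addrK => <-.
  rewrite -[_ *: _]addr0 dphi.1 p00 addr0 nmM nmR ger0_norm ?exprn_ge0//.
  by rewrite -ler_pdivlMl ?exprn_gt0// mulrC -exprVn; exact: hL.
have step n : gauge W (v n.+1 - v n) <= B * 2^-1 ^+ n.
  have := hB n; rewrite gZ ?exprn_gt0// => h.
  by rewrite exprVn ler_pdivlMr ?exprn_gt0// mulrC.
have g00 : gauge W 0 = 0 by exact: (sublinear0 (gauge_sublinear cW W0)).
have tele n m : gauge W (v (n + m)%N - v n) <= 2 * B * (2^-1 ^+ n - 2^-1 ^+ (n + m)).
  elim: m => [|m IH]; first by rewrite addn0 !subrr mulr0 g00.
  rewrite addnS -(subrK (v (n + m)%N) (v (n + m).+1)) -addrA.
  apply: (le_trans (gD _ _)); have := step (n + m)%N; rewrite (exprS _ (n + m)); lra.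
have B0 : 0 <= B by have := step 0%N; have := gauge_ge0 W0 (v 1%N - v 0%N); rewrite expr0; lra.
have [||n0 hn0] := @geom_small R (2 * B) 2^-1 1 _ _ ltr01.
- by rewrite invr_ge0.
- by rewrite invf_lt1// ltr1n.
exists n0 => m n.
have gN x : gauge W (- x) <= gauge W x.
  apply: le_trans (gauge_mul_i x tW); apply: le_trans (gauge_mul_i _ tW).
  by rewrite scalerA -expr2 sqr_i scaleN1r.
have small k l : (n0 <= k)%N -> gauge W (v (k + l)%N - v k) < 1.
  move=> n0k; apply: (le_lt_trans (tele _ _)); apply: le_lt_trans hn0.
  apply: ler_wpM2l; first by rewrite mulr_ge0.
  apply: (@le_trans _ _ (2^-1 ^+ k)); first by rewrite gerBl ltW.
  by apply: ler_wiXn2l => //; rewrite ?invr_ge0// invf_le1// ler1n.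
have fin x : gauge W x < 1 -> N x.
  by move=> /(gauge_lt cW W0); rewrite invr1 scaleS1; exact: WN.
move=> hm hn; apply: fin; have [mn|/ltnW nm] := leqP m n.
  by rewrite -opprB; apply: (le_lt_trans (gN _)); rewrite -(subnKC mn); exact: small.
by rewrite -(subnKC nm); exact: small.
Qed.

Lemma av_cvg (E : set C) (h : C -> Y) p q : seq_complete Y -> cconv E -> E p -> E q ->
  (forall phi, dual_elt phi -> forall z, E z ->
     exists2 r : R, 0 < r & forall w, nm (w - z) < r -> cdiff (fun w => phi (h w)) w) ->
  exists y : Y, (fun n => av n h p q) @ \oo --> y.
Proof.
move=> sc cE Ep Eq hh; apply: tvs_geometric => // phi dphi.
have [L hL] := av_step_bound cE Ep Eq (hh phi dphi); exists L => n.
have pB x x' : phi (x - x') = phi x - phi x'.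
  by have := dphi.1 (-1) x' x; rewrite scaleN1r mulN1r addrC => ->; rewrite addrC.
by rewrite pB !(av_lin (W := C^o) _ _ _ _ dphi.1); exact: hL.
Qed.

End VectorIntegral.

(** * From condition (i) to compact and stable slices *)

Section SliceCompactness.
Variable R : realType.
Local Notation C := R[i].
Variable X : lmodType (Cx R).
Variables (Omega K : set X) (u : X).
Hypothesis u0 : u != 0.
Hypothesis compK : forall a v : X, Omega a ->
  exists eps : R, 0 < eps /\ compact_in_Laff2 a u v (K `&` Laff2_eps a u v eps).

Lemma slice_ccompact a : Omega a -> ccompact [set z : C | K (a + z *: u)].
Proof.
(* With [v = u] the affine space degenerates to a line, and the condition gives compactness of the
   slice itself. *)
move=> /(compK u)[eps [e0 [[ind _]|[_ cS]]]].
  have [|/eqP] := ind 1 (-1); first by rewrite scale1r scaleN1r subrr.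
  by rewrite oner_eq0.
apply: compact_ccompact; suff <- : [set lam : Cx R | (K `&` Laff2_eps a u u eps) (a + lam *: u)] =
    [set z | K (a + z *: u)] by [].
apply/seteqP; split => z /=; first by case.
move=> Kz; split => //; exists z, 0; rewrite scale0r addr0 normr0; split => //.
by rewrite lecR ltW.
Qed.

(** In the compact set of pairs, points with second coordinate 0 have first coordinate in [O], and
    near any other point the second coordinate is bounded away from 0. If [v] is a multiple of [u],
    the slices are translates of one compact slice. *)
Lemma compact_slice_stable a v : Omega a -> slice_stable K u a v.
Proof.
move=> Oa O openO KO; have [eps [e0 [[ind cS]|[nind _]]]] := compK v Oa; last first.
  have [t [c [c' [eu ev]]]] := dependent_line nind.
  have c0 : c != 0 by apply: contraNneq u0 => c0; rewrite eu c0 scale0r.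
  have vu : v = (c' / c) *: u by rewrite eu scalerA divfK.
  set s := c' / c in vu.
  have [||r r0 hr] := slice_ccompact Oa
      (P := fun r w => forall w', nm (w' - w) < r -> O w').
  - by move=> r r' z r'0 rr' h w /lt_le_trans/(_ rr'); exact: h.
  - move=> z /KO/openO[r r0 hr]; exists (r / 2); first by rewrite divr_gt0.
    by move=> w hw w' hw'; apply: hr; have := nm_tri w w' z; lra.
  have s1 : 0 < nm s + 1 by have := nm_ge0 s; lra.
  exists (r / (nm s + 1)); first by rewrite divr_gt0.
  move=> l z; rewrite ltr_pdivlMr// => lr Kz.
  apply: (hr (l * s + z)).
    by rewrite /= scalerDl addrA -scalerA -vu.
  rewrite opprD addrCA subrr addr0 nmN nmM; apply: le_lt_trans lr.
  by rewrite ler_wpM2l ?nm_ge0//; lra.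
have [||r r0 hr] := compact_ccompact2 cS (P := fun r p => nm p.2 < r -> O p.1).
- by move=> r r' p r'0 rr' h /lt_le_trans/(_ rr'); exact: h.
- move=> [z l] /= [Kp _]; have [l0|l0] := eqVneq l 0.
    have /KO/openO[r r0 hr] : K (a + z *: u) by move: Kp; rewrite l0 scale0r addr0.
    by exists r => // -[z' l'] /= h _ _; exact: hr.
  have lp : 0 < nm l by rewrite nm_gt0.
  exists (nm l / 2); first by rewrite divr_gt0.
  move=> [z' l'] /= _ h h'; have := nm_tri l' l 0; rewrite !subr0 nmBC; lra.
exists (Num.min r eps); first by rewrite lt_min r0.
move=> l z; rewrite lt_min => /andP[lr le] Kz.
apply: (hr (z, l)) => //=; split; first by rewrite addrAC.
by exists z, l; rewrite nmE lecR ltW.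
Qed.

End SliceCompactness.

Section WeakHolomorphy.
Variable R : realType.
Local Notation C := R[i].
Variables (X : lmodType (Cx R)) (Y : tvsType (Cx R)).
Implicit Types (A : set X) (f : X -> Y) (phi : Y -> Cx R).

Lemma HG_GH A f phi : HG A f -> dual_elt phi -> GH A (fun x => phi (f x)).
Proof.
move=> hf dphi a v Aa; have [r [r0 h]] := hf a v phi Aa dphi.
by have [|_ /derivable_cdiff] := h 0; rewrite ?normr0 ?ltcR.
Qed.

Lemma GH_HG A f : plane_open A ->
  (forall phi, dual_elt phi -> GH A (fun x => phi (f x))) -> HG A f.
Proof.
move=> pA h a v phi Aa dphi; have [r r0 hr] := plane_line v pA Aa.
exists r; split => // z; rewrite nmE ltcR => zr; split; first exact: hr.
by apply/derivable_cdiff; apply: (GH_at (h phi dphi)); exact: hr.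
Qed.

Lemma GH_eq A (g h : X -> C) : plane_open A -> (forall x, A x -> g x = h x) -> GH A g -> GH A h.
Proof.
move=> pA e hg a v Aa; have [r r0 hr] := plane_line v pA Aa.
apply: (cdiff_near r0 _ (hg a v Aa)) => w; rewrite subr0 => wr.
by apply: e; exact: hr.
Qed.

End WeakHolomorphy.

Section VectorExtension.
Variable R : realType.
Local Notation C := R[i].
Local Notation "r %:S" := (r%:C%C : Cx R) (at level 2, format "r %:S").
Variable X : lmodType (Cx R).
Variables (Omega K : set X) (u : X).
Hypotheses (KO : K `<=` Omega) (pO : plane_open Omega) (pA : plane_open (Omega `\` K)).
Hypothesis cK : forall a, Omega a -> ccompact [set z : C | K (a + z *: u)].
Hypothesis sK : forall a v, Omega a -> slice_stable K u a v.
Hypothesis polyA : polygonally_connected (Omega `\` K).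
Variable c : X.
Hypotheses (Oc : Omega c) (cfree : forall z : C, ~ K (c + z *: u)).

Let Ac : (Omega `\` K) c.
Proof. by split => // Kc; apply: (cfree (z := 0)); rewrite scale0r addr0. Qed.

Section Valued.
Variable Y : tvsType (Cx R).
Hypotheses (hY : hausdorff_space Y) (scY : seq_complete Y).
Variable f : X -> Y.
Hypothesis hf : HG (Omega `\` K) f.
Implicit Types phi : Y -> Cx R.

Let extphi phi := ext KO pO cK (fun x => phi (f x)).

Lemma dual_clim phi (v : nat -> Y) y : dual_elt phi -> v @ \oo --> y ->
  clim (fun n => phi (v n)) (phi y).
Proof.
move=> [_ cphi] vy e e0.
have : nbhs (phi y) [set w : Cx R | nm (w - phi y) <= e].
  by apply/nbhs_nmP; exists e => // w /ltW.
by move=> /(cphi y)/vy[N _ hN]; exists N => n /hN.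
Qed.

Lemma dual_sum phi (I : eqType) (r : seq I) (k : I -> Cx R) (y : I -> Y) : dual_elt phi ->
  phi (\sum_(i <- r) k i *: y i) = \sum_(i <- r) k i * phi (y i).
Proof.
move=> [lin _]; elim: r => [|i r IH]; last by rewrite !big_cons lin IH.
by rewrite !big_nil; have := lin (-1) 0 0; rewrite scaler0 add0r mulN1r addNr.
Qed.

(** The contour depends on [a] only, not on [phi]. A single vector, assembled from the limits over
    its edges, therefore has the scalar extensions as its images under all functionals at once. *)
Lemma weak_extension : exists g : X -> Y, forall a phi, Omega a -> dual_elt phi ->
  phi (g a) = extphi phi a.
Proof.
have ex (p : X * (C * (C * C))) : exists y : Y, Omega p.1 -> p.2 \in gamma KO pO cK p.1 ->
    (fun n => av n (fun z => z^-1 *: f (p.1 + z *: u)) p.2.2.1 p.2.2.2) @ \oo --> y.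
  case: p => a e /=; have [Oa|nO] := pselect (Omega a); last by exists 0.
  have [eG|nG] := boolP (e \in gamma KO pO cK a); last by exists 0.
  have [E [cE E1 E2 hE]] := gamma_edge Oa eG.
  have [phi dphi z Ez|y hy] := av_cvg (h := fun z => z^-1 *: f (a + z *: u)) scY cE E1 E2; last by exists y.
  have [Az z0] := hE z Ez; have [r r0 hr] := slice_open pA Az.
  exists (Num.min r (nm z)); first by rewrite lt_min r0 nm_gt0.
  move=> w; rewrite lt_min => /andP[/hr Aw wz].
  have w0 : w != 0 by apply: contraTneq wz => ->; rewrite sub0r nmN ltxx.
  have -> : (fun w => phi (w^-1 *: f (a + w *: u))) = (fun w => w^-1 * phi (f (a + w *: u))).
    apply/funext => w'; have := dphi.1 w'^-1 (f (a + w' *: u)) 0.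
    have := dphi.1 (-1) 0 0; rewrite scaler0 add0r mulN1r addNr => ->.
    by rewrite !addr0.
  by apply: cdiffM; [exact: cdiff_inv|exact: (GH_at (HG_GH hf dphi) Aw)].
have [y hy] := choice ex.
exists (fun a => kappa^-1 *: \sum_(e <- gamma KO pO cK a) (e.1 * (e.2.2 - e.2.1)) *: y (a, e)).
move=> a phi Oa dphi; rewrite /extphi extE//.
have p0 : phi 0 = 0 by have := dphi.1 (-1) 0 0; rewrite scaler0 add0r mulN1r addNr.
rewrite -[_ *: _]addr0 dphi.1 p0 addr0 dual_sum//; congr (_ * _).
apply: eq_big_seq => e eG; rewrite -[LHS]mulrA; congr (_ * _).
rewrite (J_lim (l := phi (y (a, e))))//.
apply: clim_ext (dual_clim dphi (hy (a, e) Oa eG)) => n /=.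
rewrite (av_lin (W := C^o) _ _ _ _ dphi.1); congr (av n _ _ _); apply/funext => z.
by rewrite -[_ *: _]addr0 dphi.1 p0 addr0 mulrC.
Qed.

Lemma dual_agree (g h : X -> Y) : HG Omega g -> HG Omega h ->
  (forall x, (Omega `\` K) x -> g x = h x) -> forall x, Omega x -> g x = h x.
Proof.
move=> hg hh e x Ox; apply/eqP; rewrite -subr_eq0; apply: contrapT => /negP.
move=> /(dual_separates hY)[phi dphi]; apply/negP; rewrite negbK.
have := dphi.1 (-1) (h x) (g x); rewrite scaleN1r addrC => ->.
rewrite mulN1r addrC subr_eq0; apply/eqP.
by apply: (GH_unique pO cK KO (HG_GH hg dphi) (HG_GH hh dphi)) => // z /e ->.
Qed.

Theorem vector_extension : exists g : X -> Y,
  [/\ HG Omega g, forall x, (Omega `\` K) x -> g x = f x &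
      g @` Omega `<=` closed_conv_hull (f @` (Omega `\` K))].
Proof.
have [g hg] := weak_extension; exists g.
have gGH phi : dual_elt phi -> GH Omega (fun x => phi (g x)).
  move=> dphi; apply: (@GH_eq _ _ _ (extphi phi)) => //; first by move=> x Ox; rewrite hg.
  by apply: ext_GH => //; exact: HG_GH.
have gf x : (Omega `\` K) x -> g x = f x.
  move=> Ax; apply/eqP; rewrite -subr_eq0; apply: contrapT => /negP.
  move=> /(dual_separates hY)[phi dphi]; apply/negP; rewrite negbK.
  have := dphi.1 (-1) (f x) (g x); rewrite scaleN1r addrC => ->.
  rewrite mulN1r addrC subr_eq0 hg//; last by case: Ax.
  by apply/eqP; apply: (ext_agree KO pO pA cK sK polyA Oc cfree) => //; exact: HG_GH.
split => //; first exact: GH_HG.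
move=> _ [a Oa <-] B fB cB clB; apply: contrapT => nB.
have [phi dphi [s sg hs]] := dual_separates_convex (convex_set_cvx cB) clB (fB _ (ex_intro2 _ _ c Ac erefl)) nB.
have [e /(gamma_edge Oa)[E [cE E1 E2 hE]]|D D0 hD] :=
  @cyc_bounded _ (fun z => phi (f (a + z *: u))) (gamma KO pO cK a).
  exists E; split => // z /hE[Az _]; apply: cdiff_cont.
  exact: (GH_at (HG_GH hf dphi) Az).
(* On the contour [phi o f + T] lies in the disc of radius [sqrt Q], while at [a] it does not once
   [T] is large. *)
pose rho := Re (phi (g a)) - s; have r0 : 0 < rho by rewrite /rho; lra.
pose T : R := `|s| + D + D ^+ 2 / rho.
have D2 : 0 <= D ^+ 2 / rho by rewrite divr_ge0 ?sqr_ge0// ltW.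
have sT : D ^+ 2 / rho <= s + T by have := ler_norm (- s); rewrite normrN /T; lra.
have TD : D <= T by rewrite /T; have := normr_ge0 s; lra.
have nmE2 (z : C) : nm z ^+ 2 = Re z ^+ 2 + Im z ^+ 2.
  by case: z => x y; rewrite /nm/= sqr_sqrtr// addr_ge0 ?sqr_ge0.
pose Q : R := (s + T) ^+ 2 + D ^+ 2.
have Q0 : 0 <= Q by rewrite addr_ge0// sqr_ge0.
have : nm (phi (g a) + T%:C%C) <= Num.sqrt Q.
  apply: (@contour_max R X Omega K u KO pO cK (fun x => phi (g x) + T%:C%C) a (Num.sqrt Q)); [|by []|exact: sqrtr_ge0|].
    by move=> x v Ox; apply: cdiffD; [exact: gGH|exact: cdiff_cst].
  move=> e z eG ez; have [Az _] := gamma_sg Oa eG ez.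
  have h1 := hs _ (fB _ (ex_intro2 _ _ _ Az erefl)); have h2 := hD e z eG ez.
  rewrite gf//; set w := phi _ in h1 h2 *.
  rewrite -(ler_pXn2r (ltn0Sn 1)) ?nnegrE ?nm_ge0 ?sqrtr_ge0// sqr_sqrtr//.
  rewrite nmE2 ReD ImD /= addr0 /Q.
  have h3 := le_trans (nm_Re w) h2; have h4 := le_trans (nm_Im w) h2.
  apply: lerD.
    rewrite ler_pXn2r ?nnegrE//; move: h3; rewrite ler_norml => /andP[h3 _]; lra.
  by rewrite -(real_normK (num_real (Im w))) ler_pXn2r ?nnegrE.
rewrite -(ler_pXn2r (ltn0Sn 1)) ?nnegrE ?nm_ge0 ?sqrtr_ge0// sqr_sqrtr//.
rewrite nmE2 ReD ImD /= addr0 /Q.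
have -> : Re (phi (g a)) = s + rho by rewrite /rho addrC subrK.
have i0 := sqr_ge0 (Im (phi (g a))).
(* The cross term [2 * rho * (s + T)] of the square is at least [2 * D ^ 2], whereas [Q] allows only
   [D ^ 2]. *)
move: sT; rewrite ler_pdivrMr// => sT.
have rr : 0 < rho ^+ 2 by rewrite exprn_gt0.
rewrite -[X in X ^+ 2 + _ <= _]addrA [rho + T]addrC addrA sqrrD -mulr_natl.
by have := sqr_ge0 D; lra.
Qed.

End Valued.

Lemma dual_id : dual_elt (fun z : Cx R => z).
Proof. by split => // x; exact: cvg_id. Qed.

Lemma extension_range (f g : X -> Cx R) : HG (Omega `\` K) f -> HG Omega g ->
  (forall x, (Omega `\` K) x -> g x = f x) -> g @` Omega = f @` (Omega `\` K).
Proof.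
move=> hf hg gf; apply/seteqP; split => [_ [a Oa <-]|_ [x Ax <-]]; last first.
  by exists x; [case: Ax|exact: gf].
apply: contrapT => nfa.
have Gf := HG_GH hf dual_id; have Gg := HG_GH hg dual_id.
have nz x : (Omega `\` K) x -> f x - g a != 0.
  by move=> Ax; rewrite subr_eq0; apply/eqP => e; apply: nfa; exists x.
have Gi : GH (Omega `\` K) (fun x => (f x - g a)^-1).
  move=> x v Ax; apply: (cdiffV (h := fun l => f (x + l *: v) - g a)); first by rewrite scale0r addr0 nz.
  by apply: cdiffB; [exact: Gf|exact: cdiff_cst].
pose h := ext KO pO cK (fun x => (f x - g a)^-1).
have := GH_unique pO cK KO (g := fun x => h x * (g x - g a)) (h := fun=> 1) _ _ _ Oa.
rewrite subrr mulr0 => H; have : (0 : C) = 1.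
  apply: H.
  - move=> x v Ox; apply: cdiffM; first exact: ext_GH.
    by apply: cdiffB; [exact: Gg|exact: cdiff_cst].
  - by move=> x v _; exact: cdiff_cst.
  - move=> x Ax; rewrite gf// /h (ext_agree KO pO pA cK sK polyA Oc cfree)//.
    by rewrite mulVf// nz.
by move/eqP; rewrite eq_sym oner_eq0.
Qed.

End VectorExtension.

Theorem mainTheorem19 (R : realType) (X : lmodType (Cx R))
    (Omega K : set X) (u : X) :
  dim_ge2 X ->
  K `<=` Omega ->
  two_open Omega ->
  two_open (Omega `\` K) ->
  polygonally_connected (Omega `\` K) ->
  u != 0 ->
  (forall a v : X, Omega a ->
     exists eps : R, 0 < eps /\
       compact_in_Laff2 a u v (K `&` Laff2_eps a u v eps)) ->
  (exists c : X, Omega c /\ K `&` Laff1 c u = set0) ->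
  (forall Y : tvsType (Cx R),
     hausdorff_space Y -> seq_complete Y -> (exists y : Y, y != 0) ->
     forall f : X -> Y, HG (Omega `\` K) f ->
       exists g : X -> Y,
         [/\ HG Omega g,
             (forall x, (Omega `\` K) x -> g x = f x),
             (forall h : X -> Y, HG Omega h ->
                (forall x, (Omega `\` K) x -> h x = f x) ->
                forall x, Omega x -> h x = g x) &
             g @` Omega `<=` closed_conv_hull (f @` (Omega `\` K))]) /\
  (forall f : X -> Cx R, HG (Omega `\` K) f ->
     forall g : X -> Cx R, HG Omega g ->
       (forall x, (Omega `\` K) x -> g x = f x) ->
       g @` Omega = f @` (Omega `\` K)).
Proof.
move=> _ KO oO oA polyA u0 compK [c [Oc cK0]].
have cfree (z : R[i]) : ~ K (c + z *: u).
  by move=> Kz; rewrite -[False]/(set0 (c + z *: u)) -cK0; split => //; exists z.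
have pO := two_open_plane oO; have pA := two_open_plane oA.
have cK a : Omega a -> ccompact [set z : R[i] | K (a + z *: u)] by exact: slice_ccompact.
have sK a v : Omega a -> slice_stable K u a v by exact: compact_slice_stable.
split=> [Y hY scY _ f hf|f hf g hg]; last exact: (extension_range KO pO pA cK sK polyA Oc cfree).
have [g [hg gf hull]] := vector_extension KO pO pA cK sK polyA Oc cfree hY scY hf.
exists g; split => // h hh hf'; apply: (dual_agree KO pO cK hY hh hg) => x Ax.
by rewrite hf' // gf.
Qed.
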